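(* Let $M$ be a locally compact separable metric space and let $(\mathsf{P}^{(n)}: n\geq 1)$ be a consistent sequence of Feller transition functions on $M$. There exists a unique Feller convolution semigroup $(\nu_t:t\geq 0)$ in the space of kernels on $M$ such that for all $n\geq 1$, $x=(x_1,\ldots,x_n)\in M^n$, $B\in\mathcal{B}(M^n)$ and $t\geq 0$, $$\mathsf{P}^{(n)}_t(x,B)=\int_E \left(\otimes^n_{i=1}K(x_i)\right)(B)\,\nu_t(dK).$$ Moreover, there exists a mapping $\mathfrak{p}:E\to E$ which is a measurable presentation of every measure $\nu_t$, $t\geq 0$, and satisfies the relation $\mathfrak{p}\circ \mathfrak{p}=\mathfrak{p}$.
   Context: For a locally compact separable metric space $X$, $C_0(X)$ is the space of continuous functions on $X$ vanishing at infinity, with the sup norm, $\mathcal{B}(X)$ is the Borel $\sigma$-field and $\mathcal{P}(X)$ is the space of Borel probability measures on $X$ with the topology of weak convergence and its Borel $\sigma$-field. A Feller transition function on $X$ is a family $(\mathsf{P}_t:t\geq 0)$ of probability transition kernels on $X$ with $\mathsf{P}_0(x)=\delta_x$, satisfying the Chapman-Kolmogorov equation, with $\mathsf{P}_t(C_0(X))\subset C_0(X)$ and $\|\mathsf{P}_tf-f\|\to 0$ as $t\to 0+$ for every $f\in C_0(X)$. Consistent sequence: for $1\leq k\leq n$ let $S_{k,n}$ be the set of all injections $\sigma:\{1,\ldots,k\}\to\{1,\ldots,n\}$, and let $\pi_\sigma x=(x_{\sigma(1)},\ldots,x_{\sigma(k)})$ for $x\in M^n$. A sequence $(\mathsf{P}^{(n)}:n\geq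 1)$, where $\mathsf{P}^{(n)}$ is a Feller transition function on $M^n$, is a consistent sequence of Feller transition functions on $M$ if $\mathsf{P}^{(n)}_t(x)\circ\pi_\sigma^{-1}=\mathsf{P}^{(k)}_t(\pi_\sigma x)$ for all $1\leq k\leq n$, $\sigma\in S_{k,n}$, $x\in M^n$, $t\geq 0$. Kernels: a kernel on $M$ is a measurable mapping $K:M\to\mathcal{P}(M)$; $E$ is the set of all kernels on $M$, and $\mathcal{E}$ is the smallest $\sigma$-field on $E$ making all mappings $K\mapsto K(x)\in\mathcal{P}(M)$, $x\in M$, measurable. We write $K_1K_2(x)=\int_M K_2(y)K_1(x,dy)$ and $Kf(x)=\int_M f(y)K(x,dy)$. Regular measures: a probability measure $\nu$ on $(E,\mathcal{E})$ is regular if there is a mapping $\mathfrak{p}:E\to E$ such that $E\times M\ni(K,x)\mapsto\mathfrak{p}(K)(x)\in\mathcal{P}(M)$ is measurable and, for every $x\in M$, $\mathfrak{p}(K)(x)=K(x)$ for $\nu$-a.a. $K$. Such a $\mathfrak{p}$ is called a measurable presentation of $\nu$. For regular $\nu_1,\nu_2$ and a measurable presentation $\mathfrak{p}$ of $\nu_2$, the convolution $\nu_1*\nu_2$ is the distribution of $(K_1,K_2)\mapsto K_1\mathfrak{p}(K_2)$ under $\nu_1\otimes\nu_2$ (it does not depend on the choice of $\mathfrak{p}$). A Feller convolution semigroup in the space of kernels on $M$ is a family $(\nu_t:t\geq 0)$ of regular probability measures on $(E,\mathcal{E})$ such that: (1) $\nu_t*\nu_s=\nu_{t+s}$ for all $t,s\geq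 0$; (2) for all $f\in C_0(M)$ and $\varepsilon>0$, $\lim_{t\to 0+}\sup_{x\in M}\nu_t\{K:|Kf(x)-f(x)|\geq\varepsilon\}=0$; (3) for all $f\in C_0(M)$, $t\geq 0$, $x\in M$, $\varepsilon>0$, $\lim_{y\to x}\nu_t\{K:|Kf(y)-Kf(x)|\geq\varepsilon\}=0$ and $\lim_{y\to\infty}\nu_t\{K:|Kf(y)|\geq\varepsilon\}=0$. *)

(* Defs.v *)
From HB Require Import structures.
From mathcomp Require Import all_boot all_order all_algebra.
From mathcomp Require Import all_classical all_reals all_analysis.

Set Implicit Arguments.
Unset Strict Implicit.
Unset Printing Implicit Defensive.

Import Order.TTheory GRing.Theory Num.Theory.
Import numFieldNormedType.Exports.

Local Open Scope classical_set_scope.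
Local Open Scope ring_scope.

(* Measurable types of the library are pointed, hence so are our metric
   spaces. *)
#[short(type="pmetricType")]
HB.structure Definition PointedMetric (K : numDomainType) :=
  {M of Metric K M & isPointed M}.

Definition separable (X : topologicalType) : Prop :=
  exists2 D : set X, countable D & dense D.

Definition borel (X : ptopologicalType) : measurableType (@open X).-sigma :=
  g_sigma_algebraType (@open X).

HB.instance Definition _ (I : Type) (T : I -> ptopologicalType) :=
  Pointed.copy (prod_topology T) (forall i, T i).

Definition power (X : ptopologicalType) (n : nat) : ptopologicalType :=
  prod_topology (fun _ : 'I_n => X).

(* The neighborhoods of infinity: on a compact space this filter is improper,
   and convergence along it always holds. *)
Definition infty_nbhs (X : topologicalType) : set_system X :=
  filter_from (@compact X) (fun C => ~` C).
Arguments infty_nbhs : clear implicits.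

Section continuous_functions.
Variables (R : realType) (X : ptopologicalType).

Definition C0 (f : X -> R) : Prop :=
  continuous f /\ f x @[x --> infty_nbhs X] --> (0 : R).

Definition Cb : Type :=
  {f : X -> R | continuous f /\ exists r : R, forall x, `|f x| <= r}.

Definition sup_norm (f : X -> R) : \bar R :=
  ereal_sup (range (fun x => `|f x|%:E)).

End continuous_functions.
Arguments Cb : clear implicits.

Section space_of_probabilities.
Variables (R : realType) (X : ptopologicalType).

(* The topology of weak convergence is the coarsest one for which the maps
   mu |-> \int f dmu are continuous, f ranging over the bounded continuous
   functions. *)
Definition weak_probability : ptopologicalType :=
  initial_topology (fun mu : probability (borel X) R =>
    (fun f : Cb R X => \int[mu]_x sval f x) : prod_topology (fun _ => R)).

(* P(X) with the Borel sigma-field of the topology of weak convergence *)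
Definition PP : measurableType (@open weak_probability).-sigma :=
  borel weak_probability.

(* The measures of the library are set functions that are unconstrained
   outside measurable sets; two of them represent the same element of P(X)
   when they agree on measurable sets. *)
Definition same_measure d (T : measurableType d) (mu nu : set T -> \bar R) :
  Prop := forall B, measurable B -> mu B = nu B.

End space_of_probabilities.

Lemma initial_topology_cvgE (S : choiceType) (T : topologicalType) (f : S -> T)
    (F : set_system S) (s : initial_topology f) : Filter F ->
  F --> s <-> f x @[x --> F] --> f s.
Proof.
move=> FF; split=> [Fs|fFs U].
  exact: cvg_trans (cvg_app f Fs) (@initial_continuous _ _ f s).
move=> [_ [[W oW <-] Ws WU]]; apply: filterS WU _.
by apply: fFs; exact: open_nbhs_nbhs.
Qed.

Lemma weak_probability_cvgE (R : realType) (X : ptopologicalType)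
    (F : set_system (weak_probability R X)) (mu : weak_probability R X) :
  Filter F ->
  F --> mu <->
  forall f : X -> R, continuous f -> (exists r : R, forall x, `|f x| <= r) ->
    \int[(nu : probability (borel X) R)]_x f x @[nu --> F] -->
    \int[(mu : probability (borel X) R)]_x f x.
Proof.
move=> FF; rewrite initial_topology_cvgE cvg_sup.
split=> [h f cf bf|h [f [cf bf]]].
  have /initial_topology_cvgE := h (exist _ f (conj cf bf)); exact.
by apply/initial_topology_cvgE; exact: h.
Qed.

Section feller.
Variables (R : realType) (X : ptopologicalType).

Definition feller (P : R -> R.-pker (borel X) ~> (borel X)) : Prop :=
  let Pf t (f : X -> R) (x : X) := \int[P t x]_y f y in
  [/\ forall x, same_measure (P 0 x) (\d_ x),
      forall s t, 0 <= s -> 0 <= t -> forall x B, measurable B ->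
        P (s + t) x B = (\int[P s x]_y P t y B)%E,
      forall t, 0 <= t -> forall f, C0 f -> C0 (Pf t f)
    & forall f, C0 f -> sup_norm (Pf t f \- f) @[t --> 0^'+] --> 0%E].

End feller.

Section consistent.
Variables (R : realType) (M : ptopologicalType).

Definition tuple_proj k n (s : 'I_k -> 'I_n) (x : power M n) : power M k :=
  x \o s.

(* The component P 0 is unused. *)
Definition consistent_feller
    (P : forall n, R -> R.-pker (borel (power M n)) ~> (borel (power M n))) :
    Prop :=
  (forall n, (1 <= n)%N -> feller (P n)) /\
  forall k n (s : 'I_k -> 'I_n), (1 <= k)%N -> (k <= n)%N -> injective s ->
    forall (x : power M n) t, 0 <= t ->
      same_measure (pushforward (P n t x)
                    (tuple_proj s : borel (power M n) -> borel (power M k)))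
                 (P k t (tuple_proj s x)).

End consistent.

Section product_measure.
Variables (R : realType) (M : ptopologicalType).

Definition fcons n (y : M) (z : power M n) : power M n.+1 :=
  fun i => if unlift ord0 i is Some j then z j else y.

(* The product of mu_0, ..., mu_(n-1) as an iterated integral; the library has
   only binary products. *)
Fixpoint prod_prob n :
    ('I_n -> probability (borel M) R) -> set (power M n) -> \bar R :=
  match n with
  | 0 => fun _ => dirac (point : borel (power M 0))
  | n'.+1 => fun mu B =>
      \int[mu ord0]_y
        prod_prob (fun i => mu (lift ord0 i)) [set z | B (fcons y z)]
  end%E.

End product_measure.

Lemma prod_prob_set0 (R : realType) (M : ptopologicalType) n
    (mu : 'I_n -> probability (borel M) R) : prod_prob mu set0 = 0%E.
Proof.
elim: n mu => [|n IHn] mu /=; first by rewrite dirac0.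
by under eq_integral do rewrite IHn; rewrite integral0.
Qed.

Lemma prod_prob_box (R : realType) (M : ptopologicalType) n
    (mu : 'I_n -> probability (borel M) R) (A : 'I_n -> set (borel M)) :
  (forall i, measurable (A i)) ->
  prod_prob mu [set x | forall i, A i (x i)] = (\prod_(i < n) mu i (A i))%E.
Proof.
elim: n mu A => [|n IHn] mu A mA.
  by rewrite big_ord0 /= diracE mem_set// => -[].
rewrite big_ord_recl /=.
transitivity (\int[mu ord0]_y ((\1_(A ord0) y)%:E *
    \prod_(i < n) mu (lift ord0 i) (A (lift ord0 i))))%E.
  apply: eq_integral => y _; rewrite indicE; case: (boolP (y \in A ord0)) => yA.
    rewrite mul1e -(IHn (fun i => mu (lift ord0 i)) (fun i => A (lift ord0 i)))//.
    congr prod_prob; apply/seteqP; split => z /= zA i.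
      by have := zA (lift ord0 i); rewrite /fcons liftK.
    rewrite /fcons; case: unliftP => [j ->|->]; first exact: zA.
    by rewrite inE in yA.
  rewrite mul0e [X in prod_prob _ X](_ : _ = set0); first exact: prod_prob_set0.
  apply/seteqP; split => z //= /(_ ord0); rewrite /fcons unlift_none => yA'.
  by move: yA; rewrite notin_setE.
rewrite ge0_integralZr//=; first by rewrite integral_indic// setIT.
  apply/measurable_realfun.measurable_EFinP.
  exact: measurable_realfun.measurable_indic.
by apply: prode_ge0.
Qed.

Section kernels.
Variables (R : realType) (M : ptopologicalType).

Definition kernels : Type := {mfun borel M >-> PP R M}.

HB.instance Definition _ := gen_eqMixin kernels.
HB.instance Definition _ := gen_choiceMixin kernels.
HB.instance Definition _ := isPointed.Build kernels (cst point).

Definition kernel_evaluation_sets : set (set kernels) :=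
  [set (fun K : kernels => K x) @^-1` A | x in [set: M] &
     A in (measurable : set (set (PP R M)))].

Definition EE : measurableType kernel_evaluation_sets.-sigma :=
  g_sigma_algebraType kernel_evaluation_sets.

Definition kmeas (K : EE) (x : M) : probability (borel M) R :=
  (K : kernels) x.

Definition kact (K : EE) (f : M -> R) (x : M) : R := \int[kmeas K x]_y f y.

Definition same_kernel (K L : EE) : Prop :=
  forall x, same_measure (kmeas K x) (kmeas L x).

Definition is_kernel_comp (K1 K2 K : EE) : Prop :=
  forall x, same_measure (kmeas K x)
    (fun B => \int[kmeas K1 x]_y kmeas K2 y B)%E.

(* On a separable metric space such a kernel exists, and it is determined up
   to same_kernel; choosing one is thus harmless, since the measurable sets of
   EE are saturated for same_kernel. *)
Definition kernel_comp (K1 K2 : EE) : EE :=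
  get [set K | is_kernel_comp K1 K2 K].

Definition measurable_presentation (nu : probability EE R) (p : EE -> EE) :
    Prop :=
  measurable_fun [set: EE * borel M]
    (fun Kx : EE * borel M => (p Kx.1 : kernels) Kx.2) /\
  forall x : M, {ae nu, forall K, same_measure (kmeas (p K) x) (kmeas K x)}.

Definition regular_measure (nu : probability EE R) : Prop :=
  exists p, measurable_presentation nu p.

(* The convolution nu1 * nu2 computed with a measurable presentation p of
   nu2 *)
Definition convolution (p : EE -> EE) (nu1 nu2 : probability EE R) :
    set EE -> \bar R :=
  pushforward (nu1 \x nu2)%E (fun K : EE * EE => kernel_comp K.1 (p K.2)).

Definition feller_convolution_semigroup (nu : R -> probability EE R) : Prop :=
  [/\ forall t, 0 <= t -> regular_measure (nu t),
      forall t s, 0 <= t -> 0 <= s ->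
        forall p, measurable_presentation (nu s) p ->
        same_measure (convolution p (nu t) (nu s)) (nu (t + s)),
      forall f : M -> R, C0 f -> forall e, 0 < e ->
        ereal_sup (range (fun x : M =>
          nu t [set K | e <= `|kact K f x - f x|]))
        @[t --> 0^'+] --> 0%E
    & forall f : M -> R, C0 f -> forall t, 0 <= t -> forall (x : M) e, 0 < e ->
        nu t [set K | e <= `|kact K f y - kact K f x|] @[y --> x] --> 0%E /\
        nu t [set K | e <= `|kact K f y|] @[y --> infty_nbhs M] --> 0%E].

End kernels.

(* Main.v *)
(* The moments of nu_t are prescribed: the expectation of the product of the
   K(x_i)(B_i) is P^(n)_t(x, B_1 x ... x B_n), and mixed moments of bounded
   variables determine their joint law, whence uniqueness.

   For existence, fix t and a sequence y in M. Points are coded by bit sequences,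
   so that by consistency a single uniform variable drives a system of particles
   with infinitely many copies started from each y_i and finite-dimensional laws
   P^(n)_t. The copies started from y_i are exchangeable; the limits of their
   empirical frequencies define a random measure K(y_i), and these have the
   required joint moments. This gives a random kernel on every countable set.

   Let D be a countable dense set. By the Feller property of P^(2), the mean
   square E(Kf(x) - Kf(y))^2 tends to 0 as y tends to x, uniformly in t on compact
   intervals. Hence points d_j(x) of D can be chosen measurably in x, independently
   of t, such that K(d_j(x)) converges weakly to K(x) almost surely, for every t.
   The map p(K)(x) := K(x) on D and lim_j K(d_j(x)) elsewhere is the common
   measurable presentation, and as p(K) depends on K only through its values on D,
   p o p = p; nu_t is the image under p of the law constructed on D.

   The convolution identity follows from the Chapman-Kolmogorov equation by
   comparing moments, and the two limits from Chebyshev's inequality, since the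
   second moments involved are integrals with respect to P^(2)_t and P^(1)_t. *)

Require Import Defs.
From HB Require Import structures.
From mathcomp Require Import all_boot all_order all_algebra.
From mathcomp Require Import all_classical all_reals all_analysis measurable_realfun.
From mathcomp Require Import ring lra zify.

Import Order.TTheory GRing.Theory Num.Theory.
Import numFieldNormedType.Exports.

Local Open Scope classical_set_scope.
Local Open Scope ring_scope.

Set Implicit Arguments.
Unset Strict Implicit.
Unset Printing Implicit Defensive.

(** * Countable bases and the Borel structure of powers *)

Section countable_base.
Context {X : topologicalType}.

(** The field on E involves uncountably many evaluations, while only countably many random measures
    are built at once, so a law built on D says nothing yet about moments at points outside D. For
    each finite tuple x, a second law is therefore built on the countable set formed by x and D.
    Under it the presentation returns the kernel at the points of x almost surely, and its
    restriction to D has the same law as before, because mixed moments determine that law. Moments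
    at x are thus transferred.

    Frequencies and limits along D exist only almost surely, whereas a presentation must be defined
    and jointly measurable everywhere: limits are replaced by clamped limits superior, and invalid
    data by a fixed law.

    Local compactness makes the set of codes of points measurable. Decoding is then measurable, and
    a probability on M amounts to consistent masses of bit prefixes, which can be read off countably
    many integrals of continuous functions.

    The powers of 4 bound mean squares; the corresponding first moments are of order 2 ^ -n, hence
    summable, which gives almost sure convergence. *)

Definition base_seq (V : nat -> set X) : Prop :=
  (forall n, open (V n)) /\
  (forall U x, open U -> U x -> exists2 n, V n x & V n `<=` U).

Lemma base_seq_bigcup V U : base_seq V -> open U ->
  U = \bigcup_(n in [set n | V n `<=` U]) V n.
Proof.
move=> [oV bV] oU; apply/seteqP; split => [x Ux|x [n /= VU Vx]]; last exact: VU.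
by have [n Vx VU] := bV _ _ oU Ux; exists n.
Qed.

End countable_base.

Lemma base_seq_sigma (X : ptopologicalType) (V : nat -> set X) : base_seq V ->
  @measurable _ (borel X) = <<s range V >>.
Proof.
move=> bV; apply/seteqP; split.
  apply: smallest_sub; first exact: smallest_sigma_algebra.
  move=> U oU; rewrite (base_seq_bigcup bV oU).
  have [_ _ h] := smallest_sigma_algebra [set: X] (range V).
  rewrite bigcup_mkcond; apply: h => n; case: ifPn => _.
    by apply: sub_sigma_algebra; exists n.
  by have [] := smallest_sigma_algebra [set: X] (range V).
apply: smallest_sub; first exact: smallest_sigma_algebra.
by move=> _ [n _ <-]; apply: sub_sigma_algebra; exact: bV.1.
Qed.

Lemma open_measurable_borel (X : ptopologicalType) (U : set X) :
  open U -> measurable (U : set (borel X)).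
Proof. exact: sub_sigma_algebra. Qed.

Lemma measurable_fun_borel d (T : measurableType d) (X : ptopologicalType)
    (f : T -> borel X) (V : nat -> set X) : base_seq V ->
  (forall n, measurable (f @^-1` V n)) -> measurable_fun setT f.
Proof.
move=> bV mf; apply: (measurability _ (base_seq_sigma bV)).
by move=> _ [_ [n _ <-] <-]; rewrite setTI.
Qed.

Lemma continuous_measurable_borel (X Y : ptopologicalType) (f : X -> Y) :
  continuous f -> measurable_fun setT (f : borel X -> borel Y).
Proof.
move=> cf; apply: (@measurability _ _ (borel X) (borel Y) setT f (@open Y) erefl).
move=> _ [U oU <-]; rewrite setTI; apply: open_measurable_borel.
by apply: open_comp => // x _; exact: cf.
Qed.

Lemma continuous_measurable_real (R : realType) (X : ptopologicalType)
    (f : X -> R) : continuous f -> measurable_fun setT (f : borel X -> R).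
Proof.
move=> cf; apply: (measurability _ (measurable_realfun.RGenOpens.measurableE R)).
move=> _ [_ [a [b ->] <-]]; rewrite setTI; apply: open_measurable_borel.
by apply: open_comp => // x _; exact: cf.
Qed.

Section separable_metric.
Context {R : realType} {M : pmetricType R}.

Lemma ball_mdist (x y : M) (e : R) : ball x e y <-> mdist x y < e.
Proof. by rewrite ballEmdist. Qed.

Lemma open_mdist_ball (x : M) (e : R) : open (ball x e).
Proof.
rewrite openE => y /ball_mdist xy; rewrite /interior -nbhs_ballE.
exists (e - mdist x y) => /=; first by rewrite subr_gt0.
move=> z /ball_mdist yz; apply/ball_mdist.
by rewrite (le_lt_trans (metric_triangle _ y _))// -ltrBrDl.
Qed.

Lemma open_ballP (U : set M) (x : M) : open U -> U x ->
  exists2 e : R, 0 < e & ball x e `<=` U.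
Proof.
by rewrite openE => oU /oU; rewrite /interior /= -nbhs_ballE => -[e /= e0 ?]; exists e.
Qed.

Lemma mdist_continuous (a : M) : continuous (fun x : M => mdist x a : R).
Proof.
move=> x; apply/cvgrPdist_lt => e e0; near=> y.
have xy : mdist x y < e.
  by apply/ball_mdist; near: y; exact: nbhsx_ballx.
rewrite (le_lt_trans _ xy)// ler_norml lerBlDr metric_triangle andbT.
rewrite lerBrDr addrC lerBlDr [X in _ <= X]addrC [mdist x y]metric_sym.
exact: metric_triangle.
Unshelve. all: by end_near. Qed.

Definition dense_seq (d : nat -> M) : Prop :=
  forall x (e : R), 0 < e -> exists n, mdist x (d n) < e.

Lemma separable_dense_seq : separable M ->
  exists d : nat -> M, dense_seq d.
Proof.
move=> [D cD dD].
have [x0 Dx0] : D !=set0.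
  by have [x []] := dD [set: M] (ex_intro _ point I) (@openT M); exists x.
have /pfcard_geP[D0|[f]] := cD; first by rewrite D0 in Dx0.
exists f => x e e0.
have [y [xy Dy]] := dD (ball x e)
  (ex_intro _ x (ballxx x e0)) (open_mdist_ball x e).
have [n _ nE] := 'surj_f Dy; rewrite -nE in xy.
by exists n; apply/ball_mdist.
Qed.

Definition ball_seq (d : nat -> M) (n : nat) : set M :=
  let: (m, k) := odflt (0, 0)%N (unpickle n : option (nat * nat)) in
  ball (d m) k.+1%:R^-1.

Lemma ball_seqP (d : nat -> M) m k : exists n, ball_seq d n = ball (d m) k.+1%:R^-1.
Proof. by exists (pickle (m, k)); rewrite /ball_seq pickleK. Qed.

Lemma dense_ball (d : nat -> M) :
  dense_seq d ->
  forall x (e : R), 0 < e ->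
  exists m k, ball (d m) k.+1%:R^-1 x /\ ball (d m) k.+1%:R^-1 `<=` ball x e /\
    k.+1%:R^-1 < e.
Proof.
move=> dd x e e0.
have [k ke] : exists k : nat, k.+1%:R^-1 < e / 2.
  have [k _ hk] := near_infty_natSinv_lt (PosNum (divr_gt0 e0 (ltr0Sn R 1))).
  by exists k; exact: (hk k (leqnn k)).
have [m dm] := dd x k.+1%:R^-1 ltac:(by []).
exists m, k; split; first by apply/ball_mdist; rewrite metric_sym.
split; last by rewrite (lt_trans ke)// gtr_pMr// invf_lt1// ltr1n.
move=> y /ball_mdist my; apply/ball_mdist; rewrite (splitr e).
rewrite (le_lt_trans (metric_triangle _ (d m) _))// ltrD//.
  exact: lt_trans ke.
exact: lt_trans ke.
Qed.

Lemma ball_seq_base (d : nat -> M) :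
  dense_seq d -> base_seq (ball_seq d).
Proof.
move=> dd; split.
  by move=> n; rewrite /ball_seq; case: (odflt _ _) => *; exact: open_mdist_ball.
move=> U x oU Ux; have [e e0 eU] := open_ballP oU Ux.
have [m [k [dx [de _]]]] := dense_ball dd x e0.
have [n nE] := ball_seqP d m k; exists n; rewrite nE//.
exact: subset_trans eU.
Qed.

Lemma open_power_ball n (U : set (power M n)) (x : power M n) : open U -> U x ->
  exists2 e : R, 0 < e & [set y : power M n | forall i, ball (x i) e (y i)] `<=` U.
Proof.
move=> oU Ux.
(* The cubes around x form a filter that converges to x in each coordinate, hence in the product
   topology; so every neighborhood of x contains a cube. *)
pose F : set_system (power M n) := filter_from [set e : R | 0 < e]
  (fun e => [set y : power M n | forall i, ball (x i) e (y i)]).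
have FF : Filter F.
  apply: filter_from_filter; first by exists 1 => /=.
  move=> i j /= i0 j0; exists (Num.min i j); first by rewrite lt_min i0.
  by move=> y yij; split=> k; apply: le_ball (yij k); rewrite ge_min lexx ?orbT.
have Fx : F --> x.
  apply/cvg_sup => i A.
  move=> [_ [[W oW <-] /= Wx WA]]; apply: filterS WA _.
  have [e e0 eW] := open_ballP oW Wx.
  by exists e => // y /= /(_ i); exact: eW.
have [e e0 eU] := Fx U (open_nbhs_nbhs (conj oU Ux)).
by exists e.
Qed.

End separable_metric.

Section power_base.
Context {X : ptopologicalType}.
Variable V : nat -> set X.

Definition box_seq m (n : nat) : set (power X m) :=
  let: c := odflt [ffun=> 0%N] (unpickle n : option {ffun 'I_m -> nat}) in
  [set x | forall i, V (c i) (x i)].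

Arguments box_seq m n : clear implicits.

Lemma box_seqP m (c : 'I_m -> nat) :
  exists n, box_seq m n = [set x | forall i, V (c i) (x i)].
Proof.
exists (pickle (finfun c)); rewrite /box_seq pickleK /=.
by apply/seteqP; split => x /= h i; have := h i; rewrite ffunE.
Qed.

Lemma open_box m (A : 'I_m -> set X) : (forall i, open (A i)) ->
  open ([set x | forall i, A i (x i)] : set (power X m)).
Proof.
move=> oA; rewrite openE => x /= Ax; rewrite /interior.
apply: (@filter_forall (power X m) _ (fun i y => A i (y i)) (nbhs x) _) => i.
have /= := @proj_continuous _ (fun _ : 'I_m => X) i x (A i); apply.
by apply: open_nbhs_nbhs; split; [exact: oA|exact: Ax].
Qed.

End power_base.
Arguments box_seq {X} V m n.

Section power_metric.
Context {R : realType} {M : pmetricType R} (d : nat -> M).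
Hypothesis dd : dense_seq d.

Lemma box_seq_base m : base_seq (box_seq (ball_seq d) m).
Proof.
split=> [n|U x oU Ux].
  rewrite /box_seq; set c := odflt _ _.
  exact: (@open_box _ m (fun i => ball_seq d (c i)) (fun i => (ball_seq_base dd).1 (c i))).
have [e e0 eU] := open_power_ball oU Ux.
have h i : exists n, ball_seq d n (x i) /\ ball_seq d n `<=` ball (x i) e.
  have [n] := (ball_seq_base dd).2 _ _ (open_mdist_ball (x i) e) (ballxx (x i) e0).
  by exists n.
have /choice[c hc] := h.
have [n nE] := box_seqP (ball_seq d) c; exists n; rewrite nE.
  by move=> i; exact: (hc i).1.
by move=> y /= yc; apply: eU => i; exact: (hc i).2.
Qed.

Lemma measurable_proj m (i : 'I_m) :
  measurable_fun setT ((fun x => x i) : borel (power M m) -> borel M).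
Proof.
apply: (@continuous_measurable_borel (power M m) M).
exact: (@proj_continuous _ (fun _ : 'I_m => M) i).
Qed.

Lemma measurable_box m (A : 'I_m -> set (borel M)) :
  (forall i, measurable (A i)) ->
  measurable ([set x | forall i, A i (x i)] : set (borel (power M m))).
Proof.
move=> mA.
rewrite (_ : [set x | _] = \bigcap_(i in [set: 'I_m]) [set x | A i (x i)]).
  apply: fin_bigcap_measurable => // i _.
  by rewrite -[X in measurable X]setTI; exact: measurable_proj.
by apply/seteqP; split => x /= h i; [move=> _; exact: h|exact: h].
Qed.

(** Countably many boxes form a base of the power, so its Borel field is the product field and
    coordinates decide measurability. *)
Lemma measurable_fun_power d' (T : measurableType d') m
    (f : T -> borel (power M m)) :
  (forall i, measurable_fun setT ((fun t => f t i) : T -> borel M)) ->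
  measurable_fun setT f.
Proof.
move=> mf; apply: (measurable_fun_borel (box_seq_base m)) => n.
rewrite /box_seq; set c := odflt _ _.
rewrite (_ : _ @^-1` _ =
  \bigcap_(i in [set: 'I_m]) ((fun t => f t i) @^-1` ball_seq d (c i))).
  apply: fin_bigcap_measurable => // i _; rewrite -[X in measurable X]setTI.
  apply: mf => //; apply: open_measurable_borel.
  exact: (ball_seq_base dd).1.
by apply/seteqP; split => x /= h i; [move=> _; exact: h|exact: h].
Qed.

Lemma measurable_fcons m : measurable_fun setT
  ((fun yz => fcons yz.1 yz.2) : borel M * borel (power M m) -> borel (power M m.+1)).
Proof.
apply: measurable_fun_power => i; rewrite /fcons.
case: unliftP => [j _|_]; last exact: measurable_fst.
apply: (measurableT_comp (measurable_proj j)); exact: measurable_snd.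
Qed.

End power_metric.

(** * Coding points by bit sequences *)

Section bits.

Definition cyl (s : seq bool) : set (nat -> bool) := [set c | mkseq c (size s) = s].

(** Two cylinders are nested or disjoint; including the empty set makes the family closed under
    intersection, so that it determines laws on bit sequences. *)
Definition cylinders : set (set (nat -> bool)) :=
  [set A | A = set0 \/ exists s, A = cyl s].

Definition Bits : measurableType cylinders.-sigma := g_sigma_algebraType cylinders.

Lemma cylE s (c : nat -> bool) :
  cyl s c <-> forall q, (q < size s)%N -> c q = nth false s q.
Proof.
split=> [<- q|h]; first by rewrite size_mkseq => qs; rewrite nth_mkseq.
by apply: (@eq_from_nth _ false); rewrite ?size_mkseq// => i si; rewrite nth_mkseq ?h.
Qed.

Lemma measurable_cyl s : measurable (cyl s : set Bits).
Proof. by apply: sub_sigma_algebra; right; exists s. Qed.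

Lemma mem_cyl_mkseq c n : cyl (mkseq c n) c.
Proof. by rewrite /cyl/= size_mkseq. Qed.

(** Any property Q is allowed, since an event about a prefix is a countable union of cylinders. *)
Lemma measurable_prefix n (Q : seq bool -> Prop) :
  measurable ([set c | Q (mkseq c n)] : set Bits).
Proof.
rewrite (_ : [set c | _] = \bigcup_s
    (if `[< size s = n /\ Q s >] then cyl s else set0)).
  apply: countable_bigcupT_measurable; first exact: countableP.
  by move=> s; case: ifPn => _; [exact: measurable_cyl|exact: measurable0].
apply/seteqP; split=> [c /= Qc|c [s _]].
  exists (mkseq c n) => //; rewrite asboolT; first exact: mem_cyl_mkseq.
  by rewrite size_mkseq.
by case: asboolP => // -[sn Qs]; rewrite /cyl /= sn => ->.
Qed.

Lemma measurable_bit n b : measurable ([set c | c n = b] : set Bits).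
Proof.
rewrite (_ : [set c | _] = [set c : Bits | nth false (mkseq c n.+1) n = b]).
  exact: (@measurable_prefix n.+1 (fun s => nth false s n = b)).
by apply/seteqP; split=> c /=; rewrite nth_mkseq.
Qed.

Lemma cylindersI : setI_closed cylinders.
Proof.
move=> _ _ [->|[s ->]] [->|[s' ->]]; rewrite ?set0I ?setI0; try by left.
wlog ss' : s s' / (size s <= size s')%N.
  move=> h; case/orP: (leq_total (size s) (size s')) => [|/h]; first exact: h.
  by rewrite setIC.
have [tE|tN] := eqVneq (take (size s) s') s; [right; exists s'|left].
  apply/seteqP; split => [c []//|c cs']; split => //.
  move/cylE: (cs') => h; apply/cylE => q qs; rewrite h ?(leq_trans qs)//.
  by rewrite -[in RHS]tE nth_take.
apply/seteqP; split => // c [] /cylE h /cylE h'; move/eqP: tN; apply.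
apply: (@eq_from_nth _ false); rewrite size_take_min (minn_idPl ss')// => i si.
by rewrite nth_take// -h// h'// (leq_trans si).
Qed.

Lemma measurable_fun_bits d (T : measurableType d) (f : T -> Bits) :
  (forall n, measurable [set t | f t n = true]) -> measurable_fun setT f.
Proof.
move=> mf; apply: (@measurability _ _ T Bits setT f cylinders erefl).
move=> _ [_ [->|[s ->]] <-]; rewrite setTI ?preimage_set0//.
rewrite (_ : _ @^-1` _ = \bigcap_(q in [set q | (q < size s)%N])
    [set t | f t q = nth false s q]).
  apply: bigcap_measurableType => q _.
  case: (nth false s q) => //.
  rewrite (_ : [set t | _] = ~` [set t | f t q = true]); first exact: measurableC.
  by apply/seteqP; split => t /=; case: (f t q).
by apply/seteqP; split => t; rewrite /preimage /= => /cylE.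
Qed.

Lemma bits_measure_unique (R : realType) (m1 m2 : probability Bits R) :
  (forall s, m1 (cyl s) = m2 (cyl s)) -> forall A, measurable A -> m1 A = m2 A.
Proof.
move=> h A mA.
apply: (@measure_unique _ R Bits cylinders (fun=> setT)) => //.
- exact: cylindersI.
- move=> _; right; exists [::]; apply/seteqP; split => // c _.
- by rewrite bigcup_const//; exists 0%N.
- by move=> _ [->|[s ->]]; [rewrite !measure0|exact: h].
- by move=> _; rewrite [X in (X < _)%E]probability_setT ltry.
Qed.

End bits.

Section compact_sequence.
Context {X : topologicalType}.

(** Take a cluster point of points u N satisfying the first N conditions: u is eventually in each
    closed set F n. *)
Lemma compact_nested_closed (K : set X) (F : nat -> set X) : compact K ->
  (forall n, closed (F n)) -> (forall N, exists x, K x /\ forall n, (n < N)%N -> F n x) ->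
  exists x, K x /\ forall n, F n x.
Proof.
move=> cK cF /choice[u hu].
have uK : (u @ \oo) K by exists 0%N => // n _; exact: (hu n).1.
have [x [Kx clx]] := cK _ _ uK.
exists x; split => // n; apply: (cF n) => B nB.
have un : (u @ \oo) (F n) by exists n.+1 => // m /= nm; exact: (hu m).2.
by have [y [? ?]] := clx _ _ un nB; exists y.
Qed.

End compact_sequence.

(** * A measurable coding of points with a measurable left inverse *)

Section borel_retract.
Context {R : realType} {M : pmetricType R}.

Lemma locally_compact_ball : locally_compact [set: M] ->
  forall x : M, exists2 e : R, 0 < e & compact (closure (ball x e)).
Proof.
move=> lM x; have /= [U] := lM x I.
rewrite /globally/within/= => nU [cU clU].
have {}nU : nbhs x U by apply: filterS nU => y; exact.
have [e /= e0 eU] : exists2 e : R, 0 < e & ball x e `<=` U.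
  by move: nU; rewrite -nbhs_ballE => -[e /= e0 ?]; exists e.
exists e => //; apply: subclosed_compact cU _; first exact: closed_closure.
by rewrite (_ : U = closure U); [exact: closureS|exact/closure_id].
Qed.

Lemma closure_ball (x : M) (e r : R) : e < r -> closure (ball x e) `<=` ball x r.
Proof.
move=> er y /(_ (ball y (r - e)) ltac:(apply: nbhsx_ballx; by rewrite subr_gt0)).
move=> [z [/ball_mdist xz /ball_mdist yz]]; apply/ball_mdist.
rewrite (le_lt_trans (metric_triangle _ z _))// -(subrKC e r) ltrD//.
by rewrite metric_sym.
Qed.

Variable d : nat -> M.
Hypothesis dd : dense_seq d.
Hypothesis lM : locally_compact [set: M].
Let V := ball_seq d.

Let small_ball (x : M) (e : R) : 0 < e ->
  exists n, V n x /\ closure (V n) `<=` ball x e.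
Proof.
move=> e0; have e20 : 0 < e / 2 by rewrite divr_gt0.
have [m [k [dx [de ke]]]] := dense_ball dd x e20.
have [n nE] := ball_seqP d m k; exists n; rewrite /V nE; split => //.
apply: subset_trans (closureS de) _; apply: closure_ball.
by rewrite gtr_pMr// invf_lt1// ltr1n.
Qed.

(** Bit n records membership in the n-th basic ball: the coding is measurable at once, and injective
    because small balls separate points. *)
Definition code (x : borel M) : Bits := fun n => `[< V n x >].

Lemma measurable_code : measurable_fun setT code.
Proof.
apply: measurable_fun_bits => n.
rewrite (_ : [set t | _] = V n); last first.
  by apply/seteqP; split => x /= /asboolP.
by apply: open_measurable_borel; exact: (ball_seq_base dd).1.
Qed.

(* The range of code, described by countably many conditions on finite prefixes:
   compactness of one closed ball provides a point satisfying all of them. *)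
Let decodable : set Bits :=
  (\bigcup_(n in [set n | compact (closure (V n))]) [set c : Bits | c n = true /\
     forall N, exists x, closure (V n) x /\ forall q, (q < N)%N ->
       if nth false (mkseq c N) q then closure (V q) x else ~ V q x]) `&`
  \bigcap_n ([set c | c n = false] `|` \bigcup_(m in [set m | closure (V m) `<=` V n])
     [set c | c m = true]).

Let measurable_decodable : measurable decodable.
Proof.
apply: measurableI.
  apply: bigcup_measurable => n _.
  apply: (measurableI [set c : Bits | c n = true]); first exact: measurable_bit.
  rewrite (_ : (fun c : Bits => _) = \bigcap_N [set c : Bits | exists x, closure (V n) x /\
      forall q, (q < N)%N ->
      if nth false (mkseq c N) q then closure (V q) x else ~ V q x]); last first.
    by apply/seteqP; split => c /= h N; [move=> _; exact: h|exact: h].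
  apply: bigcapT_measurable => N.
  exact: (@measurable_prefix N (fun s => exists x, closure (V n) x /\
    forall q, (q < N)%N -> if nth false s q then closure (V q) x else ~ V q x)).
apply: bigcapT_measurable => n; apply: measurableU; first exact: measurable_bit.
by apply: bigcup_measurable => m _; exact: measurable_bit.
Qed.

Let decodableP (c : Bits) : decodable c <-> exists x, code x = c.
Proof.
split=> [[[n0 /= cn [cn0 hN]] h2]|[x <-]].
  have [x [_ hx]] : exists x, closure (V n0) x /\
      forall q, (if c q then closure (V q) else ~` V q) x.
    apply: compact_nested_closed => //.
      move=> q; case: (c q); first exact: closed_closure.
      by apply: open_closedC; exact: (ball_seq_base dd).1.
    move=> N; have [x [nx hx]] := hN N; exists x; split => // q qN.
    by have := hx q qN; rewrite nth_mkseq//; case: (c q).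
  (* A false bit excludes [V q] directly. A true bit only places x in the closure of [V q]; the
     second condition supplies a ball with true bit whose closure lies inside [V q]. *)
  exists x; apply/funext => q; rewrite /code; apply/asboolP/idP => [Vqx|cq].
    by have := hx q; case: (c q).
  have [|[m mq cm]] := h2 q I; first by rewrite /= cq.
  by apply: mq; have := hx m; rewrite cm.
split; last first.
  move=> n _; rewrite /code; have [Vnx|Vnx] := pselect (V n x); last first.
    by left; apply/asboolP.
  right; have [e e0 eV] := open_ballP ((ball_seq_base dd).1 n) Vnx.
  have [m [Vm me]] := small_ball x e0; exists m; last exact/asboolP.
  exact: subset_trans eV.
have [e e0 ce] := locally_compact_ball lM x.
have [n [Vn ne]] := small_ball x e0; exists n => /=.
  apply: subclosed_compact ce _; first exact: closed_closure.
  exact: subset_trans (@subset_closure _ _).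
split; first exact/asboolP.
move=> N; exists x; split; first exact: subset_closure.
move=> q qN; rewrite nth_mkseq//.
rewrite /code; have [Vx|Vx] := asboolP (V q x); last by [].
exact: subset_closure Vx.
Qed.

Let code_inj : injective code.
Proof.
move=> x y xy; apply/mdist_positivity/eqP; rewrite eq_le mdist_ge0 andbT.
rewrite leNgt; apply/negP => e0.
have [n [Vn ne]] := small_ball x e0.
have : V n y by apply/asboolP; have := congr1 (fun c => c n) xy; rewrite /code => <-; exact/asboolP.
by move=> /subset_closure/ne/ball_mdist; rewrite ltxx.
Qed.

Definition decode (c : Bits) : borel M := xget point [set x | code x = c].

Lemma codeK : cancel code decode.
Proof.
move=> x; have : code (decode (code x)) = code x.
  exact: (@xgetI _ point [set y | code y = code x] x).
exact: code_inj.
Qed.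

Lemma measurable_decode : measurable_fun setT decode.
Proof.
apply: (measurable_fun_borel (ball_seq_base dd)) => n.
(* Sequences that code no point are all decoded to [point], whence this constant event. *)
have mp : measurable ([set _ | V n point] : set Bits).
  have [p|p] := pselect (V n point).
    by rewrite (_ : mkset _ = setT)//; apply/seteqP; split.
  by rewrite (_ : mkset _ = set0)//; apply/seteqP; split.
have -> : decode @^-1` ball_seq d n = (decodable `&` [set c | c n = true]) `|`
    (~` decodable `&` [set _ | V n point]).
  apply/seteqP; split => c.
    have [dc|dc] := pselect (decodable c).
      move=> Vc; left; split => //; move/decodableP: dc Vc => [x <-].
      by rewrite /preimage/= codeK => Vx; exact/asboolP.
    move=> Vc; right; split => //; move: Vc; rewrite /preimage /= /decode.
    by case: xgetP => //= y _ yc; exfalso; apply/dc/decodableP; exists y.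
  move=> [[/decodableP[x <-]]|[dc]].
    by rewrite /preimage /= codeK => /asboolP.
  rewrite /preimage /= /decode.
  by case: xgetP => //= y _ yc; exfalso; apply/dc/decodableP; exists y.
apply: measurableU.
  refine (@measurableI _ Bits _ _ measurable_decodable (@measurable_bit n true)).
exact: (measurableI _ _ (measurableC measurable_decodable) mp).
Qed.

End borel_retract.

(** * Measures on bit sequences *)

Section unit_lebesgue.
Context {R : realType}.

Definition unit_lebesgue : set (measurableTypeR R) -> \bar R :=
  mrestr (@lebesgue_measure R) (measurable_itv `[0, 1[).

HB.instance Definition _ := Measure.on unit_lebesgue.

Let unit_lebesgue_setT : unit_lebesgue setT = 1%E.
Proof.
rewrite /unit_lebesgue /mrestr setTI.
rewrite (@lebesgue_measure_itv R `[0, 1[) /= lte_fin ltr01.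
by rewrite sube0.
Qed.

HB.instance Definition _ :=
  Measure_isProbability.Build _ _ _ unit_lebesgue unit_lebesgue_setT.

End unit_lebesgue.

Section weights.
Context {R : realType}.
Implicit Types (w : seq bool -> R) (s : seq bool).

(** These are the cylinder masses of a law on bit sequences: total mass 1, and additivity when one
    more bit is revealed. *)
Definition weights w : Prop :=
  w [::] = 1 /\ forall s, 0 <= w s /\ w s = w (rcons s false) + w (rcons s true).

(* The unit interval is split recursively in proportion to the weights; the
   points whose bits start with s form [left_end w s, left_end w s + w s[. *)
Definition left_end w s : R :=
  \sum_(i < size s | nth false s i) w (rcons (take i s) false).

Lemma left_end_rcons w s b :
  left_end w (rcons s b) = left_end w s + (if b then w (rcons s false) else 0).
Proof.
rewrite /left_end size_rcons big_mkcond big_ord_recr /=; congr (_ + _).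
  rewrite [RHS]big_mkcond; apply: eq_bigr => i _ /=.
  by rewrite nth_rcons ltn_ord -!cats1 takel_cat// ltnW.
by rewrite nth_rcons ltnn eqxx -!cats1 take_size_cat.
Qed.

Fixpoint path_of w (u : R) n : seq bool :=
  if n is n'.+1 then
    let s := path_of w u n' in rcons s (left_end w s + w (rcons s false) <= u)
  else [::].

Lemma size_path_of w u n : size (path_of w u n) = n.
Proof. by elim: n => //= n IHn; rewrite size_rcons IHn. Qed.

(** The cut at [left_end w s + w (rcons s false)] divides the half-open interval of s into those of
    its two extensions; a prefix of weight 0 gets an empty interval. *)
Lemma path_ofP w u s : weights w -> 0 <= u < 1 ->
  path_of w u (size s) = s <-> left_end w s <= u < left_end w s + w s.
Proof.
move=> [w0 hw] u01; elim/last_ind: s => [|s b IHs].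
  by rewrite /left_end big_ord0 w0 add0r u01.
rewrite size_rcons /= left_end_rcons; have [ws wsE] := hw s.
have [w0s _] := hw (rcons s false); have [w1s _] := hw (rcons s true).
split=> [/rcons_inj [sE]|].
  move/IHs: (sE) => /andP[us su]; rewrite sE => <-.
  have [h|h] := leP (left_end w s + w (rcons s false)) u.
    by rewrite -addrA -wsE su h.
  by rewrite addr0 us h.
move=> h.
have sE : path_of w u (size s) = s.
  apply/IHs; move: h; case: b => /andP[h1 h2].
    by rewrite (le_trans _ h1) ?lerDl//= wsE addrA.
  by rewrite addr0 in h1 h2; rewrite h1 (lt_le_trans h2)// lerD2l wsE lerDl.
rewrite sE; congr rcons; move: h; case: b => /andP[h1 h2]; first by rewrite h1.
by rewrite addr0 in h1 h2; apply/negbTE; rewrite -ltNge.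
Qed.

Lemma left_end_bounds w s : weights w ->
  0 <= left_end w s /\ left_end w s + w s <= 1.
Proof.
move=> [w0 hw]; elim/last_ind: s => [|s b [IH1 IH2]].
  by rewrite /left_end big_ord0 w0 add0r.
rewrite left_end_rcons; have [ws wsE] := hw s.
have [w0s _] := hw (rcons s false); have [w1s _] := hw (rcons s true).
case: b; first by rewrite addr_ge0// -addrA -wsE.
by rewrite addr0; split => //; rewrite (le_trans _ IH2)// lerD2l wsE lerDl.
Qed.

Definition bits_of w (u : measurableTypeR R) : Bits :=
  fun n => nth false (path_of w u n.+1) n.

Lemma mkseq_bits_of w u n : mkseq (bits_of w u) n = path_of w u n.
Proof.
elim: n => // n IHn; rewrite mkseqS IHn /bits_of /=.
by rewrite nth_rcons size_path_of ltnn eqxx.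
Qed.

Lemma measurable_path_of w n s :
  measurable [set u : measurableTypeR R | path_of w u n = s].
Proof.
elim: n s => [|n IHn] s.
  have [->|s0] := eqVneq s [::].
    by rewrite (_ : mkset _ = setT)//; apply/seteqP; split.
  rewrite (_ : mkset _ = set0)//; apply/seteqP; split => // u /= us.
  by rewrite us eqxx in s0.
case/lastP: s => [|s b].
  rewrite (_ : mkset _ = set0)//; apply/seteqP; split => // u /= /(congr1 size).
  by rewrite size_rcons.
rewrite (_ : mkset _ = [set u : measurableTypeR R | path_of w u n = s] `&`
   [set u : measurableTypeR R | (left_end w s + w (rcons s false) <= u) = b]).
  apply: measurableI => //.
  case: b.
    rewrite (_ : mkset _ = `[left_end w s + w (rcons s false), +oo[%classic).
      exact: measurable_itv.
    by apply/seteqP; split => u /=; rewrite in_itv/= andbT.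
  rewrite (_ : mkset _ = `]-oo, left_end w s + w (rcons s false)[%classic).
    exact: measurable_itv.
  by apply/seteqP; split => u /=; rewrite in_itv/= ltNge; case: (_ <= u).
apply/seteqP; split => u /=; first by move=> /rcons_inj[sE]; rewrite sE.
by move=> [-> ->].
Qed.

Lemma measurable_bits_of w : measurable_fun setT (bits_of w).
Proof.
apply: measurable_fun_bits => n.
rewrite (_ : mkset _ = \bigcup_s (if nth false s n then
    [set u : measurableTypeR R | path_of w u n.+1 = s] else set0)).
  apply: countable_bigcupT_measurable; first exact: countableP.
  by move=> s; case: ifPn => _; [exact: measurable_path_of|exact: measurable0].
apply/seteqP; split=> [u /= h|u [s _]]; last by case: ifPn => // ns /= us; rewrite /bits_of /= us.
by exists (path_of w u n.+1) => //; rewrite ifT.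
Qed.

(** The interval attached to s has length [w s], so the image of Lebesgue measure realizes any
    consistent weights and serves as the extension theorem. *)
Lemma unit_lebesgue_cyl w s : weights w ->
  unit_lebesgue (bits_of w @^-1` cyl s) = (w s)%:E.
Proof.
move=> hw; have [h0 h1] := left_end_bounds s hw.
rewrite /unit_lebesgue /mrestr.
rewrite (_ : _ `&` _ = `[left_end w s, left_end w s + w s[%classic).
  rewrite lebesgue_measure_itv /= lte_fin ltrDl.
  have [_|] := ltP 0 (w s); first by rewrite -EFinB addrAC subrr add0r.
  have [ws0 _] := hw.2 s.
  by move=> ws; congr (_%:E); apply/le_anti; rewrite ws ws0.
apply/seteqP; split => u.
  rewrite /preimage /cyl /= mkseq_bits_of !in_itv/= => -[uE u01].
  exact/(path_ofP s hw u01).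
rewrite /preimage /cyl /= mkseq_bits_of !in_itv/= => us.
have u01 : 0 <= u < 1.
  by case/andP: us => a b; rewrite (le_trans h0 a) (lt_le_trans b).
by split => //; apply/(path_ofP s hw u01).
Qed.

HB.instance Definition _ w :=
  isMeasurableFun.Build _ _ _ _ (bits_of w) (@measurable_bits_of w).

Definition weights_prob w : probability Bits R :=
  distribution (unit_lebesgue : probability _ R) (bits_of w).

Lemma weights_prob_cyl w s : weights w -> weights_prob w (cyl s) = (w s)%:E.
Proof. exact: unit_lebesgue_cyl. Qed.

Lemma weights_of_prob (m : probability Bits R) : weights (fun s => fine (m (cyl s))).
Proof.
split; first by rewrite (_ : cyl [::] = setT) ?probability_setT//; exact/seteqP.
move=> s; split; first exact: fine_ge0.
rewrite -fineD ?fin_num_measure//; try exact: measurable_cyl.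
rewrite -measureU//; try exact: measurable_cyl.
  congr (fine (m _)); apply/seteqP; split => c.
    move=> cs; case cn : (c (size s)); [right|left].
      rewrite /cyl /= size_rcons mkseqS cs cn//.
    by rewrite /cyl /= size_rcons mkseqS cs cn.
  by rewrite /cyl /=; rewrite !size_rcons !mkseqS => -[] /rcons_inj[].
apply/seteqP; split => // c [].
by rewrite /cyl /=; rewrite !size_rcons !mkseqS => /rcons_inj[_ ->] /rcons_inj[].
Qed.

Lemma weights_prob_id (m : probability Bits R) A : measurable A ->
  weights_prob (fun s => fine (m (cyl s))) A = m A.
Proof.
apply: bits_measure_unique => s; rewrite weights_prob_cyl; last exact: weights_of_prob.
by rewrite fineK// fin_num_measure//; exact: measurable_cyl.
Qed.

(** For random weights, validity must be a measurable event so that invalid ones can be replaced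
    measurably. *)
Lemma measurable_weights d (T : measurableType d) (w : T -> seq bool -> R) :
  (forall s, measurable_fun setT (w ^~ s)) -> measurable [set t | weights (w t)].
Proof.
move=> mw; rewrite (_ : mkset _ = [set t | w t [::] = 1] `&`
  \bigcap_s ([set t | 0 <= w t s] `&`
     [set t | w t s = w t (rcons s false) + w t (rcons s true)])); last first.
  by apply/seteqP; split => t -[h0 h]; split => // s; [move=> _; exact: h|exact: h].
have meq (f g : T -> R) : measurable_fun setT f -> measurable_fun setT g ->
    measurable [set t | f t = g t].
  move=> mf mg; rewrite (_ : [set t | _] = (fun t => f t == g t) @^-1` [set true]).
    by rewrite -[X in measurable X]setTI; apply: (measurable_fun_eqr mf mg).
  by apply/seteqP; split => t /= /eqP.
apply: measurableI; first exact: meq.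
rewrite -[X in measurable X]setCK setC_bigcap; apply: measurableC.
apply: countable_bigcupT_measurable; first exact: countableP.
move=> s; apply: measurableC; apply: measurableI.
  rewrite (_ : mkset _ = (w ^~ s) @^-1` `[0, +oo[).
    by rewrite -[X in measurable X]setTI; apply: mw => //; exact: measurable_itv.
  by apply/seteqP; split => t; rewrite /preimage/= in_itv/= andbT.
by apply: meq => //; exact: measurable_funD.
Qed.

End weights.

(** * Expectations of bounded measurable functions *)

Section bounded_measurable.
Context {R : realType} d {T : measurableType d}.
Implicit Types f g : T -> R.

Definition bm f : Prop :=
  measurable_fun setT f /\ exists r : R, forall x, `|f x| <= r.

Lemma bm_cst (a : R) : bm (fun=> a).
Proof. by split; [exact: measurable_cst|exists `|a|]. Qed.

Lemma bmD f g : bm f -> bm g -> bm (fun x => f x + g x).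
Proof.
move=> [mf [r hr]] [mg [s hs]]; split; first exact: measurable_funD.
by exists (r + s) => x; rewrite (le_trans (ler_normD _ _))// lerD.
Qed.

Lemma bmM f g : bm f -> bm g -> bm (fun x => f x * g x).
Proof.
move=> [mf [r hr]] [mg [s hs]]; split; first exact: measurable_funM.
by exists (r * s) => x; rewrite normrM ler_pM.
Qed.

Lemma bmZ a f : bm f -> bm (fun x => a * f x).
Proof. by apply: bmM; exact: bm_cst. Qed.

Lemma bmB f g : bm f -> bm g -> bm (fun x => f x - g x).
Proof.
move=> mf /(bmZ (-1)) mg; have := bmD mf mg.
by under eq_fun do rewrite mulN1r.
Qed.

Lemma bmX f n : bm f -> bm (fun x => f x ^+ n).
Proof.
move=> bf; elim: n => [|n IHn]; first exact: bm_cst.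
by under eq_fun do rewrite exprS; exact: bmM.
Qed.

Lemma bm_prod (I : Type) (s : seq I) (f : I -> T -> R) :
  (forall i, bm (f i)) -> bm (fun x => \prod_(i <- s) f i x).
Proof.
move=> bf; elim: s => [|i s IHs].
  by under eq_fun do rewrite big_nil; exact: bm_cst.
by under eq_fun do rewrite big_cons; exact: bmM.
Qed.

Lemma bm_sum (I : Type) (s : seq I) (f : I -> T -> R) :
  (forall i, bm (f i)) -> bm (fun x => \sum_(i <- s) f i x).
Proof.
move=> bf; elim: s => [|i s IHs].
  by under eq_fun do rewrite big_nil; exact: bm_cst.
by under eq_fun do rewrite big_cons; exact: bmD.
Qed.

Lemma bm_norm f : bm f -> bm (fun x => `|f x|).
Proof.
move=> [mf [r hr]]; split; first exact: measurableT_comp.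
by exists r => x; rewrite normr_id.
Qed.

Lemma bm_indic (A : set T) : measurable A -> bm (\1_A : T -> R).
Proof.
move=> mA; split; first exact: measurable_indic.
by exists 1 => x; rewrite indicE; case: (_ \in _); rewrite ?normr1 ?normr0 ?ler01.
Qed.

Lemma bm_comp d' (T' : measurableType d') (h : T' -> T) f :
  measurable_fun setT h -> bm f ->
  measurable_fun setT (f \o h) /\ exists r : R, forall x, `|(f \o h) x| <= r.
Proof.
move=> mh [mf [r hr]]; split; first exact: measurableT_comp.
by exists r => x; exact: hr.
Qed.

Lemma bm_limit (f_ : nat -> T -> R) f (r : R) : (forall n, bm (f_ n)) ->
  (forall n x, `|f_ n x| <= r) -> (forall x, f_ ^~ x @ \oo --> f x) -> bm f.
Proof.
move=> bf fr cf; split.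
  by apply: (measurable_fun_cvg (h := f_)) => [m|x _]; [exact: (bf m).1|exact: cf].
exists r => x; have cx : `|f_ n x| @[n --> \oo] --> `|f x| by apply: cvg_norm; exact: cf.
rewrite -(cvg_lim _ cx)//; apply: limr_le; first by apply/cvg_ex; exists `|f x|.
exact: nearW.
Qed.

End bounded_measurable.

Section expectation.
Context {R : realType} d {T : measurableType d} (P : probability T R).
Implicit Types f g : T -> R.

Lemma bm_integrable f : bm f -> P.-integrable setT (EFin \o f).
Proof.
move=> [mf [r hr]]; apply: measurable_bounded_integrable => //.
  by rewrite [X in (X < _)%E]probability_setT ltry.
exists r; split; first exact: num_real.
by move=> s rs x _; apply: (le_trans (hr x)); exact: ltW.
Qed.

Lemma expD f g : bm f -> bm g ->
  \int[P]_x (f x + g x) = \int[P]_x f x + \int[P]_x g x.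
Proof. by move=> bf bg; apply: RintegralD => //; exact: bm_integrable. Qed.

Lemma expB f g : bm f -> bm g ->
  \int[P]_x (f x - g x) = \int[P]_x f x - \int[P]_x g x.
Proof. by move=> bf bg; apply: RintegralB => //; exact: bm_integrable. Qed.

Lemma expZ a f : bm f -> \int[P]_x (a * f x) = a * \int[P]_x f x.
Proof. by move=> bf; apply: RintegralZl => //; exact: bm_integrable. Qed.

Lemma exp_cst a : \int[P]_x a = a.
Proof. by rewrite Rintegral_cst// [X in fine X]probability_setT mulr1. Qed.

Lemma exp_le f g : bm f -> bm g -> (forall x, f x <= g x) ->
  \int[P]_x f x <= \int[P]_x g x.
Proof. by move=> bf bg fg; apply: le_Rintegral => //; exact: bm_integrable. Qed.

Lemma exp_sum (I : Type) (s : seq I) (f : I -> T -> R) :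
  (forall i, bm (f i)) ->
  \int[P]_x (\sum_(i <- s) f i x) = \sum_(i <- s) \int[P]_x f i x.
Proof.
move=> bf; elim: s => [|i s IHs].
  by rewrite big_nil -[RHS]exp_cst; apply: eq_Rintegral => x _; rewrite big_nil.
rewrite big_cons -IHs -expD//; last exact: bm_sum.
by apply: eq_Rintegral => x _; rewrite big_cons.
Qed.

Lemma exp_norm f : bm f -> `|\int[P]_x f x| <= \int[P]_x `|f x|.
Proof. by move=> bf; apply: le_normr_Rintegral => //; exact: bm_integrable. Qed.

Lemma exp_le_bound f (r : R) : bm f -> (forall x, `|f x| <= r) ->
  `|\int[P]_x f x| <= r.
Proof.
move=> bf fr; rewrite (le_trans (exp_norm bf))// -[leRHS]exp_cst.
by apply: exp_le => //; [exact: bm_norm|exact: bm_cst].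
Qed.

Lemma exp_indic (A : set T) : measurable A -> \int[P]_x (\1_A x : R) = fine (P A).
Proof. by move=> mA; rewrite /Rintegral integral_indic// setIT. Qed.

Lemma exp_EFin f : bm f -> (\int[P]_x f x)%:E = (\int[P]_x (f x)%:E)%E.
Proof.
move=> bf; rewrite fineK//; apply: integrable_fin_num => //.
exact: bm_integrable.
Qed.

Lemma exp_cvg_ae (f_ : nat -> T -> R) f (r : R) :
  (forall n, bm (f_ n)) -> bm f -> (forall n x, `|f_ n x| <= r) ->
  {ae P, forall x, f_ ^~ x @ \oo --> f x} ->
  \int[P]_x f_ n x @[n --> \oo] --> \int[P]_x f x.
Proof.
move=> bf_ bf fr cf.
have [] := @dominated_convergence _ T R P setT measurableT
  (fun n x => (f_ n x)%:E) (EFin \o f) (fun=> r%:E).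
- by move=> n; apply/measurable_EFinP; exact: (bf_ n).1.
- by apply/measurable_EFinP; exact: bf.1.
- apply: filterS cf => x cfx _; apply: cvg_EFin; last exact: cfx.
  by apply: nearW.
- exact: (bm_integrable (bm_cst r)).
- by apply: nearW => x n _; rewrite /= lee_fin.
move=> _ _ /= h; apply: fine_cvg.
by rewrite exp_EFin.
Qed.

Lemma exp_cvg (f_ : nat -> T -> R) f (r : R) :
  (forall n, bm (f_ n)) -> (forall n x, `|f_ n x| <= r) ->
  (forall x, f_ ^~ x @ \oo --> f x) ->
  \int[P]_x f_ n x @[n --> \oo] --> \int[P]_x f x.
Proof.
move=> bf fr cf; apply: (exp_cvg_ae bf (bm_limit bf fr cf) fr).
exact: nearW.
Qed.

Lemma exp_ae_eq f g : bm f -> bm g -> {ae P, forall x, f x = g x} ->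
  \int[P]_x f x = \int[P]_x g x.
Proof.
move=> bf bg fg; congr fine; apply: ae_eq_integral => //.
- by apply/measurable_EFinP; exact: bf.1.
- by apply/measurable_EFinP; exact: bg.1.
- by apply: filterS fg => x /= -> _.
Qed.

End expectation.

(** * Layer cake approximation and the monotone class theorem *)

Section layer_cake.
Context {R : realType}.

(** A discrete layer cake: the count of thresholds 1, ..., n below y is y up to an error 1, and
    composed with a function it is a sum of indicators of superlevel sets. *)
Definition layers n (y : R) : R := \sum_(k < n) ((k.+1%:R : R) < y)%R%:R.

Lemma layersS n (y : R) : layers n.+1 y = layers n y + ((n.+1%:R : R) < y)%R%:R.
Proof. by rewrite /layers big_ord_recr. Qed.

Lemma layersP n (y : R) : 0 <= y -> y <= n%:R -> y - 1 <= layers n y <= y.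
Proof.
move=> y0 yn.
(* The assumption y <= n does not survive induction on n, whence the truncated form. *)
suff : Num.min y n.+1%:R - 1 <= layers n y <= Num.min y n%:R.
  rewrite (min_idPl yn) (min_idPl (le_trans yn _)) ?ler_nat//.
elim: {yn}n => [|n /andP[IH1 IH2]].
  rewrite /layers big_ord0 (min_idPr y0) lexx andbT subr_le0.
  by rewrite ge_min lexx orbT.
rewrite layersS.
have [ny|ny] := ltP n.+1%:R y; last first.
  rewrite addr0.
  have nSy : y <= n.+2%:R by rewrite (le_trans ny)// ler_nat.
  rewrite (min_idPl nSy); move: IH1; rewrite (min_idPl ny) => ->/=.
  by rewrite (le_trans IH2)// ge_min lexx.
move: IH1 IH2; rewrite (min_idPr (ltW ny)) => IH1.
have ny' : n%:R <= y by rewrite (le_trans _ (ltW ny))// ler_nat.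
rewrite (min_idPr ny') => IH2.
have h : Num.min y n.+2%:R <= n.+2%:R by rewrite ge_min lexx orbT.
by move: IH1 IH2 h; rewrite /= -!natr1 => *; apply/andP; split; lra.
Qed.

End layer_cake.

Section monotone_class.
Context {R : realType} d {T : measurableType d}.

Lemma cvg_bounded_by_inv (u : nat -> R) (l c : R) :
  (forall n, `|u n - l| <= c / n.+1%:R) -> u @ \oo --> l.
Proof.
move=> h; apply/cvgrPdist_le => e e0.
have c0 : 0 <= c by have := h 0%N; rewrite divr1; exact: le_trans.
have [N _ hN] := near_infty_natSinv_lt (PosNum (divr_gt0 e0 (ltr_wpDl c0 ltr01))).
exists N => // n Nn; rewrite distrC (le_trans (h n))//.
have := hN n Nn; rewrite /= ltr_pdivlMr ?ltr_wpDl// => /ltW; apply: le_trans.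
by rewrite mulrC ler_wpM2l// lerDl.
Qed.

Variable Q : (T -> R) -> Prop.
Hypothesis Q1 : Q (fun=> 1).
Hypothesis Qlin : forall a f g, bm f -> bm g -> Q f -> Q g ->
  Q (fun x => a * f x + g x).
Hypothesis Qlim : forall (f_ : nat -> T -> R) f (r : R),
  (forall n, bm (f_ n)) -> (forall n x, `|f_ n x| <= r) ->
  (forall x, f_ ^~ x @ \oo --> f x) -> (forall n, Q (f_ n)) -> Q f.

Let Q0 : Q (fun=> 0).
Proof.
have := Qlin (-1) (bm_cst 1) (bm_cst 1) Q1 Q1.
by under eq_fun do rewrite mulN1r addNr.
Qed.

Let QZ a f : bm f -> Q f -> Q (fun x => a * f x).
Proof.
move=> bf Qf; have := Qlin a bf (bm_cst 0) Qf Q0.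
by under eq_fun do rewrite addr0.
Qed.

Let QD f g : bm f -> bm g -> Q f -> Q g -> Q (fun x => f x + g x).
Proof.
move=> bf bg Qf Qg; have := Qlin 1 bf bg Qf Qg.
by under eq_fun do rewrite mul1r.
Qed.

Let Qindic_class (G : set (set T)) : @measurable _ T = <<s G >> -> setI_closed G ->
  (forall A, G A -> Q \1_A) -> forall A, measurable A -> Q \1_A.
Proof.
move=> GE GI QG A mA.
apply: (dynkin_induction (P := fun A => Q \1_A) GE GI) => //.
- by rewrite indicT; exact: Q1.
- move=> S mS QS; have := Qlin (-1) (bm_indic mS) (bm_cst 1) QS Q1.
  rewrite (_ : (fun x => _) = \1_(~` S))//; apply/funext => x.
  by rewrite !indicE in_setC; case: (x \in S); rewrite /= ?mulr1 ?mulr0 ?addNr ?add0r.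
- move=> F mF tF QF; pose U n := \big[setU/set0]_(k < n) F k.
  have mU n : measurable (U n) by apply: bigsetU_measurable => k _; exact: mF.
  have QU n : Q \1_(U n).
    elim: n => [|n IHn].
      by rewrite /U big_ord0 indic0; exact: Q0.
    rewrite /U big_ord_recr /= -/(U n).
    have := QD (bm_indic (mU n)) (bm_indic (mF n)) IHn (QF n).
    rewrite (_ : (fun x => _) = \1_(U n `|` F n))//; apply/funext => x.
    rewrite !indicE in_setU; have [xU|xU] /= := boolP (x \in U n); last by rewrite add0r.
    have [xF|xF] := boolP (x \in F n); last by rewrite addr0.
    move: xU xF; rewrite !inE /U -bigcup_mkord => -[k /= kn Fk] Fn.
    move/trivIsetP : (tF) => /(_ k n I I); rewrite (ltn_eqF kn) => /(_ isT).
    by move/seteqP => [/(_ x)] h; exfalso; apply: h.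
  apply: (Qlim (f_ := fun n => \1_(U n)) (r := 1)) => //.
  - by move=> n; exact: bm_indic.
  - by move=> n x; rewrite indicE; case: (_ \in _); rewrite ?normr1 ?normr0 ?ler01.
  - move=> x; rewrite [X in _ --> X]indicE.
    have [|xF] := boolP (x \in _).
      rewrite inE => -[k _ Fk]; apply: cvg_near_cst; exists k.+1 => // n /= kn.
      by rewrite indicE mem_set// /U -bigcup_mkord; exists k.
    apply: cvg_near_cst; apply: nearW => n; rewrite indicE memNset//.
    rewrite /U -bigcup_mkord => -[k _ Fk]; move: xF; rewrite notin_setE; apply.
    by exists k.
by rewrite -GE.
Qed.

(** Dynkin's theorem handles indicators. A bounded f, rescaled affinely to [0, n + 1], is
    approximated by its layers; undoing the scaling leaves a uniform error of order 1 / (n + 1), so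
    f is a bounded limit of combinations of indicators. *)
Lemma monotone_class (G : set (set T)) : @measurable _ T = <<s G >> -> setI_closed G ->
  (forall A, G A -> Q \1_A) -> forall f, bm f -> Q f.
Proof.
move=> GE GI QG f [mf [r hr]].
have Qindic := Qindic_class GE GI QG.
(* The summand 1 keeps the divisor [2 * s] positive even when the bound on f is 0. *)
pose s := `|r| + 1; have s0 : 0 < s by rewrite ltr_wpDl.
have fs x : `|f x| <= s by rewrite (le_trans (hr x))// (le_trans (ler_norm _))// lerDl.
pose h n x := n.+1%:R * ((f x + s) / (2 * s)).
have h0 n x : 0 <= h n x.
  rewrite mulr_ge0// divr_ge0// ?mulr_ge0 ?(ltW s0)//.
  by rewrite -lerBlDr sub0r; have := fs x; rewrite ler_norml => /andP[].
have hn n x : h n x <= n.+1%:R.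
  rewrite ler_piMr// ler_pdivrMr ?mulr_gt0// mul1r mulr_natl mulr2n lerD2r.
  by have := fs x; rewrite ler_norml => /andP[].
have mh n : measurable_fun setT (h n).
  apply: measurable_funM => //; apply: measurable_funM => //.
  exact: measurable_funD.
have bl n k : bm (\1_[set x | k.+1%:R < h n x] : T -> R).
  apply: bm_indic; rewrite (_ : mkset _ = h n @^-1` `]k.+1%:R, +oo[).
    by rewrite -[X in measurable X]setTI; apply: mh => //; exact: measurable_itv.
  by apply/seteqP; split => x; rewrite /preimage/= in_itv/= andbT.
have layersE n x : layers n.+1 (h n x) =
    \sum_(k < n.+1) \1_[set x | k.+1%:R < h n x] x.
  by apply: eq_bigr => k _; rewrite indicE mem_setE.
have bL n m : bm (fun x => \sum_(k < m) (\1_[set x | k.+1%:R < h n x] x : R)).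
  by apply: (@bm_sum _ _ _ _ _ (fun k : 'I_m => \1_[set x | k.+1%:R < h n x])).
have QL n m : Q (fun x => \sum_(k < m) (\1_[set x | k.+1%:R < h n x] x : R)).
  elim: m => [|m IHm].
    by rewrite (_ : (fun x => _) = (fun=> 0)) //; apply/funext => x; rewrite big_ord0.
  rewrite (_ : (fun x => _) = (fun x => (\sum_(k < m) (\1_[set x | k.+1%:R < h n x] x : R))
      + \1_[set x | m.+1%:R < h n x] x)).
    apply: QD => //; apply: Qindic.
    rewrite (_ : mkset _ = h n @^-1` `]m.+1%:R, +oo[).
      by rewrite -[X in measurable X]setTI; apply: mh => //; exact: measurable_itv.
    by apply/seteqP; split => x; rewrite /preimage/= in_itv/= andbT.
  by apply/funext => x; rewrite big_ord_recr.
pose f_ n x := (2 * s / n.+1%:R) * (\sum_(k < n.+1) (\1_[set x | k.+1%:R < h n x] x : R)) + (- s).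
have bf_ n : bm (f_ n) by apply: bmD; [exact: bmZ|exact: bm_cst].
have ff_ n x : `|f_ n x - f x| <= 2 * s / n.+1%:R.
  have /andP[l1 l2] := layersP (h0 n x) (hn n x).
  have fE : f x = (2 * s / n.+1%:R) * h n x - s.
    by rewrite /h; field; rewrite gt_eqF//= pnatr_eq0.
  rewrite /f_ -layersE fE opprB addrA addrNK -mulrBr normrM.
  rewrite ger0_norm ?divr_ge0 ?mulr_ge0 ?(ltW s0)//.
  rewrite ler_piMr ?divr_ge0 ?mulr_ge0 ?(ltW s0)// ler_norml lerBrDr addrC l1/=.
  by rewrite (le_trans _ (ler01))// subr_le0.
apply: (Qlim (f_ := f_) (r := s + 2 * s)) => //.
- move=> n x; rewrite -(subrK (f x) (f_ n x)) addrC (le_trans (ler_normD _ _))//.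
  rewrite lerD// (le_trans (ff_ n x))// ler_piMr ?mulr_ge0 ?(ltW s0)//.
  by rewrite invf_le1// ler1n.
- by move=> x; apply: (cvg_bounded_by_inv (c := 2 * s)) => n; exact: ff_.
- move=> n; apply: QD; [exact: bmZ|exact: bm_cst|apply: QZ|] => //.
  have := QZ (- s) (bm_cst 1) Q1.
  by rewrite (_ : (fun x => _) = (fun=> - s))//; apply/funext => x; rewrite mulr1.
Qed.

End monotone_class.

(** * Measurable families of probabilities, mixtures and Fubini's theorem *)

Section probability_families.
Context {R : realType}.

Definition mfun_of d d' (T : measurableType d) (T' : measurableType d') (f : T -> T')
    (mf : measurable_fun setT f) : {mfun T >-> T'} :=
  HB.pack f (isMeasurableFun.Build d d' T T' f mf).

Definition push d d' (T : measurableType d) (T' : measurableType d')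
    (P : probability T R) (f : T -> T') (mf : measurable_fun setT f) :
  probability T' R := distribution P (mfun_of mf).

Lemma pushE d d' (T : measurableType d) (T' : measurableType d')
    (P : probability T R) (f : T -> T') (mf : measurable_fun setT f) A :
  push P mf A = P (f @^-1` A).
Proof. by []. Qed.

Lemma prob_fineK d (T : measurableType d) (P : probability T R) A :
  measurable A -> (fine (P A))%:E = P A.
Proof. by move=> mA; rewrite fineK// fin_num_measure. Qed.

Lemma prob_fine_ge0 d (T : measurableType d) (P : probability T R) A :
  0 <= fine (P A).
Proof. exact: fine_ge0. Qed.

Lemma prob_fine_le1 d (T : measurableType d) (P : probability T R) A :
  measurable A -> fine (P A) <= 1.
Proof. by move=> mA; rewrite -lee_fin prob_fineK// probability_le1. Qed.

Lemma prob_fine_norm d (T : measurableType d) (P : probability T R) A :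
  measurable A -> `|fine (P A)| <= 1.
Proof. by move=> mA; rewrite ger0_norm ?prob_fine_le1 ?prob_fine_ge0. Qed.

Lemma exp_push d d' (T : measurableType d) (T' : measurableType d')
    (P : probability T R) (h : T -> T') (mh : measurable_fun setT h) (f : T' -> R) :
  bm f -> \int[push P mh]_y f y = \int[P]_x f (h x).
Proof.
move=> bf; have bfh : bm (fun x => f (h x)) := bm_comp mh bf.
congr fine; rewrite integral_distribution//.
  by apply/measurable_EFinP; exact: bf.1.
exact: bm_integrable bfh.
Qed.

Lemma exp_lin d (T : measurableType d) (P : probability T R) a (f g : T -> R) :
  bm f -> bm g -> \int[P]_x (a * f x + g x) = a * \int[P]_x f x + \int[P]_x g x.
Proof. by move=> bf bg; rewrite expD ?expZ//; exact: bmZ. Qed.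

Section family.
Context d d' {X : measurableType d} {Y : measurableType d'}.
Variable F : X -> probability Y R.

(** A probability kernel given as a plain function into bundled probabilities, so that images,
    products and mixtures can serve as its values. *)
Definition pfam : Prop :=
  forall A, measurable A -> measurable_fun setT (fun x => F x A).

Lemma pfam_bm A : pfam -> measurable A -> bm (fun x => fine (F x A)).
Proof.
move=> mF mA; split; last by exists 1 => x; exact: prob_fine_norm.
by apply: measurableT_comp (mF A mA) => //; exact: measurable_fine.
Qed.

Lemma pfam_from (G : set (set Y)) : @measurable _ Y = <<s G >> -> setI_closed G ->
  (forall A, G A -> measurable_fun setT (fun x => fine (F x A))) -> pfam.
Proof.
move=> GE GI GF A mA.
suff h (f : Y -> R) : bm f -> measurable_fun setT (fun x => \int[F x]_y f y).
  rewrite (_ : (fun x => _) = (EFin \o (fun x => \int[F x]_y (\1_A y : R)))).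
    by apply/measurable_EFinP; apply: h; exact: bm_indic.
  by apply/funext => x /=; rewrite exp_indic// prob_fineK.
apply: (monotone_class (Q := fun f : Y -> R => measurable_fun setT (fun x => \int[F x]_y f y)) _ _ _ GE GI).
- under eq_fun do rewrite exp_cst.
  exact: measurable_cst.
- move=> a g k bg bk mg mk.
  under eq_fun do rewrite exp_lin//.
  by apply: measurable_funD => //; exact: measurable_funM.
- move=> f_ g r bf fr fg mf.
  apply: (measurable_fun_cvg (h := fun n x => \int[F x]_y f_ n y)) => [//|x _].
  exact: exp_cvg.
- move=> B GB; have mB : measurable B by rewrite GE; exact: sub_sigma_algebra.
  by under eq_fun do rewrite exp_indic//; exact: GF.
Qed.

Lemma bm_section (f : X * Y -> R) x : bm f -> bm (fun y => f (x, y)).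
Proof.
move=> [mf [r hr]]; split; last by exists r => y; exact: hr.
by apply: measurableT_comp => //; exact: measurable_pair1.
Qed.

Lemma pfam_exp2 (f : X * Y -> R) : pfam -> bm f ->
  bm (fun x => \int[F x]_y f (x, y)).
Proof.
move=> mF bf; split; last first.
  have [_ [r hr]] := bf; exists r => x; apply: exp_le_bound => //.
  exact: bm_section.
move: f bf.
apply: (monotone_class (Q := fun f : X * Y -> R => measurable_fun setT (fun x => \int[F x]_y f (x, y)))
   _ _ _ (measurable_prod_measurableType X Y)).
- under eq_fun do rewrite exp_cst.
  exact: measurable_cst.
- move=> a g k bg bk mg mk.
  under eq_fun do rewrite (exp_lin _ _ (bm_section _ bg) (bm_section _ bk)).
  by apply: measurable_funD => //; exact: measurable_funM.
- move=> f_ g r bf fr fg mf.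
  apply: (measurable_fun_cvg (h := fun n x => \int[F x]_y f_ n (x, y))) => [//|x _].
  apply: (exp_cvg (r := r)) => // n; exact: bm_section.
- move=> _ _ [A1 mA1 [B1 mB1 <-]] [A2 mA2 [B2 mB2 <-]].
  rewrite -setXI; exists (A1 `&` A2); first exact: measurableI.
  by exists (B1 `&` B2) => //; exact: measurableI.
- move=> _ [A mA [B mB <-]].
  rewrite (_ : (fun x => _) = (fun x => \1_A x * fine (F x B))).
    by apply: measurable_funM; [exact: measurable_indic|exact: (pfam_bm mF mB).1].
  apply/funext => x; rewrite -(exp_indic (F x) mB) -expZ; last exact: bm_indic.
  by apply: eq_Rintegral => y _; rewrite !indicE in_setX; case: (x \in A); rewrite ?mul1r ?mul0r.
Qed.

Lemma pfam_exp (f : Y -> R) : pfam -> bm f -> bm (fun x => \int[F x]_y f y).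
Proof.
move=> mF bf; apply: (pfam_exp2 (f := f \o snd)) => //.
by apply: bm_comp => //; exact: measurable_snd.
Qed.

(** Both sides are linear in f and stable under bounded limits, so recognizing Q as a mixture takes
    only a generating family closed under intersection. *)
Lemma exp_mix (G : set (set Y)) (P : probability X R) (Q : probability Y R) :
  @measurable _ Y = <<s G >> -> setI_closed G -> pfam ->
  (forall A, G A -> fine (Q A) = \int[P]_x fine (F x A)) ->
  forall f, bm f -> \int[Q]_y f y = \int[P]_x \int[F x]_y f y.
Proof.
move=> GE GI mF GPQ.
apply: (monotone_class (Q := fun f : Y -> R => \int[Q]_y f y = \int[P]_x \int[F x]_y f y) _ _ _ GE GI).
- by under [RHS]eq_Rintegral do rewrite exp_cst; rewrite !exp_cst.
- move=> a g k bg bk gE kE; rewrite expD ?expZ//; last exact: bmZ.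
  rewrite gE kE -expZ; last exact: pfam_exp.
  rewrite -expD; [|exact: bmZ (pfam_exp mF bg)|exact: pfam_exp].
  by apply: eq_Rintegral => x _; rewrite expD ?expZ//; exact: bmZ.
- move=> f_ g r bf fr fg fE.
  have h1 := exp_cvg (P := Q) bf fr fg.
  have h2 : \int[P]_x \int[F x]_y f_ n y @[n --> \oo] --> \int[P]_x \int[F x]_y g y.
    apply: (exp_cvg (r := r)) => [n|n x|x].
    - exact: pfam_exp.
    - exact: exp_le_bound.
    - exact: (exp_cvg (r := r)).
  apply: (@cvg_unique _ _ (\int[Q]_y f_ n y @[n --> \oo])) h1 _ => //.
  by rewrite (funext fE).
- move=> A GA; have mA : measurable A by rewrite GE; exact: sub_sigma_algebra.
  rewrite exp_indic// GPQ//; apply: eq_Rintegral => x _.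
  by rewrite exp_indic.
Qed.

End family.

Lemma exp_unique d (Y : measurableType d) (G : set (set Y)) (P Q : probability Y R) :
  @measurable _ Y = <<s G >> -> setI_closed G ->
  (forall A, G A -> P A = Q A) ->
  forall f, bm f -> \int[P]_y f y = \int[Q]_y f y.
Proof.
move=> GE GI PQ f bf.
(* Uniqueness is the mixture formula for the constant family Q. *)
have cQ : pfam (fun _ : Y => Q) by move=> A mA; exact: measurable_cst.
have PQ' A : G A -> fine (P A) = \int[P]__ fine (Q A).
  by move=> GA; rewrite exp_cst PQ.
by rewrite (exp_mix GE GI cQ PQ' bf) exp_cst.
Qed.

Lemma prob_unique d (Y : measurableType d) (G : set (set Y)) (P Q : probability Y R) :
  @measurable _ Y = <<s G >> -> setI_closed G ->
  (forall A, G A -> P A = Q A) -> forall A, measurable A -> P A = Q A.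
Proof.
move=> GE GI PQ A mA; rewrite -(prob_fineK P mA) -(prob_fineK Q mA); congr EFin.
rewrite -(exp_indic P mA) -(exp_indic Q mA); apply: (exp_unique GE GI PQ).
exact: bm_indic.
Qed.

Lemma exp_same d (Y : measurableType d) (m1 m2 : probability Y R) (f : Y -> R) :
  same_measure m1 m2 -> bm f -> \int[m1]_y f y = \int[m2]_y f y.
Proof.
move=> h; apply: (exp_unique (G := @measurable _ Y)).
- by rewrite (sigma_algebra_id (@sigma_algebra_measurable _ Y)).
- exact: measurableI.
- by move=> A mA; rewrite h.
Qed.

Section fubini.
Context d d' {X : measurableType d} {Y : measurableType d'}.
Variables (P : probability X R) (Q : probability Y R).

Lemma pfam_cst d1 (Z : measurableType d1) : pfam (fun _ : Z => Q).
Proof. by move=> A mA; exact: measurable_cst. Qed.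

Lemma exp_fubini (f : X * Y -> R) : bm f ->
  \int[(P \x Q)%E]_z f z = \int[P]_x \int[Q]_y f (x, y).
Proof.
apply: (monotone_class (Q := fun f : X * Y -> R =>
    \int[(P \x Q)%E]_z f z = \int[P]_x \int[Q]_y f (x, y))
   _ _ _ (measurable_prod_measurableType X Y)).
- by under [RHS]eq_Rintegral do rewrite exp_cst; rewrite !exp_cst.
- move=> a g k bg bk gE kE; rewrite expD ?expZ//; last exact: bmZ.
  have cQ := @pfam_cst _ X.
  rewrite gE kE -expZ; last exact: pfam_exp2.
  rewrite -expD; [|exact: bmZ (pfam_exp2 cQ bg)|exact: (pfam_exp2 cQ bk)].
  apply: eq_Rintegral => x _; rewrite expD ?expZ//; try exact: bm_section.
  by apply: bmZ; exact: bm_section.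
- move=> f_ g r bf fr fg fE.
  have h1 := exp_cvg (P := (P \x Q)%E) bf fr fg.
  have h2 : \int[P]_x \int[Q]_y f_ n (x, y) @[n --> \oo] --> \int[P]_x \int[Q]_y g (x, y).
    apply: (exp_cvg (r := r)) => [n|n x|x].
    - by apply: (pfam_exp2 (@pfam_cst _ X)); exact: bf.
    - by apply: exp_le_bound => //; exact: bm_section.
    - by apply: (exp_cvg (r := r)) => // n; exact: bm_section.
  apply: (@cvg_unique _ _ (\int[(P \x Q)%E]_y f_ n y @[n --> \oo])) h1 _ => //.
  by rewrite (funext fE).
- move=> _ _ [A1 mA1 [B1 mB1 <-]] [A2 mA2 [B2 mB2 <-]].
  rewrite -setXI; exists (A1 `&` A2); first exact: measurableI.
  by exists (B1 `&` B2) => //; exact: measurableI.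
- move=> _ [A mA [B mB <-]].
  rewrite exp_indic; last exact: measurableX.
  rewrite [LHS](_ : _ = fine (P A * Q B)%E); last by congr fine; exact: product_measure1E.
  rewrite fineM ?fin_num_measure// -(exp_indic P mA).
  rewrite mulrC -expZ; last exact: bm_indic.
  apply: eq_Rintegral => x _; rewrite mulrC -(exp_indic Q mB) -expZ; last exact: bm_indic.
  by apply: eq_Rintegral => y _; rewrite !indicE in_setX; case: (x \in A); rewrite ?mul1r ?mul0r.
Qed.

End fubini.

Lemma exp_fubini_swap d d' (X : measurableType d) (Y : measurableType d')
    (P : probability X R) (Q : probability Y R) (f : X * Y -> R) : bm f ->
  \int[P]_x \int[Q]_y f (x, y) = \int[Q]_y \int[P]_x f (x, y).
Proof.
move=> bf; have sm : measurable_fun setT (fun z : Y * X => (z.2, z.1)).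
  by apply: measurable_fun_pair; [exact: measurable_snd|exact: measurable_fst].
have bfs : bm (f \o (fun z : Y * X => (z.2, z.1))) := bm_comp sm bf.
rewrite -exp_fubini//.
rewrite -[RHS](exp_fubini _ _ bfs) -[RHS](exp_push _ sm bf).
apply: (exp_unique (measurable_prod_measurableType X Y)) bf.
  move=> _ _ [A1 mA1 [B1 mB1 <-]] [A2 mA2 [B2 mB2 <-]].
  rewrite -setXI; exists (A1 `&` A2); first exact: measurableI.
  by exists (B1 `&` B2) => //; exact: measurableI.
move=> _ [A mA [B mB <-]]; rewrite pushE.
rewrite (_ : _ @^-1` _ = B `*` A).
  have e1 := @product_measure1E _ _ _ _ _ P Q A B mA mB.
  have e2 := @product_measure1E _ _ _ _ _ Q P B A mB mA.
  by apply: (etrans e1); rewrite muleC; apply: esym; exact: e2.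
by apply/seteqP; split => -[y x] /= [].
Qed.

End probability_families.

(** * The space of probabilities *)

Section cutoffs.
Context {R : realType} {M : pmetricType R}.
Variables (c : nat -> M) (r : nat -> R).

Definition bal n : set M := ball (c n) (r n).

(** A continuous ramp of slope k that vanishes off the ball and is 1 at depth at least 1 / k inside
    it; it tends to the indicator of the open ball from below. *)
Definition cut n k (x : M) : R := Num.min 1 (Num.max 0 (k%:R * (r n - mdist x (c n)))).

Definition phi (s : seq nat) k (x : M) : R := \prod_(n <- s) cut n k x.

Definition inter (s : seq nat) : set M := [set x | forall n, n \in s -> bal n x].

Lemma cut_ge0 n k x : 0 <= cut n k x.
Proof. by rewrite /cut le_min ler01 le_max lexx. Qed.

Lemma cut_le1 n k x : cut n k x <= 1.
Proof. by rewrite /cut ge_min lexx. Qed.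

Lemma cut_eq0 n k x : ~ bal n x -> cut n k x = 0.
Proof.
move=> /ball_mdist/negP; rewrite -leNgt metric_sym => h.
rewrite /cut (max_idPl _) ?(min_idPr _) ?ler01//.
by rewrite mulr_ge0_le0// subr_le0.
Qed.

Lemma cut_eq1 n x : bal n x -> \forall k \near \oo, cut n k x = 1.
Proof.
move=> /ball_mdist; rewrite metric_sym -subr_gt0 => h.
have [N _ hN] := near_infty_natSinv_lt (PosNum h).
exists N.+1 => // -[//|k] /= Nk; rewrite /cut.
have kh := hN k Nk; apply/min_idPl; rewrite le_max; apply/orP; right.
by rewrite mulrC -ler_pdivrMr// div1r ltW.
Qed.

Lemma cut_continuous n k : continuous (cut n k).
Proof.
rewrite (_ : cut n k = (fun=> 1) \min
  ((fun=> 0) \max (fun x => k%:R * (r n - mdist x (c n)))))//.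
move=> x; apply: (@continuous_min R); first exact: cvg_cst.
apply: (@continuous_max R); first exact: cvg_cst.
apply: cvgM; first exact: cvg_cst.
apply: cvgB; first exact: cvg_cst.
exact: mdist_continuous.
Qed.

Lemma phi_ge0 s k x : 0 <= phi s k x.
Proof. by apply: prodr_ge0 => n _; exact: cut_ge0. Qed.

Lemma phi_le1 s k x : phi s k x <= 1.
Proof. by apply: prodr_ile1 => n _; rewrite cut_ge0 cut_le1. Qed.

Lemma phi_norm s k x : `|phi s k x| <= 1.
Proof. by rewrite ger0_norm ?phi_ge0 ?phi_le1. Qed.

Lemma phi_continuous s k : continuous (phi s k).
Proof.
elim: s => [|n s IHs] x.
  rewrite /phi; under [X in continuous_at _ X]eq_fun do rewrite big_nil.
  exact: cvg_cst.
rewrite /phi; under [X in continuous_at _ X]eq_fun do rewrite big_cons.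
by apply: cvgM; [exact: cut_continuous|exact: IHs].
Qed.

Lemma bm_phi s k : bm (phi s k : borel M -> R).
Proof.
split; first by apply: continuous_measurable_real; exact: phi_continuous.
by exists 1; exact: phi_norm.
Qed.

Lemma phi_eq0 s k x : ~ inter s x -> phi s k x = 0.
Proof.
move=> /existsNP[n /not_implyP[ns nx]].
by rewrite /phi (big_rem n)//= cut_eq0// mul0r.
Qed.

Lemma phi_cvg s x : phi s k x @[k --> \oo] --> (\1_(inter s) x : R).
Proof.
apply: cvg_near_cst; have [sx|sx] := pselect (inter s x); last first.
  by apply: nearW => k; rewrite phi_eq0// indicE memNset.
rewrite indicE mem_set// => {}.
elim: s sx => [|n s IHs] sx; first by apply: nearW => k; rewrite /phi big_nil.
have h1 : \forall k \near \oo, cut n k x = 1.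
  by apply: cut_eq1; apply: sx; rewrite mem_head.
have h2 : \forall k \near \oo, phi s k x = true%:R.
  by apply: IHs => m ms; apply: sx; rewrite inE ms orbT.
by apply: filterS2 h1 h2 => k e1 e2; rewrite /phi big_cons e1 mul1r -e2.
Qed.

Definition inters : set (set (borel M)) := range inter.

Lemma intersI : setI_closed inters.
Proof.
move=> _ _ [s _ <-] [s' _ <-]; exists (s ++ s') => //.
apply/seteqP; split=> x.
  by move=> h; split=> n ns; apply: h; rewrite mem_cat ns ?orbT.
by move=> [h h'] n; rewrite mem_cat => /orP[/h|/h'].
Qed.

Hypothesis bV : base_seq bal.

Lemma inter_open s : open (inter s).
Proof.
elim: s => [|n s IHs].
  by rewrite (_ : inter _ = setT); [exact: openT|apply/seteqP; split].
rewrite (_ : inter _ = bal n `&` inter s); first by apply: openI; [exact: bV.1|].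
apply/seteqP; split=> x.
  move=> h; split; first by apply: h; rewrite mem_head.
  by move=> m ms; apply: h; rewrite inE ms orbT.
by move=> [h h'] m; rewrite inE => /orP[/eqP ->//|/h'].
Qed.

Lemma measurable_inter s : measurable (inter s : set (borel M)).
Proof. by apply: open_measurable_borel; exact: inter_open. Qed.

Lemma inters_sigma : @measurable _ (borel M) = <<s inters >>.
Proof.
apply/seteqP; split; last first.
  apply: smallest_sub; first exact: smallest_sigma_algebra.
  by move=> _ [s _ <-]; exact: measurable_inter.
rewrite (base_seq_sigma bV).
apply: smallest_sub; first exact: smallest_sigma_algebra.
move=> _ [n _ <-]; apply: sub_sigma_algebra; exists [:: n] => //.
apply/seteqP; split=> x; first by apply; rewrite mem_head.
by move=> h m; rewrite inE => /eqP ->.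
Qed.

Lemma phi_exp_cvg s (mu : probability (borel M) R) :
  \int[mu]_x phi s k x @[k --> \oo] --> fine (mu (inter s)).
Proof.
rewrite -exp_indic; last exact: measurable_inter.
apply: (exp_cvg (r := 1)).
- by move=> k; exact: bm_phi.
- by move=> k x; exact: phi_norm.
- by move=> x; exact: phi_cvg.
Qed.

Definition prob_of (mu : PP R M) : probability (borel M) R := mu.

Lemma continuous_exp_PP (f : M -> R) (b : R) : continuous f -> (forall x, `|f x| <= b) ->
  measurable_fun setT (fun mu : PP R M => \int[prob_of mu]_x f x).
Proof.
move=> cf bf.
apply: (@continuous_measurable_real R (weak_probability R M)
  (fun mu => \int[prob_of mu]_x f x)) => mu.
have /weak_probability_cvgE h : nbhs mu --> mu by [].
by apply: h => //; exists b.
Qed.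

Lemma pfam_prob_of : pfam prob_of.
Proof.
apply: (pfam_from inters_sigma intersI) => _ [s _ <-].
apply: (measurable_fun_cvg (h := fun k mu => \int[prob_of mu]_x phi s k x)).
  move=> k; apply: continuous_exp_PP; first exact: phi_continuous.
  by move=> x; exact: phi_norm.
by move=> mu _; exact: phi_exp_cvg.
Qed.

Definition unio (s : seq nat) : set M := [set x | exists2 n, n \in s & bal n x].

Lemma measurable_unio s : measurable (unio s : set (borel M)).
Proof.
apply: open_measurable_borel; rewrite (_ : unio s = \bigcup_(n in [set n | n \in s]) bal n).
  by apply: bigcup_open => n _; exact: bV.1.
by apply/seteqP; split => x [n]; exists n.
Qed.

(* Finite unions of basic balls suffice to test weak neighborhoods, which makes
   the weak topology countably generated. *)
Definition lower_set (w : seq (seq nat * rat)) : set (PP R M) :=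
  [set mu | forall p, p \in w -> ratr p.2 < fine (prob_of mu (unio p.1))].

(** Continuity from below along finite unions of the basic balls contained in U; the rational
    threshold keeps the family of tests countable. *)
Lemma open_inner_unio (mu : probability (borel M) R) (U : set M) (e : R) :
  open U -> 0 < e ->
  exists p : seq nat * rat, unio p.1 `<=` U /\
    ratr p.2 < fine (mu (unio p.1)) /\ fine (mu U) - e < ratr p.2.
Proof.
move=> oU e0.
pose F m := unio [seq n <- iota 0 m | `[< bal n `<=` U >]].
have FU m : F m `<=` U.
  by move=> x [n]; rewrite mem_filter => /andP[/asboolP h _] /h.
have mF m : measurable (F m : set (borel M)) by exact: measurable_unio.
have UE : \bigcup_m F m = U.
  apply/seteqP; split=> [x [m _]|x Ux]; first exact: FU.
  have [n nx nU] := bV.2 _ _ oU Ux; exists n.+1 => //; exists n => //.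
  by rewrite mem_filter mem_iota/= ltnS leqnn andbT; exact/asboolP.
have mU : measurable (U : set (borel M)) by exact: open_measurable_borel.
have ndF : nondecreasing_seq F.
  move=> m m' mm'; apply/subsetPset => x [n]; rewrite mem_filter mem_iota add0n.
  move=> /andP[nU /= nm] nx; exists n => //.
  by rewrite mem_filter mem_iota nU/= add0n (leq_trans nm).
have cF := @nondecreasing_cvg_mu _ (borel M) R mu F mF.
rewrite UE in cF.
have {}cF : mu (F m) @[m --> \oo] --> (fine (mu U))%:E.
  by rewrite prob_fineK//; exact: cF.
have {}cF : fine (mu (F m)) @[m --> \oo] --> fine (mu U) by apply: fine_cvg.
move/cvgrPdist_lt : cF => /(_ e e0)[m _ hm].
have /= h := hm m (leqnn m).
have {}h : fine (mu U) - e < fine (mu (F m)).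
  by rewrite ltrBlDr -ltrBlDl (le_lt_trans (ler_norm _) h).
have [q] := rat_in_itvoo h; rewrite in_itv/= => /andP[q1 q2].
exists ([seq n <- iota 0 m | `[< bal n `<=` U >]], q).
by split; [exact: (FU m)|split].
Qed.

Lemma exp_layers (mu : probability (borel M) R) (h : M -> R) n : continuous h ->
  \int[mu]_x layers n (n%:R * h x) =
  \sum_(k < n) fine (mu [set x | k.+1%:R < n%:R * h x]).
Proof.
move=> ch.
have mU (k : 'I_n) : measurable ([set x | k.+1%:R < n%:R * h x] : set (borel M)).
  apply: open_measurable_borel.
  apply: (@open_comp _ _ (fun x => n%:R * h x) [set y | k.+1%:R < y]).
    by move=> x _; apply: cvgM; [exact: cvg_cst|exact: ch].
  exact: open_gt.
under [RHS]eq_bigr do rewrite -(exp_indic mu (mU _)).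
rewrite -exp_sum; last by move=> i; exact: bm_indic.
by apply: eq_Rintegral => x _; apply: eq_bigr => k _; rewrite indicE mem_setE.
Qed.

(** The portmanteau argument: h is nearly the average of the indicators of finitely many open
    superlevel sets, and lower bounds on masses inside these sets bound the integral from below. *)
Lemma lower_semicontinuous_exp (mu : PP R M) (h : M -> R) (e : R) :
  continuous h -> (forall x, 0 <= h x <= 1) -> 0 < e ->
  exists w, lower_set w mu /\ forall nu, lower_set w nu ->
    \int[prob_of mu]_x h x - e < \int[prob_of nu]_x h x.
Proof.
move=> ch h01 e0; have e20 : 0 < e / 2 by rewrite divr_gt0.
(* Half of e pays for the layer error 1 / n, the other half for the inner approximation of the
   superlevel sets. *)
have [N _ /(_ N (leqnn N)) /= Ne] := near_infty_natSinv_lt (PosNum e20).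
pose n := N.+1; pose U (k : nat) := [set x | k.+1%:R < n%:R * h x].
have oU k : open (U k).
  apply: (@open_comp _ _ (fun x => n%:R * h x) [set y | k.+1%:R < y]).
    by move=> x _; apply: cvgM; [exact: cvg_cst|exact: ch].
  exact: open_gt.
have /choice[p hp] : forall k, exists p : seq nat * rat, unio p.1 `<=` U k /\
    ratr p.2 < fine (prob_of mu (unio p.1)) /\ fine (prob_of mu (U k)) - e / 2 < ratr p.2.
  by move=> k; exact: open_inner_unio.
exists [seq p k | k <- iota 0 n]; split.
  by move=> _ /mapP[k _ ->]; exact: (hp k).2.1.
move=> nu hnu.
have n0 : 0 < n%:R :> R by [].
have bh : bm (h : borel M -> R).
  split; first exact: continuous_measurable_real.
  by exists 1 => x; have /andP[h0 h1] := h01 x; rewrite ger0_norm.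
have bl : bm ((fun x => layers n (n%:R * h x)) : borel M -> R).
  have -> : (fun x => layers n (n%:R * h x)) = (fun x => \sum_(k < n) \1_(U k) x).
    by apply/funext => x; apply: eq_bigr => k _; rewrite indicE mem_setE.
  apply: (@bm_sum R _ (borel M) _ _ (fun k : 'I_n => \1_(U k))) => k.
  by apply: bm_indic; apply: open_measurable_borel; exact: oU.
have lP x : n%:R * h x - 1 <= layers n (n%:R * h x) <= n%:R * h x.
  have /andP[h0 h1] := h01 x.
  by apply: layersP; [rewrite mulr_ge0|rewrite ler_piMr].
have l1 : n%:R * \int[prob_of mu]_x h x - 1 <= \sum_(k < n) fine (prob_of mu (U k)).
  rewrite -exp_layers// -expZ// -[X in _ - X](exp_cst (prob_of mu)) -expB//.
  - by apply: exp_le => // [|x]; [apply: bmB; [exact: bmZ|exact: bm_cst]|case/andP: (lP x)].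
  - exact: bmZ.
  - exact: bm_cst.
have l2 : \sum_(k < n) fine (prob_of nu (U k)) <= n%:R * \int[prob_of nu]_x h x.
  rewrite -exp_layers// -expZ//.
  by apply: exp_le => // [|x]; [exact: bmZ|case/andP: (lP x)].
have l3 : \sum_(k < n) (fine (prob_of mu (U k)) - e / 2) <= \sum_(k < n) fine (prob_of nu (U k)).
  apply: ler_sum => k _; have [pU [_ /ltW h2]] := hp k; apply: (le_trans h2).
  have h3 : ratr (p k).2 < fine (prob_of nu (unio (p k).1)).
    by apply: hnu; apply: map_f; rewrite mem_iota/= add0n.
  apply: (le_trans (ltW h3)); apply: fine_le.
  - by rewrite fin_num_measure//; exact: measurable_unio.
  - by rewrite fin_num_measure//; exact: open_measurable_borel.
  - by apply: le_measure => //; rewrite inE; [exact: measurable_unio|exact: open_measurable_borel].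
move: l3; rewrite sumrB sumr_const card_ord -[X in _ - X]mulr_natl => l3.
have : n%:R * (\int[prob_of mu]_x h x - e) < n%:R * \int[prob_of nu]_x h x.
  apply: lt_le_trans l2; apply: lt_le_trans l3.
  rewrite mulrBr ltrBlDr -addrA [- _ + _](_ : _ = n%:R * (e / 2)); last by field.
  rewrite (@le_lt_trans _ _ (\sum_(k < n) fine (prob_of mu (U k)) + 1)) -?lerBlDr//.
  by rewrite ltrD2l -ltr_pdivrMl// mulr1.
by rewrite ltr_pM2l.
Qed.

Lemma weak_open_lower (O : set (weak_probability R M)) mu : open O -> O mu ->
  exists w, lower_set w mu /\ lower_set w `<=` O.
Proof.
move=> oO Omu.
pose F : set_system (weak_probability R M) :=
  filter_from [set w | lower_set w mu] lower_set.
have FF : Filter F.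
  apply: filter_from_filter; first by exists [::].
  move=> w w' hw hw'; exists (w ++ w').
    by move=> p; rewrite mem_cat => /orP[/hw|/hw'].
  move=> nu hnu; split => p pw; apply: hnu; rewrite mem_cat pw ?orbT//.
have : F --> mu.
  apply/weak_probability_cvgE => f cf [b fb].
  apply/cvgrPdist_lt => e e0.
  pose s := `|b| + 1; have s0 : 0 < s by rewrite ltr_wpDl.
  have fs x : `|f x| <= s by rewrite (le_trans (fb x))// (le_trans (ler_norm _))// lerDl.
  have bf : bm (f : borel M -> R).
    by split; [exact: continuous_measurable_real|exists b].
  have e'0 : 0 < e / (2 * s) by rewrite divr_gt0// mulr_gt0.
  (* An upper bound on the integral of f is a lower bound on that of s - f; both are rescaled to
     [0, 1] and tested from below. *)
  have h1c : continuous (fun x => (2 * s)^-1 * (f x + s)).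
    move=> x; apply: cvgM; first exact: cvg_cst.
    by apply: cvgD; [exact: cf|exact: cvg_cst].
  have h2c : continuous (fun x => (2 * s)^-1 * (s - f x)).
    move=> x; apply: cvgM; first exact: cvg_cst.
    by apply: cvgB; [exact: cvg_cst|exact: cf].
  have h101 x : 0 <= (2 * s)^-1 * (f x + s) <= 1.
    have := fs x; rewrite ler_norml => /andP[? ?].
    rewrite mulr_ge0 ?invr_ge0 ?mulr_ge0 ?(ltW s0)//=; last by lra.
    by rewrite mulrC ler_pdivrMr ?mulr_gt0//; lra.
  have h201 x : 0 <= (2 * s)^-1 * (s - f x) <= 1.
    have := fs x; rewrite ler_norml => /andP[? ?].
    rewrite mulr_ge0 ?invr_ge0 ?mulr_ge0 ?(ltW s0)//=; last by lra.
    by rewrite mulrC ler_pdivrMr ?mulr_gt0//; lra.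
  have [w1 [mw1 hw1]] := lower_semicontinuous_exp mu h1c h101 e'0.
  have [w2 [mw2 hw2]] := lower_semicontinuous_exp mu h2c h201 e'0.
  exists (w1 ++ w2); first by move=> p; rewrite mem_cat => /orP[/mw1|/mw2].
  move=> nu hnu.
  have {}hw1 := hw1 nu ltac:(by move=> p pw; apply: hnu; rewrite mem_cat pw).
  have {}hw2 := hw2 nu ltac:(by move=> p pw; apply: hnu; rewrite mem_cat pw orbT).
  have E1 (m : probability (borel M) R) :
      \int[m]_x ((2 * s)^-1 * (f x + s)) = (2 * s)^-1 * (\int[m]_x f x + s).
    rewrite expZ; last by apply: bmD => //; exact: bm_cst.
    by rewrite expD ?exp_cst//; exact: bm_cst.
  have E2 (m : probability (borel M) R) :
      \int[m]_x ((2 * s)^-1 * (s - f x)) = (2 * s)^-1 * (s - \int[m]_x f x).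
    rewrite expZ; last by apply: bmB => //; exact: bm_cst.
    by rewrite expB ?exp_cst//; exact: bm_cst.
  move: hw1 hw2; rewrite !E1 !E2 -/(prob_of mu) -/(prob_of nu).
  rewrite [e / _]mulrC -!mulrBr !ltr_pM2l ?invr_gt0 ?mulr_gt0// => *.
  by rewrite ltr_norml; apply/andP; split; lra.
move=> /(_ O (open_nbhs_nbhs (conj oO Omu)))[w wmu wO].
by exists w.
Qed.

(** Converse of [pfam_prob_of]: a weakly open set is the union of the sets [lower_set w] it
    contains, and w ranges over a countable type. *)
Lemma measurable_to_PP d (T : measurableType d) (F : T -> PP R M) :
  pfam (fun t => prob_of (F t)) -> measurable_fun setT F.
Proof.
move=> mF; apply: (@measurability _ _ T (PP R M) setT F (@open (weak_probability R M)) erefl).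
move=> _ [W oW <-]; rewrite setTI.
rewrite (_ : _ @^-1` _ = \bigcup_w (if `[< lower_set w `<=` W >] then F @^-1` lower_set w else set0)).
  apply: countable_bigcupT_measurable; first exact: countableP.
  move=> w; case: ifPn => _; last exact: measurable0.
  rewrite (_ : _ @^-1` _ = \bigcap_(p in [set p | p \in w])
     [set t | ratr p.2 < fine (prob_of (F t) (unio p.1))]).
    rewrite -[X in measurable X]setCK setC_bigcap; apply: measurableC.
    rewrite bigcup_mkcond; apply: countable_bigcupT_measurable; first exact: countableP.
    move=> p; case: ifPn => _; last exact: measurable0.
    apply: measurableC.
    rewrite (_ : mkset _ = (fun t => fine (prob_of (F t) (unio p.1))) @^-1` `]ratr p.2, +oo[).
      rewrite -[X in measurable X]setTI.
      by apply: (pfam_bm mF (measurable_unio p.1)).1 => //; exact: measurable_itv.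
    by apply/seteqP; split => t; rewrite /preimage/= in_itv/= andbT.
  by apply/seteqP; split => t h p; exact: h.
apply/seteqP; split=> [t Ot|t [w _]]; last by case: asboolP => // h; exact: h.
have [w [wt wO]] := weak_open_lower oW Ot.
by exists w => //; rewrite asboolT.
Qed.

End cutoffs.

(** * Measurable limits of sequences and of probabilities *)

Section clamped_limits.
Context {R : realType}.

Definition clamp (x : R) : R := Num.min 1 (Num.max 0 x).

Lemma clamp_ge0 x : 0 <= clamp x.
Proof. by rewrite /clamp le_min ler01 le_max lexx. Qed.

Lemma clamp_le1 x : clamp x <= 1.
Proof. by rewrite /clamp ge_min lexx. Qed.

Lemma clamp_id x : 0 <= x <= 1 -> clamp x = x.
Proof. by move=> /andP[x0 x1]; rewrite /clamp (max_idPr x0) (min_idPr x1). Qed.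

Lemma clamp_continuous : continuous clamp.
Proof.
rewrite (_ : clamp = (fun=> 1) \min ((fun=> 0) \max id))// => x.
apply: (@continuous_min R); first exact: cvg_cst.
by apply: (@continuous_max R); [exact: cvg_cst|exact: cvg_id].
Qed.

(* The clamping to [0, 1] makes the limit superior measurable in the sequence,
   whether or not the sequence converges. *)
Definition clim (u : nat -> R) : R := limn_sup (clamp \o u).

Lemma clim_cvg u (l : R) : 0 <= l <= 1 -> u @ \oo --> l -> clim u = l.
Proof.
move=> l01 ul; have : (clamp \o u) @ \oo --> clamp l.
  by apply: continuous_cvg => //; exact: clamp_continuous.
by rewrite clamp_id// => /cvg_sups /cvg_lim; rewrite /clim/limn_sup; apply.
Qed.

Lemma measurable_clamp : measurable_fun setT clamp.
Proof. exact: continuous_measurable_fun clamp_continuous. Qed.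

Lemma measurable_clim d (T : measurableType d) (u : T -> nat -> R) :
  (forall n, measurable_fun setT (u ^~ n)) -> measurable_fun setT (fun t => clim (u t)).
Proof.
move=> mu; apply: (measurable_fun_limn_sup (h := fun n t => clamp (u t n))).
- by move=> t _; exists 1 => _ [n _ <-]; exact: clamp_le1.
- by move=> t _; exists 0 => _ [n _ <-]; exact: clamp_ge0.
- by move=> n; exact: (measurableT_comp measurable_clamp (mu n)).
Qed.

End clamped_limits.

Section measures_from_weights.
Context {R : realType} {M : pmetricType R}.
Variable d : nat -> M.
Hypothesis dd : dense_seq d.
Hypothesis lM : locally_compact [set: M].
Variables (c : nat -> M) (r : nat -> R).
Hypothesis bV : base_seq (bal c r).

Definition default_weights (s : seq bool) : R :=
  fine ((\d_(point : Bits) : probability Bits R) (cyl s)).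

(** Random weights are valid only almost surely; the fallback makes the resulting law a probability
    everywhere. *)
Definition fix_weights (w : seq bool -> R) : seq bool -> R :=
  if `[< weights w >] then w else default_weights.

Lemma fix_weightsP w : weights (fix_weights w).
Proof.
rewrite /fix_weights; case: asboolP => // _.
exact: weights_of_prob.
Qed.

Lemma pfam_weights_prob e (T : measurableType e) (w : T -> seq bool -> R) :
  (forall s, measurable_fun setT (w ^~ s)) ->
  pfam (fun t => weights_prob (fix_weights (w t))).
Proof.
move=> mw; apply: (@pfam_from R _ _ T Bits _ cylinders erefl cylindersI).
move=> _ [->|[s ->]].
  by under eq_fun do rewrite measure0; exact: measurable_cst.
under eq_fun do rewrite (weights_prob_cyl s (fix_weightsP _)).
rewrite -/(measurable_fun setT (fun t => fix_weights (w t) s)).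
rewrite (_ : (fun t => _) = (fun t => \1_[set t | weights (w t)] t * w t s +
   (1 - \1_[set t | weights (w t)] t) * default_weights s)).
  have mV := measurable_weights mw.
  have mI := (@bm_indic R _ _ _ mV).1.
  apply: measurable_funD.
    by apply: measurable_funM => //; exact: mw.
  by apply: measurable_funM => //; apply: measurable_funB.
apply/funext => t; rewrite /= /fix_weights indicE; case: asboolP => h.
  by rewrite mem_set//= mul1r subrr mul0r addr0.
by rewrite memNset//= mul0r add0r subr0 mul1r.
Qed.

Definition wmeas (w : seq bool -> R) : PP R M :=
  push (weights_prob (fix_weights w)) (measurable_decode dd lM).

Lemma measurable_wmeas e (T : measurableType e) (w : T -> seq bool -> R) :
  (forall s, measurable_fun setT (w ^~ s)) -> measurable_fun setT (fun t => wmeas (w t)).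
Proof.
move=> mw; apply: (measurable_to_PP bV) => B mB.
rewrite (_ : (fun t => _) = (fun t => weights_prob (fix_weights (w t)) (decode d @^-1` B)))//.
apply: pfam_weights_prob => //.
by rewrite -[X in measurable X]setTI; exact: measurable_decode.
Qed.

(** Since [decode] is a left inverse of [code], decoding the image of mu under [code] gives mu back;
    that image is determined by its cylinder masses. *)
Lemma wmeas_code (mu : probability (borel M) R) :
  same_measure (prob_of (wmeas (fun s => fine (mu (code d @^-1` cyl s))))) mu.
Proof.
move=> B mB; set w := fun s => _.
have wE : w = (fun s => fine (push mu (measurable_code dd) (cyl s))) by [].
have vw : weights w by rewrite wE; exact: weights_of_prob.
rewrite /prob_of /wmeas pushE /fix_weights asboolT// wE.
rewrite weights_prob_id; last first.
  by rewrite -[X in measurable X]setTI; exact: (measurable_decode dd lM).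
rewrite pushE; congr (mu _); apply/seteqP; split => x; rewrite /preimage/=.
  by rewrite codeK.
by rewrite codeK.
Qed.

(* h recovers the mass of A measurably from countably many integrals of cutoffs;
   it can thus also be fed with limits of such integrals. *)
Definition reading (h : (seq nat * nat -> R) -> R) (A : set (borel M)) : Prop :=
  (forall e (T : measurableType e) (a : T -> seq nat * nat -> R),
     (forall i, measurable_fun setT (a ^~ i)) -> measurable_fun setT (fun t => h (a t))) /\
  forall mu : probability (borel M) R,
    h (fun i => \int[mu]_x phi c r i.1 i.2 x) = fine (mu A).

(** Dynkin induction builds h along with A: a clamped limit of cutoffs for an intersection of balls,
    subtraction from 1 for a complement, a clamped series for a disjoint union. *)
Lemma reading_ex A : measurable A -> exists h, reading h A.
Proof.
move=> mA; have : <<s inters c r >> A by rewrite -(inters_sigma bV).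
apply: (dynkin_induction (P := fun A => exists h, reading h A)
  (inters_sigma bV) (@intersI _ _ c r)).
- exists (fun=> 1); split; first by move=> *; exact: measurable_cst.
  by move=> mu; rewrite probability_setT.
- move=> _ [s _ <-]; exists (fun a => clim (fun k => a (s, k))); split.
    by move=> e T a ma; apply: (@measurable_clim _ _ _ (fun t k => a t (s, k))).
  move=> mu; apply: clim_cvg; last exact: phi_exp_cvg.
  by rewrite prob_fine_ge0 prob_fine_le1//; exact: measurable_inter.
- move=> S mS [h [h1 h2]]; exists (fun a => 1 - h a); split.
    by move=> e T a ma; apply: measurable_funB => //; exact: h1.
  move=> mu; rewrite h2 probability_setC// fineB ?fin_num_measure//.
- move=> F mF tF /choice[h hh].
  exists (fun a => clim (fun n => \sum_(k < n) h k a)); split.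
    move=> e T a ma; apply: (@measurable_clim _ _ _ (fun t n => \sum_(k < n) h k (a t))).
    by move=> n; apply: measurable_sum => k; exact: (hh k).1.
  move=> mu; have mUF : measurable (\bigcup_k F k) by exact: bigcupT_measurable.
  apply: clim_cvg; first by rewrite prob_fine_ge0 prob_fine_le1.
  have H : (fun n => (\sum_(k < n) h k (fun i => \int[mu]_x phi c r i.1 i.2 x))%:E) @ \oo
      --> (fine (mu (\bigcup_k F k)))%:E.
    rewrite prob_fineK//.
    rewrite (_ : (fun n => _) = (fun n => \sum_(0 <= k < n) mu (F k))%E).
      exact: (measure_semi_sigma_additive F mF tF mUF).
    apply/funext => n /=; rewrite big_mkord -sumEFin; apply: eq_bigr => k _.
    by rewrite (hh k).2 prob_fineK.
  by apply: (fine_cvg H).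
Qed.

Lemma readings_ex : exists h : seq bool -> (seq nat * nat -> R) -> R,
  forall s, reading (h s) (code d @^-1` cyl s).
Proof.
suff /choice[h hh] : forall s, exists h, reading h (code d @^-1` cyl s) by exists h.
move=> s; apply: reading_ex.
rewrite -[X in measurable X]setTI; apply: (measurable_code dd) => //.
exact: measurable_cyl.
Qed.

Definition readings := projT1 (cid readings_ex).

(** Defined for every sequence and measurable in it; it is the weak limit whenever the integrals of
    the cutoffs converge to those of a probability. *)
Definition wlim (mus : nat -> PP R M) : PP R M :=
  wmeas (fun s => readings s (fun i =>
    clim (fun j => \int[prob_of (mus j)]_x phi c r i.1 i.2 x))).

Lemma measurable_wlim e (T : measurableType e) (mus : T -> nat -> PP R M) :
  (forall j, measurable_fun setT (mus ^~ j)) -> measurable_fun setT (fun t => wlim (mus t)).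
Proof.
move=> mm; apply: measurable_wmeas => s.
have [h1 _] := projT2 (cid readings_ex) s.
apply: (h1 _ _ (fun t i => clim (fun j => \int[prob_of (mus t j)]_x phi c r i.1 i.2 x))) => i.
apply: measurable_clim => j.
have := (pfam_exp (pfam_prob_of bV) (bm_phi c r i.1 i.2)).1.
by move=> h; exact: (measurableT_comp h (mm j)).
Qed.

Lemma wlim_cvg (mus : nat -> PP R M) (mu : PP R M) :
  (forall s k, \int[prob_of (mus j)]_x phi c r s k x @[j --> \oo] -->
     \int[prob_of mu]_x phi c r s k x) ->
  same_measure (prob_of (wlim mus)) (prob_of mu).
Proof.
move=> h B mB; rewrite -(wmeas_code (prob_of mu) mB).
rewrite /wlim; congr (prob_of (wmeas _) B); apply/funext => s.
have [_ <-] := projT2 (cid readings_ex) s.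
congr (readings s _); apply/funext => i.
apply: clim_cvg; last exact: h.
rewrite Rintegral_ge0//=; last by move=> x _; exact: phi_ge0.
rewrite -[leRHS](exp_cst (prob_of mu)).
apply: exp_le; [exact: bm_phi|exact: bm_cst|move=> x; exact: phi_le1].
Qed.

End measures_from_weights.

(** * Uniqueness from mixed moments *)

Section sign_iteration.
Context {R : realType}.

(* An odd polynomial map of [-1, 1] whose iterates converge to the sign function:
   applied to Z - a, it turns moments into probabilities of thresholds. *)
Definition sgstep (v : R) : R := (3%:R * v - v ^+ 3) / 2.

Lemma sgstepN v : sgstep (- v) = - sgstep v.
Proof. by rewrite /sgstep; field. Qed.

Lemma sgstep_itv v : 0 <= v <= 1 -> v <= sgstep v <= 1.
Proof.
move=> /andP[v0 v1].
have h1 : 0 <= (1 - v) ^+ 2 * (2 + v) / 2.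
  by rewrite divr_ge0// mulr_ge0 ?sqr_ge0//; lra.
have h2 : 0 <= v * (1 - v) * (1 + v) / 2.
  by rewrite divr_ge0// !mulr_ge0//; lra.
have e1 : 1 - sgstep v = (1 - v) ^+ 2 * (2 + v) / 2 by rewrite /sgstep; field.
have e2 : sgstep v - v = v * (1 - v) * (1 + v) / 2 by rewrite /sgstep; field.
by rewrite -subr_ge0 e2 h2 -subr_ge0 e1 h1.
Qed.

Lemma iter_sgstepN k v : iter k sgstep (- v) = - iter k sgstep v.
Proof. by elim: k => //= k ->; rewrite sgstepN. Qed.

Lemma iter_sgstep_itv k v : 0 <= v <= 1 -> v <= iter k sgstep v <= 1.
Proof.
move=> v01; have /andP[v0 v1] := v01; elim: k => [|k /andP[IH1 IH2]] /=.
  by rewrite lexx v1.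
have := @sgstep_itv (iter k sgstep v); rewrite IH2 (le_trans v0 IH1) => /(_ isT) /andP[h ->].
by rewrite (le_trans IH1 h).
Qed.

Lemma iter_sgstep_norm k v : `|v| <= 1 -> `|iter k sgstep v| <= 1.
Proof.
have [v0|v0] := leP 0 v.
  rewrite ger0_norm// => v1.
  have /andP[h1 h2] := @iter_sgstep_itv k v (introT andP (conj v0 v1)).
  by rewrite ger0_norm// (le_trans v0).
rewrite ltr0_norm// => v1.
have v0' : 0 <= - v by lra.
have /andP[h1 h2] := @iter_sgstep_itv k (- v) (introT andP (conj v0' v1)).
by rewrite -normrN -iter_sgstepN ger0_norm// (le_trans v0').
Qed.

Lemma iter_sgstep_cvg v : `|v| <= 1 -> iter k sgstep v @[k --> \oo] --> Num.sg v.
Proof.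
have pos w : 0 < w <= 1 -> iter k sgstep w @[k --> \oo] --> (1 : R).
  move=> /andP[w0 w1].
  have w01 : 0 <= w <= 1 by rewrite ltW.
  (* The defect contracts, as 1 - sgstep z = (1 - z)(1 - z(1 + z) / 2); the iterates z stay above w,
     so the second factor is at most q. *)
  pose q := 1 - w / 2.
  have q0 : 0 <= q by rewrite /q; lra.
  have bound k : 1 - iter k sgstep w <= q ^+ k.
    elim: k => [|k IHk]; first by rewrite expr0 /=; lra.
    have /andP[h1 h2] := iter_sgstep_itv k w01.
    set z := iter k sgstep w in IHk h1 h2 *.
    have e1 : 1 - sgstep z = (1 - z) * (1 - z * (1 + z) / 2) by rewrite /sgstep; field.
    rewrite /= -/z e1 exprS mulrC; apply: ler_pM => //.
    - by nra.
    - by lra.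
    - by rewrite /q; nra.
  apply/cvgrPdist_le => e e0.
  have /cvgrPdist_le /(_ e e0) : q ^+ k @[k --> \oo] --> (0 : R).
    by apply: cvg_expr; rewrite ger0_norm// /q; lra.
  apply: filterS => k; rewrite sub0r normrN => h.
  have /andP[h1 h2] := iter_sgstep_itv k w01.
  rewrite ger0_norm ?subr_ge0//; apply: (le_trans (bound k)).
  by apply: le_trans h; exact: ler_norm.
have [v0|v0|->] := ltrgt0P v.
- by rewrite gtr0_sg// => v1; apply: pos; rewrite v0.
- rewrite ltr0_sg// => v1.
  rewrite (_ : (fun k => _) = (fun k => - iter k sgstep (- v))).
    by apply: cvgN; apply: pos; lra.
  by apply/funext => k; rewrite iter_sgstepN opprK.
- move=> _; rewrite sgr0 (_ : (fun k => _) = (fun=> 0)); first exact: cvg_cst.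
  by apply/funext => k; elim: k => //= k ->; rewrite /sgstep mulr0 expr0n/= subrr mul0r.
Qed.

Lemma measurable_sgr : measurable_fun setT (Num.sg : R -> R).
Proof.
rewrite (_ : Num.sg = (fun x => \1_(`]0, +oo[) x - \1_(`]-oo, 0[) x)).
  by apply: measurable_funB; apply: measurable_indic; exact: measurable_itv.
apply/funext => x; rewrite !indicE !mem_setE !in_itv/= andbT.
case: (ltrgt0P x) => [x0|x0|->].
- by rewrite gtr0_sg// subr0.
- by rewrite ltr0_sg// sub0r.
- by rewrite sgr0 subr0.
Qed.

End sign_iteration.

Section moments_unique.
Context {R : realType}.

Fixpoint sgpoly (q : {poly R}) k : {poly R} :=
  if k is k'.+1 then 2^-1 *: (3%:R *: sgpoly q k' - sgpoly q k' ^+ 3) else q.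

Lemma sgpolyE q k y : (sgpoly q k).[y] = iter k sgstep q.[y].
Proof.
elim: k => //= k IHk; rewrite !hornerE /= IHk /sgstep.
by rewrite [in RHS]mulrC.
Qed.

Context (I : Type) d d' (T : measurableType d) (T' : measurableType d').
Variables (P : probability T R) (P' : probability T' R).
Variables (Z : I -> T -> R) (Z' : I -> T' -> R).
Hypothesis mZ : forall i, measurable_fun setT (Z i).
Hypothesis mZ' : forall i, measurable_fun setT (Z' i).
Hypothesis Z01 : forall i t, 0 <= Z i t <= 1.
Hypothesis Z'01 : forall i t, 0 <= Z' i t <= 1.
Hypothesis mom : forall l : seq I,
  \int[P]_t (\prod_(i <- l) Z i t) = \int[P']_t (\prod_(i <- l) Z' i t).

Let thr e (S : measurableType e) (Y : I -> S -> R) (l : seq (I * R)) (t : S) : R :=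
  \prod_(p <- l) ((p.2 < Y p.1 t)%R)%:R.

Let bmY e (S : measurableType e) (Y : I -> S -> R) : (forall i, measurable_fun setT (Y i)) ->
  (forall i t, 0 <= Y i t <= 1) -> forall i, bm (Y i).
Proof.
move=> mY Y01 i; split => //; exists 1 => t; have /andP[h1 h2] := Y01 i t.
by rewrite ger0_norm.
Qed.

Let bm_thr e (S : measurableType e) (Y : I -> S -> R) : (forall i, measurable_fun setT (Y i)) ->
  (forall i t, 0 <= Y i t <= 1) -> forall l, bm (thr Y l).
Proof.
move=> mY Y01 l.
apply: (@bm_prod _ _ _ _ _ (fun p t => ((p.2 < Y p.1 t)%R)%:R)) => p.
rewrite (_ : (fun t => _) = \1_[set t | (p.2 < Y p.1 t)%R]).
  apply: bm_indic; rewrite (_ : mkset _ = Y p.1 @^-1` `]p.2, +oo[).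
    by rewrite -[X in measurable X]setTI; apply: mY => //; exact: measurable_itv.
  by apply/seteqP; split => t; rewrite /preimage/= in_itv/= andbT.
by apply/funext => t; rewrite indicE mem_setE.
Qed.

Let bm_pr e (S : measurableType e) (Y : I -> S -> R) : (forall i, measurable_fun setT (Y i)) ->
  (forall i t, 0 <= Y i t <= 1) -> forall l, bm (fun t => \prod_(i <- l) Y i t).
Proof. by move=> mY Y01 l; apply: bm_prod; exact: bmY. Qed.

Let eqm l1 (f : R -> R) i l2 := \int[P]_t (f (Z i t) * (thr Z l1 t * \prod_(i <- l2) Z i t)) =
  \int[P']_t (f (Z' i t) * (thr Z' l1 t * \prod_(i <- l2) Z' i t)).

Let limit_step l1 i l2 (f_ : nat -> R -> R) (f : R -> R) (b : R) :
  (forall n, continuous (f_ n) \/ measurable_fun setT (f_ n)) ->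
  (forall n y, 0 <= y <= 1 -> `|f_ n y| <= b) ->
  (forall y, 0 <= y <= 1 -> f_ ^~ y @ \oo --> f y) ->
  (forall n, eqm l1 (f_ n) i l2) -> eqm l1 f i l2.
Proof.
move=> cf fb fcv h.
have lim e (S : measurableType e) (Y : I -> S -> R) (Q : probability S R) :
    (forall i, measurable_fun setT (Y i)) -> (forall i t, 0 <= Y i t <= 1) ->
    \int[Q]_t (f_ n (Y i t) * (thr Y l1 t * \prod_(i <- l2) Y i t)) @[n --> \oo] -->
    \int[Q]_t (f (Y i t) * (thr Y l1 t * \prod_(i <- l2) Y i t)).
  move=> mY Y01; have bG := bmM (bm_thr mY Y01 l1) (bm_pr mY Y01 l2).
  have [_ [g hg]] := bG.
  apply: (exp_cvg (r := b * g)).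
  - move=> n; apply: (bmM _ bG); split.
      case: (cf n) => [cfn|mfn]; last exact: (measurableT_comp mfn (mY i)).
      by apply: measurableT_comp (mY i); exact: continuous_measurable_fun.
    by exists b => t; apply: fb.
  - by move=> n t; rewrite normrM ler_pM//; apply: fb.
  - by move=> t; apply: cvgMr_tmp; apply: fcv.
apply: (@cvg_unique _ _ (\int[P]_t (f_ n (Z i t) * (thr Z l1 t * \prod_(i <- l2) Z i t)) @[n --> \oo])) => //.
  exact: lim.
by rewrite (funext h); exact: lim.
Qed.

(** Moments are converted into thresholds one variable at a time: monomials, then polynomials, then
    signs of Z - b as limits of polynomials, then the indicator of a < Z. *)
Let threshold l1 l2 : \int[P]_t (thr Z l1 t * \prod_(i <- l2) Z i t) =
  \int[P']_t (thr Z' l1 t * \prod_(i <- l2) Z' i t).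
Proof.
elim: l1 l2 => [|[i a] l1 IH] l2.
  rewrite /thr; under eq_Rintegral do rewrite big_nil mul1r.
  by under [RHS]eq_Rintegral do rewrite big_nil mul1r.
have bG l := bmM (bm_thr mZ Z01 l1) (bm_pr mZ Z01 l).
have bG' l := bmM (bm_thr mZ' Z'01 l1) (bm_pr mZ' Z'01 l).
(* A power of Z i is absorbed into the list of plain factors, which is why l2 is arbitrary in the
   induction. *)
have mono k : eqm l1 (fun y => y ^+ k) i l2.
  rewrite /eqm; have := IH (nseq k i ++ l2).
  under eq_Rintegral do rewrite big_cat big_nseq -Monoid.iteropE /= mulrCA.
  by under [X in _ = X -> _]eq_Rintegral do rewrite big_cat big_nseq -Monoid.iteropE /= mulrCA.
have pol (q : {poly R}) : eqm l1 (fun y => q.[y]) i l2.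
  rewrite /eqm; under eq_Rintegral do rewrite horner_coef mulr_suml.
  under [RHS]eq_Rintegral do rewrite horner_coef mulr_suml.
  rewrite (@exp_sum _ _ _ P _ _ (fun (k : 'I_(size q)) t => q`_k * Z i t ^+ k * (thr Z l1 t * \prod_(i <- l2) Z i t))); last first.
    by move=> k; apply: bmM => //; apply: bmZ; apply: bmX; exact: bmY.
  rewrite (@exp_sum _ _ _ P' _ _ (fun (k : 'I_(size q)) t => q`_k * Z' i t ^+ k * (thr Z' l1 t * \prod_(i <- l2) Z' i t))); last first.
    by move=> k; apply: bmM => //; apply: bmZ; apply: bmX; exact: bmY.
  apply: eq_bigr => k _.
  under eq_Rintegral do rewrite -mulrA.
  under [RHS]eq_Rintegral do rewrite -mulrA.
  rewrite expZ; last by apply: bmM => //; apply: bmX; exact: bmY.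
  rewrite [RHS]expZ; last by apply: bmM => //; apply: bmX; exact: bmY.
  by rewrite mono.
(* For y in [0, 1] and b within 1 of a, the distance from y to b is at most 1 + 1 + |a|, so division
   by L lands in [-1, 1]. *)
pose L : R := `|a| + 2.
have L0 : 0 < L by rewrite ltr_wpDl.
have sgn (b : R) : `|b - a| <= 1 -> eqm l1 (fun y => Num.sg (L^-1 * (y - b))) i l2.
  move=> ba; pose q := L^-1 *: ('X - b%:P).
  have qE y : q.[y] = L^-1 * (y - b) by rewrite /q !hornerE.
  have qn y : 0 <= y <= 1 -> `|q.[y]| <= 1.
    move=> /andP[y0 y1]; rewrite qE normrM gtr0_norm ?invr_gt0// ler_pdivrMl// mulr1.
    rewrite (_ : y - b = y - (b - a) - a); last by lra.
    rewrite (le_trans (ler_normB _ _))// /L addrC lerD2l (le_trans (ler_normB _ _))//.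
    by rewrite ger0_norm//; lra.
  apply: (limit_step (f_ := fun k y => (sgpoly q k).[y]) (b := 1)).
  - by move=> k; left; exact: continuous_horner.
  - by move=> k y y01; rewrite sgpolyE iter_sgstep_norm// qn.
  - move=> y y01; under eq_fun do rewrite sgpolyE.
    by rewrite -qE; apply: iter_sgstep_cvg; exact: qn.
  - by move=> k; exact: pol.
have : eqm l1 (fun y => (a < y)%R%:R) i l2.
  (* The sign vanishes at the threshold itself, so thresholds decreasing strictly to a are used: at
     y = a they all give 0, as the strict inequality demands. *)
  apply: (limit_step (f_ := fun j y => 2^-1 * Num.sg (L^-1 * (y - (a + j.+1%:R^-1))) + 2^-1) (b := 1)).
  - move=> j; right; apply: measurable_funD => //; apply: measurable_funM => //.
    apply: (measurableT_comp measurable_sgr).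
    by apply: measurable_funM => //; apply: measurable_funB.
  - move=> j y _; set s := Num.sg _; have : `|s| <= 1 by rewrite normr_sg; case: (_ != 0).
    by rewrite !ler_norml => /andP[? ?]; lra.
  - move=> y y01; have [ay|ya] := ltP a y.
      apply: cvg_near_cst.
      have [N _ hN] := near_infty_natSinv_lt (PosNum (ltac:(by rewrite subr_gt0) : 0 < y - a)).
      exists N => // j Nj; have hj : j.+1%:R^-1 < y - a := hN j Nj.
      rewrite gtr0_sg; first by rewrite (_ : true%:R = 1)//; field.
      by rewrite mulr_gt0 ?invr_gt0// opprD addrA subr_gt0.
    apply: cvg_near_cst; apply: nearW => j.
    rewrite ltr0_sg; first by rewrite mulrN1 addNr.
    by rewrite pmulr_rlt0 ?invr_gt0// subr_lt0 (le_lt_trans ya)// ltrDl.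
  - move=> j.
    have e1 : eqm l1 (fun y => Num.sg (L^-1 * (y - (a + j.+1%:R^-1)))) i l2.
      by apply: sgn; rewrite addrAC subrr add0r ger0_norm// invf_le1// ler1n.
    have bS e (S : measurableType e) (Y : I -> S -> R) : (forall i, measurable_fun setT (Y i)) ->
       bm (fun t => Num.sg (L^-1 * (Y i t - (a + j.+1%:R^-1)))).
      move=> mY; split; last first.
        by exists 1 => t; rewrite normr_sg; case: (_ != 0).
      apply: (measurableT_comp measurable_sgr).
      by apply: measurable_funM => //; apply: measurable_funB.
    rewrite /eqm; under eq_Rintegral do rewrite mulrDl -mulrA.
    under [RHS]eq_Rintegral do rewrite mulrDl -mulrA.
    rewrite exp_lin; [|by apply: bmM => //; exact: bS|exact: bmZ].
    rewrite [RHS]exp_lin; [|by apply: bmM => //; exact: bS|exact: bmZ].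
    rewrite expZ// [in RHS]expZ//; congr (_ * _ + _ * _); first exact: e1.
    exact: IH.
rewrite /eqm /thr; under eq_Rintegral do rewrite mulrA.
under [X in _ = X -> _]eq_Rintegral do rewrite mulrA.
move=> h; under eq_Rintegral do rewrite big_cons.
by under [RHS]eq_Rintegral do rewrite big_cons.
Qed.

Lemma moments_unique (l : seq (I * R)) :
  P [set t | all (fun p => p.2 < Z p.1 t)%R l] = P' [set t | all (fun p => p.2 < Z' p.1 t)%R l].
Proof.
have thrE e (S : measurableType e) (Y : I -> S -> R) :
    thr Y l = \1_[set t | all (fun p => p.2 < Y p.1 t)%R l].
  apply/funext => t; rewrite indicE /thr mem_setE.
  elim: l => [|p l' IHl] /=; first by rewrite big_nil.
  by rewrite big_cons IHl -natrM mulnb.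
have mset e (S : measurableType e) (Y : I -> S -> R) : (forall i, measurable_fun setT (Y i)) ->
    measurable [set t | all (fun p => p.2 < Y p.1 t)%R l].
  move=> mY; elim: l {thrE} => [|p l' IHl] /=; first by rewrite (_ : mkset _ = setT)//; exact/seteqP.
  rewrite (_ : mkset _ = (Y p.1 @^-1` `]p.2, +oo[) `&` [set t | all (fun p => p.2 < Y p.1 t)%R l']).
    apply: measurableI => //; rewrite -[X in measurable X]setTI.
    by apply: mY => //; exact: measurable_itv.
  apply/seteqP; split => t; rewrite /preimage/= in_itv/= andbT.
    by move=> /andP[].
  by move=> [-> ->].
have := threshold l [::].
under eq_Rintegral do rewrite big_nil mulr1 thrE.
under [X in _ = X -> _]eq_Rintegral do rewrite big_nil mulr1 thrE.
rewrite (exp_indic P (mset _ _ _ mZ)) (exp_indic P' (mset _ _ _ mZ')) => h.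
by rewrite -(prob_fineK P (mset _ _ _ mZ)) -(prob_fineK P' (mset _ _ _ mZ')) h.
Qed.

End moments_unique.

(** * Mixtures, finite products and the space of kernels *)

Section mixture.
Context {R : realType} d d' {X : measurableType d} {Y : measurableType d'}.
Variables (P : probability X R) (F : X -> probability Y R) (mF : pfam F).

Definition mixture_of (_ : pfam F) (A : set Y) : \bar R := (\int[P]_x F x A)%E.

Let mixture0 : mixture_of mF set0 = 0%E.
Proof. by rewrite /mixture_of; under eq_integral do rewrite measure0; rewrite integral0. Qed.

Let mixture_ge0 A : (0 <= mixture_of mF A)%E.
Proof. by apply: integral_ge0 => x _. Qed.

Let mixture_sigma_additive : semi_sigma_additive (mixture_of mF).
Proof.
move=> A mA tA mUA; rewrite /mixture_of.
rewrite [X in _ --> X](_ : _ = \int[P]_x (\sum_(n <oo) F x (A n))%E)%E; last first.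
  by apply: eq_integral => x _; apply/esym/cvg_lim => //; exact: measure_semi_sigma_additive.
rewrite integral_nneseries//; last by move=> n; exact: mF.
apply: is_cvg_ereal_nneg_natsum => n _; exact: integral_ge0.
Qed.

HB.instance Definition _ := isMeasure.Build _ _ _ (mixture_of mF)
  mixture0 mixture_ge0 mixture_sigma_additive.

Let mixture_setT : mixture_of mF setT = 1%E.
Proof.
rewrite /mixture_of; under eq_integral do rewrite probability_setT.
by rewrite integral_cst// mul1e [LHS]probability_setT.
Qed.

HB.instance Definition _ := Measure_isProbability.Build _ _ _ (mixture_of mF) mixture_setT.

Definition mixture : probability Y R := mixture_of mF.

Lemma mixture_fine A : measurable A -> fine (mixture A) = \int[P]_x fine (F x A).
Proof.
move=> mA; congr fine; apply: eq_integral => x _.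
by rewrite prob_fineK.
Qed.

Lemma exp_mixture f : bm f -> \int[mixture]_y f y = \int[P]_x \int[F x]_y f y.
Proof.
have GE : @measurable _ Y = <<s @measurable _ Y >>.
  by rewrite (sigma_algebra_id (@sigma_algebra_measurable _ Y)).
apply: (exp_mix GE) => //; first exact: measurableI.
exact: mixture_fine.
Qed.

End mixture.

Section kernel_values.
Context {R : realType} d d' {X : measurableType d} {Y : measurableType d'}.
Variable k : R.-pker X ~> Y.

Let kset (x : X) : set Y -> \bar R := k x.
HB.instance Definition _ x := Measure.on (kset x).
HB.instance Definition _ x := Measure_isProbability.Build _ _ _ (kset x) (prob_kernel x).
Definition kprob (x : X) : probability Y R := kset x.

Lemma pfam_kprob : pfam kprob.
Proof. by move=> A mA; exact: (measurable_kernel k A mA). Qed.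

End kernel_values.

Section finite_products.
Context {R : realType} {M : pmetricType R}.
Variable d : nat -> M.
Hypothesis dd : dense_seq d.

Definition box n (A : 'I_n -> set (borel M)) : set (borel (power M n)) :=
  [set x | forall i, A i (x i)].

Definition boxes n : set (set (borel (power M n))) :=
  [set B | exists A : 'I_n -> set (borel M), (forall i, measurable (A i)) /\ B = box A].

Lemma boxesI n : setI_closed (@boxes n).
Proof.
move=> _ _ [A [mA ->]] [B [mB ->]]; exists (fun i => A i `&` B i); split.
  by move=> i; exact: measurableI.
apply/seteqP; split => x; first by move=> [h h'] i; split; [exact: h|exact: h'].
by move=> h; split => i; [exact: (h i).1|exact: (h i).2].
Qed.

Lemma boxes_sigma n : @measurable _ (borel (power M n)) = <<s @boxes n >>.
Proof.
apply/seteqP; split; last first.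
  apply: smallest_sub; first exact: smallest_sigma_algebra.
  by move=> _ [A [mA ->]]; exact: measurable_box.
rewrite (base_seq_sigma (box_seq_base dd n)).
apply: smallest_sub; first exact: smallest_sigma_algebra.
move=> _ [k _ <-]; apply: sub_sigma_algebra; rewrite /box_seq; set e := odflt _ _.
exists (fun i => ball_seq d (e i)); split => // i.
by apply: open_measurable_borel; exact: (ball_seq_base dd).1.
Qed.

(** The iterated integral [prod_prob] rebuilt as a bundled probability, under which expectations can
    be taken. *)
Fixpoint pprod n : ('I_n -> probability (borel M) R) -> probability (borel (power M n)) R :=
  match n with
  | 0 => fun _ => \d_(point : borel (power M 0))
  | n'.+1 => fun mu => push (mu ord0 \x pprod (fun i => mu (lift ord0 i)))%E
                            (@measurable_fcons R M d dd n')
  end.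

Lemma pprodE n (mu : 'I_n -> probability (borel M) R) B : measurable B ->
  pprod mu B = prod_prob mu B.
Proof.
elim: n mu B => [//|n IHn] mu B mB /=.
transitivity (\int[mu ord0]_y pprod (fun i => mu (lift ord0 i))
    (xsection ((fun yz : borel M * borel (power M n) => fcons yz.1 yz.2) @^-1` B) y))%E.
  by [].
apply: eq_integral => y _.
rewrite -IHn; last first.
  have m1 : measurable_fun setT (fun z : borel (power M n) => fcons y z : borel (power M n.+1)).
    have mp : measurable_fun setT (fun z : borel (power M n) => ((y, z) : borel M * borel (power M n))).
      exact: measurable_pair1.
    exact: (measurableT_comp (@measurable_fcons R M d dd n) mp).
  by have := m1 measurableT B mB; rewrite setTI.
by congr (pprod _ _); apply/seteqP; split => z; rewrite /xsection/= inE.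
Qed.

Lemma pprod_box n (mu : 'I_n -> probability (borel M) R) (A : 'I_n -> set (borel M)) :
  (forall i, measurable (A i)) -> fine (pprod mu (box A)) = \prod_i fine (mu i (A i)).
Proof.
move=> mA; rewrite pprodE; last exact: measurable_box.
rewrite prod_prob_box//.
rewrite (_ : (\prod_(i < n) mu i (A i))%E = (\prod_(i < n) fine (mu i (A i)))%:E)//.
rewrite -prodEFin; apply: eq_bigr => i _.
by rewrite prob_fineK.
Qed.

Lemma pfam_pprod e (T : measurableType e) n (F : 'I_n -> T -> probability (borel M) R) :
  (forall i, pfam (F i)) -> pfam (fun t => pprod (fun i => F i t)).
Proof.
move=> mF; apply: (pfam_from (@boxes_sigma n) (@boxesI n)) => _ [A [mA ->]].
under eq_fun do rewrite pprod_box//.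
by apply: (bm_prod _ _).1 => i; exact: pfam_bm.
Qed.

Lemma bm_proj n (f : borel M -> R) (i : 'I_n) : bm f ->
  bm ((fun x => f (x i)) : borel (power M n) -> R).
Proof. by move=> bf; exact: (bm_comp (measurable_proj i) bf). Qed.

Lemma exp_pprod n (mu : 'I_n -> probability (borel M) R) (f : 'I_n -> borel M -> R) :
  (forall i, bm (f i)) ->
  \int[pprod mu]_x (\prod_i f i (x i)) = \prod_i \int[mu i]_y f i y.
Proof.
elim: n mu f => [|n IHn] mu f bf.
  rewrite big_ord0 -[RHS](exp_cst (pprod mu)).
  by apply: eq_Rintegral => x _; rewrite big_ord0.
have bp : bm ((fun x => \prod_i f i (x i)) : borel (power M n.+1) -> R).
  by apply: (@bm_prod R _ (borel (power M n.+1)) _ _ (fun i x => f i (x i))) => i; exact: bm_proj.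
rewrite [pprod mu]/= exp_push// exp_fubini; last first.
  exact: (bm_comp (@measurable_fcons R M d dd n) bp).
rewrite big_ord_recl.
pose C := \prod_(i < n) \int[mu (lift ord0 i)]_y f (lift ord0 i) y.
have inner y : \int[pprod (fun i => mu (lift ord0 i))]_z
    (\prod_i f i (fcons y z i)) = C * f ord0 y.
  rewrite /C -(IHn (fun i => mu (lift ord0 i)) (fun i => f (lift ord0 i))); last by move=> i.
  rewrite mulrC -expZ; last first.
    by apply: (@bm_prod R _ (borel (power M n)) _ _ (fun i x => f (lift ord0 i) (x i))) => i; exact: bm_proj.
  apply: eq_Rintegral => z _; rewrite big_ord_recl; congr (_ * _).
    by rewrite /fcons unlift_none.
  by apply: eq_bigr => i _; rewrite /fcons liftK.
under eq_Rintegral do rewrite inner.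
by rewrite expZ// mulrC.
Qed.

End finite_products.

Section kernel_space.
Context {R : realType} {M : pmetricType R}.
Variables (c : nat -> M) (r : nat -> R).
Hypothesis bV : base_seq (bal c r).

Lemma measurable_kev (x : M) :
  measurable_fun setT (fun K : EE R M => (K : kernels R M) x).
Proof.
apply: (@measurability _ _ (EE R M) (PP R M) setT _ measurable).
  by rewrite (sigma_algebra_id (@sigma_algebra_measurable _ _)).
move=> _ [A mA <-]; rewrite setTI; apply: sub_sigma_algebra.
by exists x => //; exists A.
Qed.

Lemma pfam_PP d (T : measurableType d) (F : T -> PP R M) :
  measurable_fun setT F -> pfam (fun t => prob_of (F t)).
Proof. by move=> mF A mA; exact: (measurableT_comp (pfam_prob_of bV mA) mF). Qed.

Lemma pfam_kmeas (x : M) : pfam (fun K : EE R M => kmeas K x).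
Proof. exact: (pfam_PP (measurable_kev x)). Qed.

Lemma pfam_kernel (K : EE R M) : pfam (kmeas K : borel M -> _).
Proof.
have mK : measurable_fun setT ((K : kernels R M) : borel M -> PP R M) by exact: measurable_funPT.
exact: (pfam_PP mK).
Qed.

Lemma measurable_to_EE d (T : measurableType d) (F : T -> EE R M) :
  (forall x, measurable_fun setT (fun t => (F t : kernels R M) x)) -> measurable_fun setT F.
Proof.
move=> mF; refine (@measurability _ _ T (EE R M) setT F (@kernel_evaluation_sets R M) erefl _).
move=> _ [_ [x _ [A mA <-]] <-].
exact: mF.
Qed.

Definition mk_kernel (k : borel M -> PP R M) (mk : measurable_fun setT k) : EE R M :=
  (mfun_of mk : kernels R M).

(** Finitely many thresholds on masses of intersections of balls: events closed under intersection,
    generating the field of E, and with probabilities determined by mixed moments. *)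
Definition kthresholds : set (set (EE R M)) :=
  range (fun l : seq ((M * seq nat) * R) =>
    [set K : EE R M | all (fun p => p.2 < fine (kmeas K p.1.1 (inter c r p.1.2)))%R l]).

Lemma kthresholdsI : setI_closed kthresholds.
Proof.
move=> _ _ [l _ <-] [l' _ <-]; exists (l ++ l') => //.
apply/seteqP; split => K /=; rewrite all_cat; first by move/andP.
by move=> [-> ->].
Qed.

Lemma kthresholds_sigma : @measurable _ (EE R M) = <<s kthresholds >>.
Proof.
apply/seteqP; split; last first.
  apply: smallest_sub; first exact: smallest_sigma_algebra.
  move=> _ [l _ <-]; elim: l => [|p l IHl] /=.
    by rewrite (_ : mkset _ = setT)//; exact/seteqP.
  rewrite (_ : mkset _ = ((fun K => fine (kmeas K p.1.1 (inter c r p.1.2))) @^-1` `]p.2, +oo[) `&`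
     [set K : EE R M | all (fun p => p.2 < fine (kmeas K p.1.1 (inter c r p.1.2)))%R l]).
    apply: measurableI; last exact: IHl.
    rewrite -[X in measurable X]setTI.
    have m1 := (pfam_bm (pfam_kmeas p.1.1) (measurable_inter bV p.1.2)).1.
    exact: (m1 measurableT _ (@measurable_itv R `]p.2, +oo[)).
  apply/seteqP; split => K; rewrite /preimage/= in_itv/= andbT; first by move/andP.
  by move=> [-> ->].
apply: smallest_sub; first exact: smallest_sigma_algebra.
move=> _ [x _ [A mA <-]].
(* On E with the field generated by thresholds alone, the evaluations are already measurable, by the
   mass criterion for maps into [PP]. *)
pose E' := g_sigma_algebraType kthresholds.
suff : measurable_fun setT ((fun K => (K : kernels R M) x) : E' -> PP R M).
  by move=> h; have := h measurableT A mA; rewrite setTI.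
apply: (measurable_to_PP bV).
apply: (pfam_from (inters_sigma bV) (@intersI _ _ c r)) => _ [s _ <-].
apply: (measurability _ (measurable_realfun.RGenOInfty.measurableE R)).
move=> _ [_ [a ->] <-]; rewrite setTI; apply: sub_sigma_algebra.
by exists [:: ((x, s), a)].
Qed.

Lemma kernel_measure_unique (nu nu' : probability (EE R M) R) :
  (forall l : seq (M * seq nat),
     \int[nu]_K \prod_(p <- l) fine (kmeas K p.1 (inter c r p.2)) =
     \int[nu']_K \prod_(p <- l) fine (kmeas K p.1 (inter c r p.2))) ->
  same_measure nu nu'.
Proof.
move=> h B mB; apply: (prob_unique kthresholds_sigma kthresholdsI) mB.
move=> _ [l _ <-].
apply: (@moments_unique _ _ _ _ _ _ nu nu'
  (fun p K => fine (kmeas K p.1 (inter c r p.2))) (fun p K => fine (kmeas K p.1 (inter c r p.2)))).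
- by move=> p; exact: (pfam_bm (pfam_kmeas p.1) (measurable_inter bV p.2)).1.
- by move=> p; exact: (pfam_bm (pfam_kmeas p.1) (measurable_inter bV p.2)).1.
- by move=> p K; rewrite prob_fine_ge0 prob_fine_le1//; exact: measurable_inter.
- by move=> p K; rewrite prob_fine_ge0 prob_fine_le1//; exact: measurable_inter.
- exact: h.
Qed.

(** The mixtures of K2 under the laws [K1 x] form a kernel meeting the specification, so the choice
    made by [get] is a genuine composition. *)
Lemma kernel_compP (K1 K2 : EE R M) : is_kernel_comp K1 K2 (kernel_comp K1 K2).
Proof.
have mk : measurable_fun setT ((fun x => mixture (kmeas K1 x) (pfam_kernel K2)) : borel M -> PP R M).
  apply: (measurable_to_PP bV) => A mA.
  rewrite (_ : (fun x => _) = (fun x => (\int[kmeas K1 x]_y fine (kmeas K2 y A))%:E)).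
    apply/measurable_EFinP.
    exact: (pfam_exp (pfam_kernel K1) (pfam_bm (pfam_kernel K2) mA)).1.
  apply/funext => x; rewrite -(mixture_fine (kmeas K1 x) (pfam_kernel K2) mA).
  by rewrite (prob_fineK (mixture (kmeas K1 x) (pfam_kernel K2)) mA).
apply: (@getPex _ [set K | is_kernel_comp K1 K2 K]).
by exists (mk_kernel mk) => x B mB.
Qed.

End kernel_space.

(** * Particle systems driven by one uniform variable *)

Section prefix_measures.
Context {R : realType}.

Lemma prefix_measure (m : probability Bits R) n (Q : pred (seq bool)) :
  fine (m [set c | Q (mkseq c n)]) = \sum_(s : n.-tuple bool | Q s) fine (m (cyl s)).
Proof.
have mQ : measurable ([set c | Q (mkseq c n)] : set Bits).
  exact: (@measurable_prefix n (fun s => Q s)).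
rewrite -(exp_indic m mQ).
under [RHS]eq_bigr do rewrite -(exp_indic m (measurable_cyl _)).
rewrite big_mkcond.
transitivity (\int[m]_c (\sum_(s : n.-tuple bool) (if Q s then \1_(cyl s) c else 0) : R)).
  apply: eq_Rintegral => c _; rewrite indicE.
  rewrite (_ : (c \in _) = Q (mkseq c n)); last first.
    by apply/idP/idP => [|h]; rewrite inE.
  have sn : size (mkseq c n) == n by rewrite size_mkseq.
  rewrite (bigD1 (Tuple sn)) //= big1 ?addr0.
    case: (Q _) => //; rewrite indicE mem_set//; exact: mem_cyl_mkseq.
  move=> s sN; case: ifP => // _; rewrite indicE memNset// => /= cs.
  move/eqP: sN; apply; apply: val_inj => /=.
  by rewrite -cs size_tuple.
rewrite exp_sum; last first.
  move=> s; case: (Q s); last exact: bm_cst.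
  by apply: bm_indic; exact: measurable_cyl.
apply: eq_bigr => s _; case: (Q s) => //.
by rewrite exp_cst.
Qed.

End prefix_measures.

Section particles.
Context {R : realType} {M : pmetricType R}.
Variable d : nat -> M.
Hypothesis dd : dense_seq d.
Hypothesis lM : locally_compact [set: M].
Variable Q : forall n, power M n -> probability (borel (power M n)) R.
Hypothesis cQ : forall k n (s : 'I_k -> 'I_n), (1 <= k)%N -> (k <= n)%N -> injective s ->
  forall (x : power M n) (B : set (borel (power M k))), measurable B ->
  Q x ((tuple_proj s : borel (power M n) -> borel (power M k)) @^-1` B) = Q (tuple_proj s x) B.
Variable z : nat -> M.

Definition upair (q : nat) : nat * nat := odflt (0, 0)%N (unpickle q).

Lemma upairK k m : upair (pickle (k, m)) = (k, m).
Proof. by rewrite /upair pickleK. Qed.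

(** Indices beyond the system return [point]; by [needP] no bit of the relevant prefix sees this
    value. *)
Definition tget n (x : power M n) (k : nat) : M := oapp x point (insub k).

Lemma tgetE n (x : power M n) (i : 'I_n) : tget x i = x i.
Proof. by rewrite /tget valK. Qed.

Definition start n : power M n := fun i => z i.

(* The bits of all particles are interleaved in a single sequence, whose first n
   terms involve the first need n particles only. *)
Definition tcode n (x : borel (power M n)) : Bits :=
  fun q => code d (tget x (upair q).1) (upair q).2.

Definition need n : nat := (\max_(q < n) (upair q).1).+1.

Lemma needP n q : (q < n)%N -> ((upair q).1 < need n)%N.
Proof. by move=> qn; rewrite /need ltnS (leq_bigmax (Ordinal qn)). Qed.

Lemma need_mono n m : (n <= m)%N -> (need n <= need m)%N.
Proof. by move=> nm; rewrite /need ltnS; apply/bigmax_leqP => i _; rewrite -ltnS needP// (leq_trans _ nm). Qed.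

Lemma measurable_tcode n : measurable_fun setT (@tcode n).
Proof.
apply: measurable_fun_bits => q.
suff mt : measurable_fun setT (fun x : borel (power M n) => tget x (upair q).1 : borel M).
  have mc := measurableT_comp (measurable_code dd) mt.
  have := mc measurableT _ (@measurable_bit (upair q).2 true).
  by rewrite setTI.
rewrite /tget; case: insubP => [i _ _|_] /=; first exact: measurable_proj.
exact: measurable_cst.
Qed.

Definition plaw n : probability Bits R := push (Q (@start n)) (@measurable_tcode n).

Lemma plawE n A : plaw n A = Q (@start n) (@tcode n @^-1` A).
Proof. by []. Qed.

(** The prefix s involves only particles present in both systems, and consistency along the
    inclusion of 'I_n in 'I_m identifies their laws. *)
Lemma plaw_cyl n m s : (need (size s) <= n)%N -> (n <= m)%N ->
  plaw n (cyl s) = plaw m (cyl s).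
Proof.
move=> sn nm; rewrite (plawE n) (plawE m).
have n0 : (1 <= n)%N by apply: leq_trans sn.
have mB : measurable (@tcode n @^-1` cyl s).
  by rewrite -[X in measurable X]setTI; apply: measurable_tcode => //; exact: measurable_cyl.
have inj : injective (widen_ord nm) by move=> i j /(congr1 val) /= ij; exact: val_inj.
have := @cQ n m (widen_ord nm) n0 nm inj (@start m) _ mB.
rewrite (_ : tuple_proj _ _ = @start n); last by apply/funext.
move=> <-.
have e (x : power M m) q : (q < size s)%N -> tcode (tuple_proj (widen_ord nm) x) q = tcode x q.
  move=> qs; have qn : ((upair q).1 < n)%N by rewrite (leq_trans (needP qs)).
  rewrite /tcode; congr (code d _ _).
  exact: (etrans (tgetE _ (Ordinal qn)) (esym (tgetE x (widen_ord nm (Ordinal qn))))).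
congr (Q _ _); apply/seteqP; split => x; rewrite /preimage /= => /cylE h;
  apply/cylE => q qs; rewrite -h//.
  by rewrite -e.
by rewrite -e.
Qed.

Definition pweights (s : seq bool) : R := fine (plaw (need (size s)) (cyl s)).

Lemma pweightsE n s : (need (size s) <= n)%N -> pweights s = fine (plaw n (cyl s)).
Proof. by move=> sn; rewrite /pweights (plaw_cyl (leqnn _) sn). Qed.

Lemma weights_pweights : weights pweights.
Proof.
have w n := weights_of_prob (plaw n); split; first by have [] := w (need 0).
move=> s; split; first exact: prob_fine_ge0.
have nS : (need (size s) <= need (size s).+1)%N by exact: need_mono.
(* All three masses are computed with the same number of particles, hence under one probability. *)
rewrite (pweightsE nS) !(@pweightsE (need (size s).+1)) ?size_rcons//.
by have [_ /(_ s)[]] := w (need (size s).+1).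
Qed.

Definition ULeb : probability (measurableTypeR R) R := unit_lebesgue.

Definition pbits (u : measurableTypeR R) : Bits := bits_of pweights u.

Definition pbit (k : nat) (u : measurableTypeR R) : Bits := fun m => pbits u (pickle (k, m)).

Lemma measurable_pbit k : measurable_fun setT (pbit k).
Proof.
apply: measurable_fun_bits => m.
have := measurable_bits_of pweights measurableT (@measurable_bit (pickle (k, m)) true).
by rewrite setTI.
Qed.

Lemma pbits_prefix n N (F : pred (seq bool)) : (need n <= N)%N ->
  fine (ULeb [set u | F (mkseq (pbits u) n)]) =
  fine (Q (@start N) [set x | F (mkseq (tcode x) n)]).
Proof.
move=> nN; have := prefix_measure (weights_prob pweights) n F.
have := prefix_measure (plaw N) n F.
rewrite [X in fine X]plawE => hN hw.
rewrite (_ : [set u | _] = bits_of pweights @^-1` [set c | F (mkseq c n)])//.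
apply: (etrans hw); apply: (etrans _ (esym hN)); apply: eq_bigr => s _.
by rewrite (weights_prob_cyl _ weights_pweights)/= (@pweightsE N)// size_tuple.
Qed.

Lemma pbit_joint n (k : 'I_n -> nat) (s : 'I_n -> seq bool) : (0 < n)%N -> injective k ->
  fine (ULeb [set u | forall i, cyl (s i) (pbit (k i) u)]) =
  fine (Q (fun i => z (k i)) (box (fun i => code d @^-1` cyl (s i)))).
Proof.
move=> n0 injk.
(* m is a prefix length containing every bit involved; N particles suffice to determine that prefix
   and include all the particles [k i]. *)
pose m : nat := (\max_i \max_(j < size (s i)) (pickle (k i, j : nat)).+1)%N.
have mP i j : (j < size (s i))%N -> (pickle (k i, j) < m)%N.
  move=> js; rewrite /m (leq_trans _ (leq_bigmax i))//.
  by rewrite (leq_trans _ (leq_bigmax (Ordinal js))).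
pose N := maxn (need m) (maxn n (\max_i (k i).+1)).
have kN i : (k i < N)%N by rewrite /N !leq_max (leq_bigmax i) !orbT.
have nN : (n <= N)%N by rewrite /N !leq_max leqnn orbT.
pose F (t : seq bool) := [forall i, [forall j : 'I_(size (s i)),
  nth false t (pickle (k i, j : nat)) == nth false (s i) j]].
have FE (c : nat -> bool) (b : nat -> Bits) : (forall i j, b (k i) j = c (pickle (k i, j))) ->
    F (mkseq c m) <-> forall i, cyl (s i) (b (k i)).
  move=> bc; split.
    move=> /forallP h i; apply/cylE => j js; rewrite bc.
    by have /forallP/(_ (Ordinal js))/eqP /= := h i; rewrite nth_mkseq ?mP.
  move=> h; apply/forallP => i; apply/forallP => j; apply/eqP.
  by rewrite nth_mkseq ?mP// -bc; have /cylE := h i; exact.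
rewrite (_ : [set u | _] = [set u | F (mkseq (pbits u) m)]); last first.
  by apply/seteqP; split => u /=; have := FE (pbits u) (pbit^~ u) ltac:(by []) => -[h1 h2].
rewrite (@pbits_prefix m N) ?leq_maxl//.
pose kk (i : 'I_n) := Ordinal (kN i).
have injkk : injective kk by move=> i j /(congr1 val) /= /injk.
have mB : measurable (box (fun i : 'I_n => code d @^-1` cyl (s i))).
  apply: measurable_box => i; rewrite -[X in measurable X]setTI.
  by apply: (measurable_code dd) => //; exact: measurable_cyl.
have := @cQ n N kk n0 nN injkk (@start N) _ mB.
rewrite (_ : tuple_proj kk (@start N) = (fun i => z (k i)))// => <-.
congr (fine (Q _ _)); apply/seteqP; split => x.
  move=> /(FE (tcode x) (fun l => code d (tget x l))) h i.
  rewrite /preimage/= (_ : tuple_proj kk x i = tget x (k i)); last exact: (esym (tgetE x (kk i))).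
  by apply: h => {}i j; rewrite /tcode upairK.
move=> h; apply/(FE (tcode x) (fun l => code d (tget x l))).
  by move=> i j; rewrite /tcode upairK.
move=> i; have := h i; rewrite /preimage/=.
by rewrite (_ : tuple_proj kk x i = tget x (k i))//; exact: (esym (tgetE x (kk i))).
Qed.

End particles.

(** * Almost sure convergence from second moments *)

Section ae_convergence.
Context {R : realType} d {T : measurableType d} (P : probability T R).

(** From 2|h| <= 2 ^ n h ^ 2 + 2 ^ -n the first moments are at most (C + 1) / 2 times 2 ^ -n; the
    sum of the |h n| then has finite expectation and is finite almost surely. *)
Lemma ae_summable (h : nat -> T -> R) (C : R) : (forall n, bm (h n)) ->
  (forall n, \int[P]_x (h n x ^+ 2) <= C / 4 ^+ n) ->
  {ae P, forall x, cvgn (series (fun n => `|h n x|))}.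
Proof.
move=> bh hC.
pose K : R := (C + 1) / 2.
have C0 : 0 <= C.
  have := hC 0%N; rewrite expr0 divr1; apply: le_trans.
  by apply: Rintegral_ge0 => x _; exact: sqr_ge0.
have hK n : \int[P]_x `|h n x| <= K / 2 ^+ n.
  have h2 (x : T) : `|h n x| <= 2^-1 * (2 ^+ n * h n x ^+ 2 + (2 ^+ n)^-1).
    have p0 : 0 < 2 ^+ n :> R by rewrite exprn_gt0.
    rewrite mulrC ler_pdivlMr// -subr_ge0.
    rewrite (_ : _ - _ = 2 ^+ n * (`|h n x| - (2 ^+ n)^-1) ^+ 2).
      by rewrite mulr_ge0 ?sqr_ge0 ?ltW.
    rewrite -(real_normK (num_real (h n x))); field.
    by rewrite gt_eqF.
  have bh2 := bmX 2 (bh n).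
  have b1 : bm (fun x => 2 ^+ n * h n x ^+ 2 + (2 ^+ n)^-1).
    by apply: bmD; [exact: bmZ|exact: bm_cst].
  rewrite (le_trans (exp_le P (bm_norm (bh n)) (bmZ 2^-1 b1) h2))//.
  rewrite expZ// exp_lin//; last exact: bm_cst.
  rewrite exp_cst /K mulrC -mulrA [X in _ <= X](_ : _ = (C / 2 ^+ n + (2 ^+ n)^-1) / 2); last first.
    by field; rewrite gt_eqF// exprn_gt0.
  rewrite ler_pM2r// lerD2r (le_trans (ler_wpM2l _ (hC n)))//.
  rewrite le_eqVlt; apply/orP; left; apply/eqP.
  rewrite (_ : 4 = 2 * 2 :> R); last by ring.
  by rewrite exprMn; field; rewrite gt_eqF// exprn_gt0.
have K0 : 0 <= K by rewrite /K; lra.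
pose S (x : T) := (\sum_(n <oo) (`|h n x|)%:E)%E.
have mn n : measurable_fun setT (fun x => (`|h n x|)%:E : \bar R).
  by apply/measurable_EFinP; exact: (bm_norm (bh n)).1.
have iS : (\int[P]_x S x < +oo)%E.
  rewrite integral_nneseries//.
  apply: (@le_lt_trans _ _ (2 * K)%:E); last by rewrite ltry.
  apply: lime_le; first by apply: is_cvg_nneseries => n _ _; exact: integral_ge0.
  apply: nearW => n.
  apply: (@le_trans _ _ (\sum_(0 <= k < n) K / 2 ^+ k)%:E).
    rewrite -sumEFin; apply: lee_sum => k _.
    by rewrite -exp_EFin; [rewrite lee_fin|exact: bm_norm].
  rewrite lee_fin (_ : \sum_(0 <= k < n) _ = 2 * K - 2 * K / 2 ^+ n); last first.
    elim: n => [|n IHn]; first by rewrite big_geq// expr0 divr1 subrr.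
    rewrite big_nat_recr//= IHn exprS; field.
    by rewrite gt_eqF// exprn_gt0.
  by rewrite gerBl divr_ge0// mulr_ge0.
have mS : measurable_fun setT S.
  by apply: ge0_emeasurable_sum => //.
have S0 x : (0 <= S x)%E by apply: nneseries_ge0 => n _ _.
have inS : P.-integrable setT S.
  apply/integrableP; split => //.
  by under eq_integral do rewrite gee0_abs//.
have := integrable_ae measurableT inS.
apply: filterS => x /(_ I) fS.
apply: nnseries_is_cvg => //.
by rewrite ltey_eq fS.
Qed.

Lemma ae_cvg_to (f_ : nat -> T -> R) (f : T -> R) (C : R) :
  (forall n, bm (f_ n)) -> bm f ->
  (forall n, \int[P]_x ((f_ n x - f x) ^+ 2) <= C / 4 ^+ n) ->
  {ae P, forall x, f_ ^~ x @ \oo --> f x}.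
Proof.
move=> bf_ bf hC.
have := @ae_summable (fun n x => f_ n x - f x) C (fun n => bmB (bf_ n) bf) hC.
apply: filterS => x /cvg_series_cvg_0 h.
apply/cvgrPdist_le => e e0; move/cvgrPdist_le : h => /(_ e e0).
by apply: filterS => n /=; rewrite sub0r normrN normr_id distrC.
Qed.

Lemma ae_cvg_increments (f_ : nat -> T -> R) (C : R) :
  (forall n, bm (f_ n)) ->
  (forall n, \int[P]_x ((f_ n.+1 x - f_ n x) ^+ 2) <= C / 4 ^+ n) ->
  {ae P, forall x, cvgn (f_ ^~ x)}.
Proof.
move=> bf_ hC.
have := @ae_summable (fun n x => f_ n.+1 x - f_ n x) C (fun n => bmB (bf_ n.+1) (bf_ n)) hC.
apply: filterS => x h.
have /normed_cvg {}h : cvgn [normed series (fun n => f_ n.+1 x - f_ n x)] by [].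
rewrite (_ : f_ ^~ x = (fun n => series (fun n => f_ n.+1 x - f_ n x) n + f_ 0 x)).
  by apply: is_cvgD => //; exact: is_cvg_cst.
apply/funext => n; rewrite /series /=; elim: n => [|n IHn].
  by rewrite big_geq// add0r.
by rewrite big_nat_recr//= addrAC -IHn; ring.
Qed.

Lemma cvg_cesaro_eventually (v : nat -> R) (l b : R) (A : nat) : (forall a, `|v a - l| <= b) ->
  (forall a, (A <= a)%N -> v a = l) ->
  (4 ^+ j)^-1 * \sum_(a < (4 ^ j)%N) v a @[j --> \oo] --> l.
Proof.
move=> vb vA.
apply: (@cvg_bounded_by_inv _ _ _ (A%:R * b)) => j.
have p0 : 0 < 4 ^+ j :> R by rewrite exprn_gt0.
have -> : (4 ^+ j)^-1 * \sum_(a < (4 ^ j)%N) v a - l = (4 ^+ j)^-1 * \sum_(a < (4 ^ j)%N) (v a - l).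
  rewrite sumrB sumr_const card_ord -[l *+ _]mulr_natl natrX.
  by field; rewrite gt_eqF.
rewrite normrM gtr0_norm ?invr_gt0// mulrC.
have b0 : 0 <= b by rewrite (le_trans _ (vb 0%N)).
apply: ler_pM => //.
  rewrite (le_trans (ler_norm_sum _ _ _))//.
  apply: (@le_trans _ _ (\sum_(a < (4 ^ j)%N) (if (a < A)%N then b else 0))).
    apply: ler_sum => a _; case: ltnP => [_|/vA ->]; first exact: vb.
    by rewrite subrr normr0.
  have e N : \sum_(a < N) (if (a < A)%N then b else 0) = (minn N A)%:R * b.
    elim: N => [|N IHN]; first by rewrite big_ord0 min0n mul0r.
    rewrite big_ord_recr /= IHN; case: ltnP => NA.
      by rewrite (minn_idPl NA) -natr1 mulrDl mul1r.
    by rewrite (minn_idPr (leqW NA)) addr0.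
  by rewrite e ler_wpM2r// ler_nat geq_minr.
rewrite lef_pV2 ?posrE// -natrX ler_nat.
by elim: j {p0} => // j IHj; rewrite expnS; lia.
Qed.

End ae_convergence.

Section almost_everywhere_lemmas.
Context {R : realType} d {T : measurableType d} (P : probability T R).

Lemma ae_countable (I : countType) (Q : I -> T -> Prop) :
  (forall i, {ae P, forall x, Q i x}) -> {ae P, forall x, forall i, Q i x}.
Proof.
move=> h.
pose Q' n x := if unpickle n is Some i then Q i x else True.
have h' n : P.-negligible (~` [set x | Q' n x]).
  rewrite /Q'; case: (unpickle n) => [i|]; first exact: h.
  by rewrite (_ : [set _ | True] = setT) ?setCT; [exact: negligible_set0|apply/seteqP; split].
have := negligible_bigcup h'.
apply: negligibleS => x /= /existsNP[i hi]; exists (pickle i) => //=.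
by rewrite /Q' pickleK.
Qed.

Lemma ae_exp0 (f : T -> R) : bm f -> (forall x, 0 <= f x) -> \int[P]_x f x = 0 ->
  {ae P, forall x, f x = 0}.
Proof.
move=> bf f0 h.
have mf : measurable_fun setT (EFin \o f) by apply/measurable_EFinP; exact: bf.1.
have [+ _] := @ae_eq_integral_abs _ T R P setT measurableT _ mf.
rewrite (_ : (\int[P]_x _)%E = 0%E); last first.
  rewrite -[RHS]/((0 : R)%:E) -h exp_EFin//; apply: eq_integral => x _.
  by rewrite /= ger0_norm.
by move=> /(_ erefl); apply: filterS => x /(_ I) /= [].
Qed.

End almost_everywhere_lemmas.

(** * Empirical measures *)

Section empirical_measures.
Context {R : realType} {M : pmetricType R}.
Variable d : nat -> M.
Hypothesis dd : dense_seq d.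
Hypothesis lM : locally_compact [set: M].
Variables (c : nat -> M) (r : nat -> R).
Hypothesis bV : base_seq (bal c r).
Variable Q : forall n, power M n -> probability (borel (power M n)) R.
Hypothesis cQ : forall k n (s : 'I_k -> 'I_n), (1 <= k)%N -> (k <= n)%N -> injective s ->
  forall (x : power M n) (B : set (borel (power M k))), measurable B ->
  Q x ((tuple_proj s : borel (power M n) -> borel (power M k)) @^-1` B) = Q (tuple_proj s x) B.
Variable y : nat -> M.

Local Notation Om := (measurableTypeR R).
Local Notation leb := (@ULeb R).

(* Infinitely many particles start from each point y i. *)
Definition pstart (k : nat) : M := y (upair k).1.

(** The pair p holds the index of a starting point and a bit prefix; a numbers the copies started
    there. *)
Definition xi (p : nat * seq bool) (a : nat) (u : Om) : R :=
  \1_(cyl p.2) (pbit dd Q pstart (pickle (p.1, a)) u).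

(** The mixed moments prescribed for the random measures, on the sets of points whose codes begin
    with given bits. *)
Definition qq n (f : nat -> nat * seq bool) : R :=
  fine (Q (fun l : 'I_n => y (f l).1) (box (fun l : 'I_n => code d @^-1` cyl (f l).2))).

Let dflt : nat * seq bool := (0%N, [::]).

Definition qlist (L : seq (nat * seq bool)) : R := qq (size L) (nth dflt L).

Lemma bm_xi p a : bm (xi p a).
Proof.
apply: (bm_comp (measurable_pbit dd Q pstart (pickle (p.1, a)))).
by apply: bm_indic; exact: measurable_cyl.
Qed.

Lemma xi_ge0 p a u : 0 <= xi p a u.
Proof. by rewrite /xi indicE. Qed.

Lemma xi_le1 p a u : xi p a u <= 1.
Proof. by rewrite /xi indicE; case: (_ \in _). Qed.

Lemma xi_norm p a u : `|xi p a u| <= 1.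
Proof. by rewrite ger0_norm ?xi_ge0 ?xi_le1. Qed.

Lemma xi_sq p a u : xi p a u * xi p a u = xi p a u.
Proof. by rewrite /xi indicE; case: (_ \in _); rewrite /= ?mulr1 ?mulr0. Qed.

(** Only the particles must be distinct; several of them may share a starting point, which is how
    higher moments of one random measure arise. *)
Lemma xi_joint (L : seq ((nat * seq bool) * nat)) : (0 < size L)%N ->
  uniq [seq (p.1.1, p.2) | p <- L] ->
  \int[leb]_u (\prod_(p <- L) xi p.1 p.2 u) = qlist [seq p.1 | p <- L].
Proof.
move=> L0 uL; pose df : (nat * seq bool) * nat := (dflt, 0%N).
pose k (l : 'I_(size L)) := pickle ((nth df L l).1.1, (nth df L l).2).
pose s (l : 'I_(size L)) := (nth df L l).1.2.
have injk : injective k.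
  move=> i j /(pcan_inj pickleK) h; apply: val_inj => /=.
  apply/eqP; rewrite -(@nth_uniq _ (0%N, 0%N) [seq (p.1.1, p.2) | p <- L]) ?size_map//.
  by rewrite !(nth_map df)// h.
have := pbit_joint dd cQ pstart s L0 injk.
have mE : measurable [set u | forall i, cyl (s i) (pbit dd Q pstart (k i) u)].
  rewrite (_ : mkset _ = \bigcap_(i in [set: 'I_(size L)]) [set u | cyl (s i) (pbit dd Q pstart (k i) u)]).
    apply: fin_bigcap_measurable => // i _.
    have := measurable_pbit dd Q pstart (k i) measurableT (measurable_cyl (s i)).
    by rewrite setTI.
  by apply/seteqP; split => u /= h i; [move=> _; exact: h|exact: h].
rewrite -(exp_indic leb mE) => h.
transitivity (\int[leb]_u (\1_[set u | forall i, cyl (s i) (pbit dd Q pstart (k i) u)] u : R)).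
  apply: eq_Rintegral => u _; rewrite indicE (big_nth df) big_mkord.
  have [hu|hu] := pselect (forall i, cyl (s i) (pbit dd Q pstart (k i) u)).
    rewrite mem_set//= big1// => i _; rewrite /xi indicE mem_set//; exact: hu.
  rewrite memNset//=; move/existsNP: hu => [i hi].
  by rewrite (bigD1 i)//= {1}/xi indicE memNset// mul0r.
rewrite h /qlist /qq size_map; congr (fine (Q _ _)).
  by apply/funext => l; rewrite (nth_map df)// /pstart upairK.
by congr box; apply/funext => l; rewrite (nth_map df).
Qed.

(* Averaging over 4 ^ j particles makes the squared increments summable. *)
Definition avg p j (u : Om) : R := (4 ^+ j)^-1 * \sum_(a < (4 ^ j)%N) xi p a u.

Definition lfreq p (u : Om) : R := clamp (clim (fun j => avg p j u)).

Lemma bm_avg p j : bm (avg p j).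
Proof. by apply: bmZ; apply: (@bm_sum _ _ _ _ _ (fun a : 'I__ => xi p a)) => a; exact: bm_xi. Qed.

Lemma avg_itv p j u : 0 <= avg p j u <= 1.
Proof.
have s0 : 0 <= \sum_(a < (4 ^ j)%N) xi p a u by apply: sumr_ge0 => a _; exact: xi_ge0.
rewrite /avg mulr_ge0//=.
rewrite ler_pdivrMl ?exprn_gt0// mulr1.
apply: (@le_trans _ _ (\sum_(a < (4 ^ j)%N) 1)).
  by apply: ler_sum => a _; exact: xi_le1.
by rewrite sumr_const card_ord natrX.
Qed.

Lemma avg_norm p j u : `|avg p j u| <= 1.
Proof. by have /andP[h1 h2] := avg_itv p j u; rewrite ger0_norm. Qed.

Lemma bm_lfreq p : bm (lfreq p).
Proof.
split; last by exists 1 => u; rewrite ger0_norm ?clamp_ge0// clamp_le1.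
apply: (measurableT_comp (@measurable_clamp R)).
by apply: (@measurable_clim _ _ _ (fun u j => avg p j u)) => j; exact: (bm_avg p j).1.
Qed.

Lemma lfreq_norm p u : `|lfreq p u| <= 1.
Proof. by rewrite ger0_norm ?clamp_ge0// clamp_le1. Qed.

Lemma lfreq_cvg p u : cvgn (avg p ^~ u) -> avg p j u @[j --> \oo] --> lfreq p u.
Proof.
move=> /cvg_ex[l hl].
have l01 : 0 <= l <= 1.
  rewrite -(cvg_lim _ hl)//; apply/andP; split.
    apply: limr_ge; first by apply/cvg_ex; exists l.
    by apply: nearW => j; have /andP[] := avg_itv p j u.
  apply: limr_le; first by apply/cvg_ex; exists l.
  by apply: nearW => j; have /andP[] := avg_itv p j u.
by rewrite /lfreq (clim_cvg l01 hl) clamp_id.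
Qed.

(* Var (\sum_a l_a xi_a) = (E xi_0 - E xi_0 xi_1) \sum_a l_a ^ 2 *)
Lemma xi_variance p n (l : 'I_n -> R) : \sum_a l a = 0 ->
  \int[leb]_u ((\sum_a l a * xi p a u) ^+ 2) <= \sum_a l a ^+ 2.
Proof.
move=> l0; pose e := qlist [:: p]; pose cc := qlist [:: p; p].
have bxx a b : bm (fun u => xi p a u * xi p b u) by apply: bmM; exact: bm_xi.
(* By exchangeability this second moment depends only on whether a = b. *)
have v a b : \int[leb]_u (xi p a u * xi p b u) = cc + (a == b)%:R * (e - cc).
  have [->|ab] := eqVneq a b.
    rewrite mul1r subrKC /e; under eq_Rintegral do rewrite xi_sq.
    rewrite -[RHS](@xi_joint [:: (p, b)])//; apply: eq_Rintegral => u _.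
    by rewrite big_seq1.
  have uab : uniq [seq (q.1.1, q.2) | q <- [:: (p, a); (p, b)]].
    by rewrite /= !inE andbT xpair_eqE eqxx.
  rewrite mul0r addr0 /cc -(xi_joint _ uab)//.
  by apply: eq_Rintegral => u _; rewrite big_cons big_seq1.
have ec : e - cc <= 1.
  rewrite lerBlDr (@le_trans _ _ 1)// ?lerDl; last exact: prob_fine_ge0.
  apply: prob_fine_le1; apply: measurable_box => i.
  by rewrite -[X in measurable X]setTI; apply: (measurable_code dd) => //; exact: measurable_cyl.
rewrite (_ : \int[leb]_u _ = \sum_a \sum_b (l a * l b) * (cc + (a == b)%:R * (e - cc))); last first.
  transitivity (\int[leb]_u (\sum_a \sum_b (l a * l b) * (xi p a u * xi p b u))).
    apply: eq_Rintegral => u _; rewrite expr2 big_distrlr /=; apply: eq_bigr => a _.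
    by apply: eq_bigr => b _; rewrite mulrACA.
  rewrite exp_sum; last first.
    move=> a; apply: (@bm_sum _ _ _ _ _ (fun b u => (l a * l b) * (xi p a u * xi p b u))) => b.
    exact: bmZ.
  apply: eq_bigr => a _; rewrite exp_sum; last by move=> b; exact: bmZ.
  by apply: eq_bigr => b _; rewrite expZ// v.
rewrite (_ : \sum_a _ = (e - cc) * \sum_a l a ^+ 2).
  by rewrite ler_piMl// sumr_ge0// => a _; exact: sqr_ge0.
transitivity (\sum_a (l a * cc * (\sum_b l b) + (e - cc) * l a ^+ 2)).
  apply: eq_bigr => a _; rewrite mulr_sumr.
  rewrite (eq_bigr (fun b => l a * cc * l b + (if b == a then (e - cc) * l a ^+ 2 else 0))).
    by rewrite big_split/= -big_mkcond big_pred1_eq.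
  move=> b _; rewrite eq_sym; have [->|ba] /= := eqVneq b a; last by rewrite mul0r !addr0; ring.
  by rewrite mul1r; ring.
by rewrite big_split/= -mulr_suml l0 mulr0 add0r mulr_sumr.
Qed.

(** With N = 4 ^ j, the difference is a combination of 4N indicators whose coefficients sum to 0 and
    are at most 1 / N in absolute value, so the variance bound gives 4N / N ^ 2. *)
Lemma avg_increment p j : \int[leb]_u ((avg p j.+1 u - avg p j u) ^+ 2) <= 4 / 4 ^+ j.
Proof.
pose N := (4 ^ j)%N; pose N' := (4 ^ j.+1)%N.
have NN' : (N <= N')%N by rewrite leq_exp2l.
pose l (a : 'I_N') : R := N'%:R^-1 - (if (a < N)%N then N%:R^-1 else 0).
have N0 : 0 < N%:R :> R by rewrite ltr0n expn_gt0.
have N'0 : 0 < N'%:R :> R by rewrite ltr0n expn_gt0.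
have N'E : N'%:R = 4 * N%:R :> R by rewrite /N' expnS natrM.
have trunc (f : nat -> R) : \sum_(a < N') (if (a < N)%N then f a else 0) = \sum_(a < N) f a.
  by rewrite -big_mkcond/= (big_ord_widen _ f NN').
have lE u : avg p j.+1 u - avg p j u = \sum_(a < N') l a * xi p a u.
  rewrite /avg -/N -/N' -!natrX -/N -/N'.
  rewrite -(trunc (fun a => xi p a u)) !mulr_sumr -sumrB; apply: eq_bigr => a _.
  by rewrite /l mulrBl; case: ifP => _; rewrite ?mulr0 ?mul0r.
under eq_Rintegral do rewrite lE.
apply: le_trans; first apply: xi_variance.
  rewrite /l sumrB sumr_const card_ord (trunc (fun=> N%:R^-1)) sumr_const card_ord.
  by rewrite -[X in X - _]mulr_natl -[X in _ - X]mulr_natl !divff ?subrr// gt_eqF.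
apply: (@le_trans _ _ (\sum_(a < N') N%:R^-1 ^+ 2)).
  apply: ler_sum => a _; rewrite -subr_ge0 subr_sqr /l N'E invfM.
  have q0 : 0 <= N%:R^-1 :> R by rewrite invr_ge0 ltW.
  by case: ifP => _; rewrite mulr_ge0//; lra.
rewrite sumr_const card_ord -[X in X <= _]mulr_natl N'E -natrX -/N.
by rewrite le_eqVlt; apply/orP; left; apply/eqP; field; rewrite gt_eqF.
Qed.

Lemma avg_ae_cvg : {ae leb, forall u, forall p, cvgn (avg p ^~ u)}.
Proof.
apply: (@ae_countable _ _ _ leb (nat * seq bool)%type (fun p u => cvgn (avg p ^~ u))) => p.
apply: (ae_cvg_increments (C := 4)) => j; first exact: bm_avg.
exact: avg_increment.
Qed.

(* The limiting frequencies are replaced one at a time: by exchangeability, a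
   factor lfreq p may be traded for xi p a as soon as the particle a is fresh. *)
Lemma lfreq_moments L1 (L2 : seq ((nat * seq bool) * nat)) :
  (0 < size L2 + size L1)%N -> uniq [seq (p.1.1, p.2) | p <- L2] ->
  \int[leb]_u (\prod_(p <- L2) xi p.1 p.2 u * \prod_(p <- L1) lfreq p u) =
  qlist ([seq p.1 | p <- L2] ++ L1).
Proof.
elim: L1 L2 => [|p L1 IH] L2.
  rewrite addn0 cats0 => h1 h2; rewrite -xi_joint//; apply: eq_Rintegral => u _.
  by rewrite big_nil mulr1.
move=> _ uL2.
(* Copies numbered A or more do not occur in L2, hence are fresh. *)
pose A := (\max_(q <- L2) q.2).+1.
have AP q : q \in L2 -> (q.2 < A)%N by move=> qL; rewrite /A ltnS (leq_bigmax_seq _ qL).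
have bG : bm (fun u => \prod_(p <- L2) xi p.1 p.2 u).
  by apply: (@bm_prod _ _ _ _ _ (fun q => xi q.1 q.2)) => q; exact: bm_xi.
have bH : bm (fun u => \prod_(p <- L1) lfreq p u) by apply: bm_prod => q; exact: bm_lfreq.
have GH1 u : `|\prod_(p <- L2) xi p.1 p.2 u| <= 1.
  by rewrite normr_prod; apply: prodr_ile1 => q _; rewrite normr_ge0 xi_norm.
have HH1 u : `|\prod_(p <- L1) lfreq p u| <= 1.
  by rewrite normr_prod; apply: prodr_ile1 => q _; rewrite normr_ge0 lfreq_norm.
pose v a := \int[leb]_u (\prod_(p <- L2) xi p.1 p.2 u * (xi p a u * \prod_(p <- L1) lfreq p u)).
have bv a : bm (fun u => \prod_(p <- L2) xi p.1 p.2 u * (xi p a u * \prod_(p <- L1) lfreq p u)).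
  by apply: bmM => //; apply: bmM => //; exact: bm_xi.
have vE a : (A <= a)%N -> v a = qlist ([seq p.1 | p <- L2] ++ p :: L1).
  move=> Aa; rewrite -cat_rcons -[rcons _ p]/(rcons _ (p, a).1) -map_rcons -IH.
  - apply: eq_Rintegral => u _; rewrite mulrA; congr (_ * _).
    by rewrite -cats1 big_cat big_seq1.
  - by rewrite size_rcons.
  - rewrite map_rcons rcons_uniq uL2 andbT; apply/negP => /mapP[q qL [_ qa]].
    by have := AP q qL; rewrite -qa ltnNge Aa.
have v1 a : `|v a - qlist ([seq p.1 | p <- L2] ++ p :: L1)| <= 2.
  rewrite (le_trans (ler_normB _ _))// (_ : 2 = 1 + 1)// lerD//.
    apply: exp_le_bound => // u; rewrite !normrM; apply: mulr_ile1 => //.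
    by apply: mulr_ile1 => //; exact: xi_norm.
  apply: prob_fine_norm; apply: measurable_box => i.
  by rewrite -[X in measurable X]setTI; apply: (measurable_code dd) => //; exact: measurable_cyl.
(* The finitely many copies that are not fresh disappear in the average. *)
have cv := cvg_cesaro_eventually v1 vE.
apply/esym; apply: (@cvg_unique _ _ ((4 ^+ j)^-1 * \sum_(a < (4 ^ j)%N) v a @[j --> \oo])) cv _ => //.
rewrite (_ : (fun j => _) = (fun j => \int[leb]_u (\prod_(p <- L2) xi p.1 p.2 u *
   (avg p j u * \prod_(p <- L1) lfreq p u)))); last first.
  apply/funext => j; rewrite -exp_sum// -expZ; last exact: bm_sum.
  apply: eq_Rintegral => u _; rewrite /avg -!mulrA [RHS]mulrCA; congr (_ * _).
  by rewrite mulr_suml mulr_sumr.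
apply: (exp_cvg_ae (r := 1)).
- by move=> j; apply: bmM => //; apply: bmM => //; exact: bm_avg.
- by under eq_fun do rewrite big_cons; apply: bmM => //; apply: bmM => //; exact: bm_lfreq.
- move=> j u; rewrite normrM [X in _ * X]normrM.
  have h := mulr_ile1 (normr_ge0 _) (normr_ge0 _) (avg_norm p j u) (HH1 u).
  exact: mulr_ile1 (normr_ge0 _) (mulr_ge0 (normr_ge0 _) (normr_ge0 _)) (GH1 u) h.
- apply: filterS avg_ae_cvg => u /(_ p) /lfreq_cvg hu; rewrite big_cons.
  apply: cvgM; first exact: cvg_cst.
  by apply: cvgM => //; exact: cvg_cst.
Qed.

Lemma lfreq_weights : {ae leb, forall u, forall i, weights (fun s => lfreq (i, s) u)}.
Proof.
apply: filterS avg_ae_cvg => u hu i.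
have cv s := lfreq_cvg (hu (i, s)).
split.
  apply: (@cvg_unique _ _ (avg (i, [::]) j u @[j --> \oo])) (cv [::]) _ => //.
  rewrite (_ : (fun j => _) = (fun=> 1)); first exact: cvg_cst.
  apply/funext => j; rewrite /avg (eq_bigr (fun=> 1)).
    by rewrite sumr_const card_ord natrX mulVf// gt_eqF// exprn_gt0.
  by move=> a _; rewrite /xi indicE mem_set.
move=> s; split; first exact: clamp_ge0.
apply: (@cvg_unique _ _ (avg (i, s) j u @[j --> \oo])) (cv s) _ => //.
rewrite (_ : (fun j => _) = (fun j => avg (i, rcons s false) j u + avg (i, rcons s true) j u)).
  by apply: cvgD; exact: cv.
apply/funext => j; rewrite /avg -mulrDr -big_split/=; congr (_ * _).
apply: eq_bigr => a _; rewrite /xi !indicE /=.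
set b := pbit _ _ _ _ _.
have e w : (b \in cyl w) = (mkseq b (size w) == w).
  by apply/idP/eqP; rewrite inE.
rewrite !e !size_rcons !mkseqS !eqseq_rcons.
by case: (_ == s); rewrite /= ?addr0//; case: (b _); rewrite ?addr0 ?add0r.
Qed.

(* The directing random measure of the exchangeable particles started from y i. *)
Definition emp i (u : Om) : PP R M := wmeas dd lM (fun s => lfreq (i, s) u).

Lemma measurable_emp i : measurable_fun setT (emp i).
Proof. by apply: (measurable_wmeas dd lM bV) => s; exact: (bm_lfreq (i, s)).1. Qed.

Let kap i (u : Om) : probability Bits R := weights_prob (fix_weights (fun s => lfreq (i, s) u)).

Let pfam_kap i : pfam (kap i).
Proof. by apply: pfam_weights_prob => s; exact: (bm_lfreq (i, s)).1. Qed.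

Let kap_cyl : {ae leb, forall u, forall i s, kap i u (cyl s) = (lfreq (i, s) u)%:E}.
Proof.
apply: filterS lfreq_weights => u hu i s.
rewrite /kap (weights_prob_cyl _ (fix_weightsP _)).
by rewrite /fix_weights asboolT.
Qed.

Let undecodable : set Bits := [set b | code d (decode d b) != b].

Let measurable_undecodable : measurable undecodable.
Proof.
rewrite (_ : undecodable = \bigcup_n ([set b : Bits | code d (decode d b) n = true] `&` [set b | b n = false]
   `|` ([set b : Bits | code d (decode d b) n = false] `&` [set b | b n = true]))).
  have mcd := measurableT_comp (measurable_code dd) (measurable_decode dd lM).
  have m1 n b : measurable [set c0 : Bits | code d (decode d c0) n = b].
    have := mcd measurableT _ (@measurable_bit n b).
    by rewrite setTI.
  apply: bigcupT_measurable => n; apply: measurableU.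
    exact: (measurableI _ _ (m1 n true) (@measurable_bit n false)).
  exact: (measurableI _ _ (m1 n false) (@measurable_bit n true)).
apply/seteqP; split => b /=.
  move=> /eqP hb.
  have /existsNP[n hn] : ~ forall n, code d (decode d b) n = b n.
    by move=> h; apply: hb; apply/funext.
  exists n => //=; move: hn; case: (b n); case: (code _ _ _) => //; first by right.
  by left.
move=> [n _ /= hn]; apply/eqP => h; rewrite h in hn.
by case: hn => -[->].
Qed.

(** Averaged over u, [kap i u] is the law of the code of one particle started from [y i], which
    charges only codes of points; a nonnegative variable of mean 0 vanishes almost surely. *)
Let kap_undecodable i : {ae leb, forall u, fine (kap i u undecodable) = 0}.
Proof.
pose Q1 : probability Bits R := push (Q (fun _ : 'I_1 => y i))
  (measurableT_comp (measurable_code dd) (@measurable_proj _ _ 1 ord0)).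
have h A : measurable A -> mixture leb (pfam_kap i) A = Q1 A.
  apply: bits_measure_unique => s.
  have mC := measurable_cyl s.
  rewrite -(prob_fineK (mixture leb (pfam_kap i)) mC) -(prob_fineK Q1 mC); congr EFin.
  rewrite mixture_fine//.
  transitivity (\int[leb]_u (\prod_(p <- [::]) xi p.1 p.2 u * \prod_(p <- [:: (i, s)]) lfreq p u)).
    apply: exp_ae_eq.
    - exact: (pfam_bm (pfam_kap i) mC).
    - apply: bmM.
        by apply: (@bm_prod _ _ _ _ _ (fun q => xi q.1 q.2)) => q; exact: bm_xi.
      by apply: bm_prod => q; exact: bm_lfreq.
    - by apply: filterS kap_cyl => u /(_ i s) ->; rewrite big_nil mul1r big_seq1.
  rewrite lfreq_moments// /qlist /qq /=.
  congr (fine _).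
  rewrite -[RHS]/(Q (fun=> y i) [set x | cyl s (code d (x ord0))]).
  rewrite (_ : (fun l : 'I_1 => y (nth dflt [:: (i, s)] l).1) = (fun=> y i)); last first.
    by apply/funext => l; rewrite ord1.
  congr (Q _ _); apply/seteqP; split => x.
    by move=> /(_ ord0).
  by move=> hx l; rewrite ord1.
suff e0 : \int[leb]_u fine (kap i u undecodable) = 0.
  have b0 := pfam_bm (@pfam_kap i) measurable_undecodable.
  exact: (ae_exp0 b0 (fun u => prob_fine_ge0 _ _) e0).
rewrite -(mixture_fine leb (pfam_kap i) measurable_undecodable) h// pushE.
rewrite (_ : _ @^-1` _ = set0) ?measure0//.
by apply/seteqP; split => // x; rewrite /preimage/undecodable/= codeK// eqxx.
Qed.

(** Decoding and coding again alters a sequence only on the null set [undecodable], so the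
    frequencies survive as masses. *)
Let emp_code : {ae leb, forall u, forall i s,
  fine (prob_of (emp i u) (code d @^-1` cyl s)) = lfreq (i, s) u}.
Proof.
have hu : {ae leb, forall u, forall i, fine (kap i u undecodable) = 0}.
  by apply: (@ae_countable _ _ _ leb nat (fun i u => fine (kap i u undecodable) = 0)) => i; exact: kap_undecodable.
apply: filterS2 kap_cyl hu => u h1 h2 i s.
rewrite (_ : prob_of (emp i u) (code d @^-1` cyl s) =
   kap i u (decode d @^-1` (code d @^-1` cyl s)))//.
have mA : measurable (decode d @^-1` (code d @^-1` cyl s)).
  have mcd := measurableT_comp (measurable_code dd) (measurable_decode dd lM).
  by have := mcd measurableT _ (measurable_cyl s); rewrite setTI.
have mU := measurable_undecodable.
have z0 B : measurable B -> kap i u (B `&` undecodable) = 0%E.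
  move=> mB; apply/eqP; rewrite eq_le measure_ge0 andbT.
  rewrite -[leRHS]/((0 : R)%:E) -(h2 i) prob_fineK//.
  by apply: le_measure => //; rewrite inE//; exact: measurableI.
have mC := measurable_cyl s.
have e B : measurable B -> kap i u B = kap i u (B `\` undecodable).
  by move=> mB; rewrite (measureDI (kap i u) mB mU) [X in (_ + X)%E](z0 _ mB) adde0.
transitivity (fine (kap i u (cyl s))); last by rewrite h1.
congr fine; rewrite e// [RHS]e//; congr (kap i u _).
by apply/seteqP; split => b [hb /negP]; rewrite /undecodable /= negbK => /eqP hb';
  split => //=; try (by apply/negP; rewrite negbK hb'); move: hb; rewrite /preimage /= hb'.
Qed.

(** Limiting frequencies are known on cylinders only, so laws on powers are compared on boxes of
    coded cylinders. *)
Let code_boxes n : set (set (borel (power M n))) :=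
  [set B | exists C : 'I_n -> set Bits, (forall i, cylinders (C i)) /\
     B = box (fun i => code d @^-1` C i)].

Let code_boxesI n : setI_closed (@code_boxes n).
Proof.
move=> _ _ [A [mA ->]] [B [mB ->]]; exists (fun i => A i `&` B i); split.
  by move=> i; exact: cylindersI.
apply/seteqP; split => x; first by move=> [h h'] i; split; [exact: h|exact: h'].
by move=> h; split => i; [exact: (h i).1|exact: (h i).2].
Qed.

Let measurable_code_cyl (C : set Bits) : cylinders C -> measurable (code d @^-1` C).
Proof.
move=> cC; rewrite -[X in measurable X]setTI; apply: (measurable_code dd) => //.
exact: sub_sigma_algebra.
Qed.

Let measurable_of_code e (T : measurableType e) n (f : T -> borel (power M n)) :
  (forall i C, cylinders C -> measurable [set t | C (code d (f t i))]) -> measurable_fun setT f.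
Proof.
move=> h; apply: (measurable_fun_power dd) => i.
have hc : measurable_fun setT (fun t => code d (f t i)).
  apply: (@measurability _ _ T Bits setT _ cylinders erefl).
  by move=> _ [C cC <-]; rewrite setTI; exact: h.
rewrite (_ : (fun t => f t i) = decode d \o (fun t => code d (f t i))).
  exact: (measurableT_comp (measurable_decode dd lM) hc).
by apply/funext => t /=; rewrite codeK.
Qed.

Let code_boxes_sigma n : @measurable _ (borel (power M n)) = <<s @code_boxes n >>.
Proof.
apply/seteqP; split; last first.
  apply: smallest_sub; first exact: smallest_sigma_algebra.
  by move=> _ [A [mA ->]]; apply: measurable_box => i; exact: measurable_code_cyl.
(* The identity is measurable from the field of code boxes: it contains the codes of the
   coordinates, and [decode] recovers the coordinates from them. *)
have h := @measurable_of_code _ (g_sigma_algebraType (@code_boxes n)) n (fun x => x).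
suff /h mid : forall i C, cylinders C -> <<s @code_boxes n >> [set x | C (code d (x i))].
  by move=> B mB; have := mid measurableT B mB; rewrite setTI.
move=> i C cC; apply: sub_sigma_algebra.
exists (fun j => if j == i then C else setT); split.
  move=> j; case: ifP => // _; right; exists [::].
  by apply/seteqP; split.
apply/seteqP; split => x; last by move=> /(_ i); rewrite eqxx.
by rewrite /box/= => hx j; case: eqP => [->|].
Qed.

Lemma pfam_emp_prod n (i : 'I_n -> nat) :
  pfam (fun u => pprod dd (fun l => prob_of (emp (i l) u))).
Proof. by apply: pfam_pprod => l; exact: (pfam_PP bV (measurable_emp (i l))). Qed.

(** On code boxes this is [lfreq_moments] with every particle replaced by its frequency. The map i
    need not be injective. *)
Lemma emp_law n (i : 'I_n -> nat) B : (0 < n)%N -> measurable B ->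
  Q (fun l => y (i l)) B = mixture leb (pfam_emp_prod i) B.
Proof.
move=> n0; apply: (prob_unique (@code_boxes_sigma n) (@code_boxesI n)) => _ [C [cC ->]].
have mC l := measurable_code_cyl (cC l).
have mB : measurable (box (fun l => code d @^-1` C l)) := measurable_box mC.
have [[l Cl]|hC] := pselect (exists l, C l = set0).
  rewrite (_ : box _ = set0) ?measure0//.
  by apply/seteqP; split => // x /(_ l); rewrite /= Cl.
have /choice[s sE] : forall l, exists s, C l = cyl s.
  by move=> l; case: (cC l) => [Cl|//]; exfalso; apply: hC; exists l.
rewrite -(prob_fineK (Q _) mB) -(prob_fineK (mixture _ _) mB); congr EFin.
rewrite mixture_fine//.
pose L := [seq (i l, s l) | l <- enum 'I_n].
have sL : size L = n by rewrite size_map size_enum_ord.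
have nL (l : 'I_n) : nth dflt L l = (i l, s l).
  by rewrite (nth_map l) ?size_enum_ord// nth_ord_enum.
transitivity (qlist L).
  rewrite /qlist sL /qq; congr (fine (Q _ _)).
    by apply/funext => l; rewrite nL.
  rewrite (_ : (fun l : 'I_n => code d @^-1` cyl (nth dflt L l).2) =
               (fun l => code d @^-1` C l))//.
  by apply/funext => l; rewrite nL sE.
rewrite -[L]cat0s -[[::]]/([seq p.1 | p <- [::] : seq ((nat * seq bool) * nat)]).
rewrite -lfreq_moments ?sL//; apply: exp_ae_eq.
- apply: bmM.
    by apply: (@bm_prod _ _ _ _ _ (fun q => xi q.1 q.2)) => q; exact: bm_xi.
  by apply: bm_prod => q; exact: bm_lfreq.
- exact: (pfam_bm (pfam_emp_prod i) mB).
- apply: filterS emp_code => u hu; rewrite big_nil mul1r /L big_map big_enum.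
  by rewrite [RHS]pprod_box//; apply: eq_bigr => l _; rewrite sE hu.
Qed.

End empirical_measures.

(** * Feller transition functions *)

Section vanishing_at_infinity.
Context {R : realType} {X : ptopologicalType}.
Implicit Types f : X -> R.

Lemma C0P f : C0 f <-> continuous f /\
  forall e, 0 < e -> exists2 C, compact C & forall x, ~ C x -> `|f x| < e.
Proof.
split=> -[cf hf]; split=> //.
  move=> e e0; have [C cC hC] := hf (ball 0 e) (nbhsx_ballx _ _ e0).
  exists C => // x Cx; have := hC x Cx.
  by rewrite /preimage/= -ball_normE/= sub0r normrN.
move=> U /nbhs_ballP[e e0 eU]; have [C cC hC] := hf e e0.
exists C => // x Cx; apply: eU; rewrite -ball_normE/= sub0r normrN.
exact: hC.
Qed.

Lemma C0_bounded f : C0 f -> exists2 b, 0 < b & forall x, `|f x| <= b.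
Proof.
move=> /C0P[cf /(_ 1 ltr01)[C cC hC]].
have cfC : compact (f @` C).
  by apply: continuous_compact => //; exact: continuous_subspaceT.
have [N [_ hN]] := compact_bounded cfC.
exists (`|N| + 1) => [|x]; first by rewrite ltr_wpDl.
have [Cx|Cx] := pselect (C x).
  apply: hN; last by exists x.
  by rewrite (le_lt_trans (ler_norm _))// ltrDl.
by rewrite (le_trans (ltW (hC _ Cx)))// lerDr.
Qed.

Lemma bm_C0 f : C0 f -> bm (f : borel X -> R).
Proof.
move=> C0f; split; first by apply: continuous_measurable_real; exact: C0f.1.
by have [b _ hb] := C0_bounded C0f; exists b.
Qed.

End vanishing_at_infinity.

Section feller_families.
Context {R : realType} {X : ptopologicalType}.
Variable P : R -> R.-pker (borel X) ~> (borel X).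
Hypothesis fP : feller P.

Lemma feller0 (f : X -> R) x : bm (f : borel X -> R) -> \int[P 0 x]_y f y = f x.
Proof.
move=> bf; have [h _ _ _] := fP.
rewrite -[LHS]/(\int[kprob (P 0) x]_y f y).
rewrite (@exp_same _ _ _ (kprob (P 0) x) (\d_x : probability (borel X) R)) //.
  by rewrite /Rintegral integral_dirac ?diracT ?mul1e//; apply/measurable_EFinP; exact: bf.1.
exact: h.
Qed.

Lemma fellerD s t (f : X -> R) x : 0 <= s -> 0 <= t -> bm (f : borel X -> R) ->
  \int[P (s + t) x]_y f y = \int[P s x]_y \int[P t y]_z f z.
Proof.
move=> s0 t0 bf; have [_ h _ _] := fP.
rewrite -[LHS]/(\int[kprob (P (s + t)) x]_y f y).
transitivity (\int[mixture (kprob (P s) x) (pfam_kprob (P t))]_y f y); last first.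
  exact: exp_mixture.
apply: exp_same => // B mB.
by rewrite [LHS]h.
Qed.

Lemma feller_small (f : X -> R) e : C0 f -> 0 < e ->
  exists2 d, 0 < d & forall t x, 0 <= t < d -> `|\int[P t x]_y f y - f x| <= e.
Proof.
move=> C0f e0; have [_ _ _ /(_ f C0f) h] := fP.
have ne : nbhs (0 : \bar R)%E [set u | (u < e%:E)%E].
  by apply: open_nbhs_nbhs; split; [exact: open_ereal_lt_ereal|rewrite /= lte_fin].
have /= [d d0 hd] := h _ ne.
exists d => // t x /andP[]; rewrite le_eqVlt => /orP[/eqP <- _|t0 td].
  by rewrite feller0 ?subrr ?normr0 ?ltW//; exact: bm_C0.
have := hd t; rewrite /= sub0r normrN gtr0_norm// => /(_ td t0) /ltW.
rewrite -lee_fin; apply: le_trans; apply: ereal_sup_ubound.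
by exists x.
Qed.

(** Writing t = k h + s with s < h, the difference between P_t f and P_(kh) f is P_(kh) (P_s f - f),
    uniformly small; continuity at the finitely many grid times then suffices. *)
Lemma feller_equicontinuous (f : X -> R) T e x : C0 f -> 0 < e ->
  \forall y \near x, forall t, 0 <= t <= T -> `|\int[P t y]_z f z - \int[P t x]_z f z| <= e.
Proof.
move=> C0f e0; have bf := bm_C0 C0f.
have [d d0 hd] := feller_small C0f (divr_gt0 e0 (ltr0n R 3)).
pose h := d / 2; have h0 : 0 < h by rewrite divr_gt0.
pose N := Num.truncn (T / h).
have near_grid (k : 'I_N.+1) : \forall y \near x,
    `|\int[P (k%:R * h) y]_z f z - \int[P (k%:R * h) x]_z f z| <= e / 3.
  have kh : 0 <= k%:R * h by rewrite mulr_ge0// ltW.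
  have [_ _ /(_ _ kh f C0f)[cPf _] _] := fP.
  have e3 : 0 < e / 3 by rewrite divr_gt0.
  have /cvgrPdist_le/(_ _ e3) := cPf x.
  by apply: filterS => y; rewrite distrC.
have : \forall y \near x, forall k : 'I_N.+1,
    `|\int[P (k%:R * h) y]_z f z - \int[P (k%:R * h) x]_z f z| <= e / 3.
  exact: filter_forall.
apply: filterS => y hy t /andP[t0 tT].
pose k := Num.truncn (t / h).
have th0 : 0 <= t / h by rewrite divr_ge0// ltW.
have /andP[kt tk] := truncn_itv th0.
have kN : (k < N.+1)%N by rewrite ltnS; apply: le_truncn; rewrite ler_pM2r// invr_gt0.
have khge : 0 <= k%:R * h by rewrite mulr_ge0// ltW.
pose s := t - k%:R * h.
have s0 : 0 <= s by rewrite subr_ge0 -ler_pdivlMr.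
have sd : s < d.
  rewrite (@lt_trans _ _ h)//; last by rewrite ltr_pdivrMr// ltr_pMr// ltr1n.
  by move: tk; rewrite ltr_pdivrMr// -natr1 mulrDl mul1r /s ltrBlDl.
have step z : `|\int[P t z]_w f w - \int[P (k%:R * h) z]_w f w| <= e / 3.
  have bPs : bm (fun w : borel X => \int[P s w]_u f u) := pfam_exp (pfam_kprob (P s)) bf.
  rewrite (_ : t = k%:R * h + s); last by rewrite /s addrC subrK.
  rewrite fellerD// -(expB (kprob (P (k%:R * h)) z) bPs bf).
  apply: exp_le_bound => [|w]; first exact: bmB.
  by apply: hd; rewrite s0.
have h1 := step y; have h2 := step x; have h3 := hy (Ordinal kN).
rewrite (_ : e = e / 3 + e / 3 + e / 3); last by field.
rewrite (_ : _ - _ = (\int[P t y]_w f w - \int[P (k%:R * h) y]_w f w) +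
  (\int[P (k%:R * h) y]_w f w - \int[P (k%:R * h) x]_w f w) -
  (\int[P t x]_w f w - \int[P (k%:R * h) x]_w f w)); last by ring.
by rewrite (le_trans (ler_normB _ _))// lerD// (le_trans (ler_normD _ _))// lerD.
Qed.

End feller_families.

(** * Tensor squares and compactly supported cutoffs *)

Section tensor_squares.
Context {R : realType} {M : pmetricType R}.

Lemma continuous_to_power (T : topologicalType) n (h : T -> power M n) :
  (forall i, continuous (fun t => h t i)) -> continuous h.
Proof.
move=> ch t U; rewrite nbhsE => -[V [oV Vh] VU].
have [e e0 he] := open_power_ball oV Vh.
have : \forall t' \near t, forall i, ball (h t i) e (h t' i).
  apply: filter_forall => i; have := ch i t; apply; exact: nbhsx_ballx.
by apply: filterS => t' ht'; apply: VU; apply: he.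
Qed.

Definition pair2 (x y : M) : power M 2 := fun i => if i == ord0 then x else y.

Definition tensor2 (f : M -> R) (z : power M 2) : R := f (z ord0) * f (z ord_max).

Lemma continuous_pair2l y : continuous (fun x => pair2 x y).
Proof.
apply: continuous_to_power => i x; rewrite /pair2; case: (i == ord0); [exact: cvg_id|exact: cvg_cst].
Qed.

Lemma continuous_pair2r x : continuous (pair2 x).
Proof.
apply: continuous_to_power => i y; rewrite /pair2; case: (i == ord0); [exact: cvg_cst|exact: cvg_id].
Qed.

Lemma continuous_diag2 : continuous (fun x => pair2 x x).
Proof.
apply: continuous_to_power => i x; rewrite /pair2; case: (i == ord0); exact: cvg_id.
Qed.

Lemma C0_tensor2 f : C0 f -> C0 (tensor2 f).
Proof.
move=> C0f; have [b b0 fb] := C0_bounded C0f.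
have /C0P[cf hf] := C0f; apply/C0P; split.
  move=> z; apply: cvgM; (apply: continuous_comp; [exact: proj_continuous|exact: cf]).
move=> e e0; have [C cC hC] := hf (e / b) (divr_gt0 e0 b0).
exists [set z : power M 2 | forall i, C (z i)].
  exact: (@tychonoff _ (fun _ : 'I_2 => M) (fun=> C)).
move=> z /existsNP[i Ci]; rewrite /tensor2 normrM.
have hi := hC _ Ci.
have -> : e = e / b * b by rewrite divfK// gt_eqF.
have [i0|i0] := eqVneq i ord0.
  rewrite i0 in hi; apply: le_lt_trans (_ : `|f (z ord0)| * b < _).
    by rewrite ler_wpM2l.
  by rewrite ltr_pM2r.
have i1 : i = ord_max.
  by apply: val_inj; case: i i0 {Ci hi} => -[|[|//]] //= ?; rewrite -val_eqE.
rewrite i1 in hi; rewrite mulrC; apply: le_lt_trans (_ : `|f (z ord_max)| * b < _).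
  by rewrite ler_wpM2l.
by rewrite ltr_pM2r.
Qed.

Lemma compact_base (d : nat -> M) :
  dense_seq d -> locally_compact [set: M] ->
  exists c r, base_seq (@bal R M c r) /\ forall n, compact (closure (bal c r n)).
Proof.
move=> dd lM.
pose mk (n : nat) : nat * nat := odflt (0, 0)%N (unpickle n).
pose c n := d (mk n).1.
(* Balls without compact closure get radius 0 and become empty; local compactness leaves enough
   small balls for a base. *)
pose r n : R := if `[< compact (closure (ball (c n) ((mk n).2.+1%:R^-1 : R))) >]
  then (mk n).2.+1%:R^-1 else 0.
exists c, r; split=> [|n].
  split=> [n|U x oU Ux]; first exact: open_mdist_ball.
  have [e e0 cU] := locally_compact_ball lM x.
  have [e' e'0 eU] := open_ballP oU Ux.
  have m0 : 0 < Num.min e e' by rewrite lt_min e0.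
  have [m [k [mx [mk' _]]]] := dense_ball dd x m0.
  have ck : compact (closure (ball (d m) (k.+1%:R^-1 : R))).
    apply: subclosed_compact cU _; first exact: closed_closure.
    apply: closure_subset => z /mk' /ball_mdist hz; apply/ball_mdist.
    by rewrite (lt_le_trans hz)// ge_min lexx.
  exists (pickle (m, k)); rewrite /bal /r /c /mk pickleK/= asboolT// => z /mk' /ball_mdist hz.
  by apply: eU; apply/ball_mdist; rewrite (lt_le_trans hz)// ge_min lexx orbT.
rewrite /bal /r; case: asboolP => // _.
rewrite (_ : ball _ _ = set0) ?closure0; first exact: compact0.
by apply/seteqP; split => // z /ball_mdist; rewrite ltNge mdist_ge0.
Qed.

Variables (c : nat -> M) (r : nat -> R).
Hypothesis cV : forall n, compact (closure (bal c r n)).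

Lemma C0_phi n s k : C0 (phi c r (n :: s) k).
Proof.
apply/C0P; split; first exact: phi_continuous.
move=> e e0; exists (closure (bal c r n)) => // x hx.
rewrite phi_eq0 ?normr0// => /(_ n); rewrite mem_head => /(_ erefl) hn.
by apply: hx; exact: subset_closure.
Qed.

End tensor_squares.

(** * Laws of kernels matching the transition functions *)

Lemma measurable_fun_cases d d' (T : measurableType d) (T' : measurableType d') (f : T -> T')
    (D : nat -> set T) (g : nat -> T -> T') :
  (forall n, measurable (D n)) -> (forall t, exists n, D n t) ->
  (forall n, measurable_fun setT (g n)) -> (forall n t, D n t -> f t = g n t) ->
  measurable_fun setT f.
Proof.
move=> mD D1 mg fg _ A mA; rewrite setTI.
rewrite (_ : f @^-1` A = \bigcup_n (D n `&` g n @^-1` A)).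
  apply: bigcupT_measurable => n; apply: measurableI => //.
  by have := mg n measurableT _ mA; rewrite setTI.
apply/seteqP; split => t.
  by have [n Dn] := D1 t; rewrite /preimage/= (fg n t Dn) => At; exists n.
by move=> [n _ [Dn]]; rewrite /preimage/= (fg n t Dn).
Qed.

Section countable_modification.
Context {R : realType} {M : pmetricType R}.

Lemma measurable_singleton (a : M) : measurable ([set a] : set (borel M)).
Proof.
rewrite -[X in measurable X]setCK; apply: measurableC; apply: open_measurable_borel.
by apply: closed_openC; apply: accessible_closed_set1; apply: hausdorff_accessible; exact: metric_hausdorff.
Qed.

Lemma measurable_range (y : nat -> M) : measurable (range y : set (borel M)).
Proof.
rewrite (_ : range y = \bigcup_n [set y n]).
  by apply: bigcupT_measurable => n; exact: measurable_singleton.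
by apply/seteqP; split => x [n _ h]; exists n.
Qed.

Lemma measurable_off_range d (T : measurableType d) (y : nat -> M) (f : M -> T) a :
  (forall x, ~ range y x -> f x = a) -> measurable_fun setT (f : borel M -> T).
Proof.
move=> fa; apply: (@measurable_fun_cases _ _ (borel M) T _
  (fun n => if n is i.+1 then [set y i] else ~` range y)
  (fun n => if n is i.+1 then fun=> f (y i) else fun=> a)).
- move=> [|i]; last exact: measurable_singleton.
  by apply: measurableC; exact: measurable_range.
- move=> x; have [[i _ <-]|h] := pselect (range y x); first by exists i.+1.
  by exists 0%N.
- by move=> [|i]; exact: measurable_cst.
- by move=> [|i] x; [exact: fa|move=> ->].
Qed.

End countable_modification.

Section matching.
Context {R : realType} {M : pmetricType R}.
Variable d : nat -> M.
Hypothesis dd : dense_seq d.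
Variables (c : nat -> M) (r : nat -> R).
Hypothesis bV : base_seq (bal c r).
Variable P : forall n, R -> R.-pker (borel (power M n)) ~> (borel (power M n)).

Lemma pprod_same n (mu mu' : 'I_n -> probability (borel M) R) :
  (forall i, same_measure (mu i) (mu' i)) -> same_measure (pprod dd mu) (pprod dd mu').
Proof.
move=> h B; apply: (prob_unique (@boxes_sigma _ _ d dd n) (@boxesI _ _ n)) => _ [A [mA ->]].
have mB : measurable (box A) := measurable_box mA.
rewrite -(prob_fineK (pprod dd mu) mB) -(prob_fineK (pprod dd mu') mB); congr EFin.
by rewrite !pprod_box//; apply: eq_bigr => i _; rewrite h.
Qed.

Lemma pfam_prod_kmeas n (x : power M n) :
  pfam (fun K : EE R M => pprod dd (fun i => kmeas K (x i))).
Proof. by apply: pfam_pprod => i; exact: (pfam_kmeas bV). Qed.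

Lemma bm_kact (f : M -> R) x : bm (f : borel M -> R) -> bm (fun K : EE R M => kact K f x).
Proof. by move=> bf; exact: (pfam_exp (pfam_kmeas bV x) bf). Qed.

(** D is a parameter because laws are first found for countable sets, compared on a common subset,
    and only then extended to all of M. *)
Definition matches (t : R) (nu : probability (EE R M) R) (D : set M) : Prop :=
  forall n (x : power M n), (0 < n)%N -> (forall i, D (x i)) -> forall B, measurable B ->
  fine (P n t x B) = \int[nu]_K fine (pprod dd (fun i => kmeas K (x i)) B).

Lemma matches_boxes t (nu : probability (EE R M) R) (D : set M) :
  (forall n (x : power M n), (0 < n)%N -> (forall i, D (x i)) ->
   forall A : 'I_n -> set (borel M), (forall i, measurable (A i)) ->
   fine (P n t x (box A)) = \int[nu]_K \prod_i fine (kmeas K (x i) (A i))) ->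
  matches t nu D.
Proof.
move=> h n x n0 Dx B mB.
rewrite -[LHS](exp_indic (kprob (P n t) x) mB).
rewrite (@exp_mix _ _ _ _ _ _ _ nu (kprob (P n t) x)
  (@boxes_sigma _ _ d dd n) (@boxesI _ _ n) (pfam_prod_kmeas x)) //; last exact: bm_indic.
  by apply: eq_Rintegral => K _; rewrite exp_indic.
move=> _ [A [mA ->]]; rewrite [LHS]h//.
by apply: eq_Rintegral => K _; rewrite pprod_box.
Qed.

Section matching_measure.
Variables (t : R) (nu : probability (EE R M) R) (D : set M).
Hypothesis mnu : matches t nu D.

Lemma matches_exp n (x : power M n) f : (0 < n)%N -> (forall i, D (x i)) ->
  bm (f : borel (power M n) -> R) ->
  \int[P n t x]_z f z = \int[nu]_K \int[pprod dd (fun i => kmeas K (x i))]_z f z.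
Proof.
move=> n0 Dx bf; have GE : @measurable _ (borel (power M n)) = <<s @measurable _ (borel (power M n)) >>.
  by rewrite (sigma_algebra_id (@sigma_algebra_measurable _ _)).
apply: (@exp_mix _ _ _ _ _ _ _ nu (kprob (P n t) x) GE _ (pfam_prod_kmeas x)) => //.
  exact: measurableI.
by move=> A mA; exact: mnu.
Qed.

Lemma matches_prod n (x : power M n) (f : 'I_n -> M -> R) : (0 < n)%N -> (forall i, D (x i)) ->
  (forall i, bm (f i : borel M -> R)) ->
  \int[P n t x]_z \prod_i f i (z i) = \int[nu]_K \prod_i kact K (f i) (x i).
Proof.
move=> n0 Dx bf; rewrite matches_exp//; last first.
  by apply: (@bm_prod R _ (borel (power M n)) _ _ (fun i z => f i (z i))) => i; exact: bm_proj.
by apply: eq_Rintegral => K _; rewrite exp_pprod.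
Qed.

Lemma matches1 x (f : M -> R) : D x -> bm (f : borel M -> R) ->
  \int[P 1 t (fun=> x)]_z f (z ord0) = \int[nu]_K kact K f x.
Proof.
move=> Dx bf; have := @matches_prod 1 (fun=> x) (fun=> f) isT (fun=> Dx) (fun=> bf).
by under eq_Rintegral do rewrite big_ord1; under [RHS]eq_Rintegral do rewrite big_ord1.
Qed.

Lemma matches2 x y (f : M -> R) : D x -> D y -> bm (f : borel M -> R) ->
  \int[P 2 t (pair2 x y)]_z tensor2 f z = \int[nu]_K (kact K f x * kact K f y).
Proof.
move=> Dx Dy bf.
have D2 i : D (pair2 x y i) by rewrite /pair2; case: ifP.
have := @matches_prod 2 (pair2 x y) (fun=> f) isT D2 (fun=> bf).
have e0 : lift ord0 ord0 = ord_max :> 'I_2 by apply: val_inj.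
under eq_Rintegral do rewrite big_ord_recl big_ord1 e0.
by under [RHS]eq_Rintegral do rewrite big_ord_recl big_ord1.
Qed.

End matching_measure.

(* The expectation of (K f x - K f y) ^ 2 under any matching law of K. *)
Definition gap (f : M -> R) t x y : R :=
  \int[P 2 t (pair2 x x)]_z tensor2 f z - 2 * \int[P 2 t (pair2 x y)]_z tensor2 f z +
  \int[P 2 t (pair2 y y)]_z tensor2 f z.

Lemma matches_gap t (nu : probability (EE R M) R) D f x y : matches t nu D -> D x -> D y -> bm (f : borel M -> R) ->
  gap f t x y = \int[nu]_K ((kact K f x - kact K f y) ^+ 2).
Proof.
move=> mnu Dx Dy bf; have bK z := bm_kact z bf.
have bKK z w : bm (fun K : EE R M => kact K f z * kact K f w) by exact: bmM.
rewrite /gap !(matches2 mnu)// -expZ// -expB//; last exact: bmZ.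
rewrite -expD//; last by apply: bmB => //; exact: bmZ.
by apply: eq_Rintegral => K _; rewrite sqrrB !expr2 mulr_natl.
Qed.

Lemma moments_matches t (nu nu' : probability (EE R M) R) D (l : seq (M * seq nat)) :
  matches t nu D -> matches t nu' D -> all (fun p => `[< D p.1 >]) l ->
  \int[nu]_K \prod_(p <- l) fine (kmeas K p.1 (inter c r p.2)) =
  \int[nu']_K \prod_(p <- l) fine (kmeas K p.1 (inter c r p.2)).
Proof.
(* The empty moment is separate, as matching concerns only n > 0; any other moment is the mass of a
   box under P^(n). *)
move=> mnu mnu' Dl; have [->|l0] := eqVneq l [::].
  by under eq_Rintegral do rewrite big_nil; under [RHS]eq_Rintegral do rewrite big_nil; rewrite !exp_cst.
pose n := size l; have n0 : (0 < n)%N by rewrite lt0n size_eq0.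
pose dp : M * seq nat := (point, [::]).
pose x : power M n := fun i => (nth dp l i).1.
pose A (i : 'I_n) : set (borel M) := inter c r (nth dp l i).2.
have mA i : measurable (A i) by exact: measurable_inter.
have Dx i : D (x i) by have /(all_nthP dp)/(_ i (ltn_ord i))/asboolP := Dl.
have e (m : probability (EE R M) R) : \int[m]_K \prod_(p <- l) fine (kmeas K p.1 (inter c r p.2)) =
    \int[m]_K fine (pprod dd (fun i => kmeas K (x i)) (box A)).
  apply: eq_Rintegral => K _; rewrite pprod_box// (big_nth dp) big_mkord.
  by [].
rewrite !e -mnu//; last exact: measurable_box.
by rewrite -mnu'//; exact: measurable_box.
Qed.

Lemma matches_unique t (nu nu' : probability (EE R M) R) :
  matches t nu setT -> matches t nu' setT -> same_measure nu nu'.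
Proof.
move=> mnu mnu'; apply: (kernel_measure_unique bV) => l.
apply: (moments_matches mnu mnu'); apply/allP => p _; exact/asboolP.
Qed.

End matching.

(** * The measurable presentation *)

Section presentation.
Context {R : realType} {M : pmetricType R}.
Variable d : nat -> M.
Hypothesis dd : dense_seq d.
Hypothesis lM : locally_compact [set: M].
Variables (c : nat -> M) (r : nat -> R).
Hypothesis bV : base_seq (bal c r).
Hypothesis cV : forall n, compact (closure (bal c r n)).
Variable P : forall n, R -> R.-pker (borel (power M n)) ~> (borel (power M n)).
Hypothesis fP : feller (P 2).

Lemma gap_continuous f t y : C0 f -> 0 <= t -> continuous (fun x => gap P f t x y).
Proof.
move=> C0f t0 x; have [_ _ /(_ t t0 _ (C0_tensor2 C0f))[cP _] _] := fP.
apply: cvgD; last exact: cvg_cst.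
apply: cvgB.
  apply: (@continuous_comp _ _ _ (fun x => pair2 x x) (fun z => \int[P 2 t z]_w tensor2 f w));
    [exact: continuous_diag2|exact: cP].
apply: cvgM; first exact: cvg_cst.
apply: (@continuous_comp _ _ _ (fun x => pair2 x y) (fun z => \int[P 2 t z]_w tensor2 f w));
  [exact: continuous_pair2l|exact: cP].
Qed.

(** On the diagonal the three integrals cancel. Near it each is within e / 3 of its diagonal value,
    uniformly in t by equicontinuity, and the coefficients 2 and 1 of the two varying terms add up
    to e. *)
Lemma gap_small f x T e : C0 f -> 0 < e ->
  \forall y \near x, forall t, 0 <= t <= T -> gap P f t x y <= e.
Proof.
move=> C0f e0; have e3 : 0 < e / 3 by rewrite divr_gt0.
have h := feller_equicontinuous fP T (pair2 x x) (C0_tensor2 C0f) e3.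
pose near_pt z := forall t, 0 <= t <= T ->
  `|\int[P 2 t z]_w tensor2 f w - \int[P 2 t (pair2 x x)]_w tensor2 f w| <= e / 3.
have h1 : \forall y \near x, near_pt (pair2 x y) := @continuous_pair2r _ _ x x _ h.
have h2 : \forall y \near x, near_pt (pair2 y y) := @continuous_diag2 _ _ x _ h.
apply: filterS2 h1 h2 => y h1 h2 t tT.
have {}h1 := h1 t tT; have {}h2 := h2 t tT.
move: h1 h2; rewrite !ler_norml /gap => /andP[h1 h1'] /andP[h2 h2'].
by rewrite (_ : e = 3 * (e / 3)); [lra|field].
Qed.

(** Only nonempty lists are enumerated: these cutoffs have compact support, whereas the empty
    product 1 need not vanish at infinity. *)
Definition test (n : nat) : M -> R :=
  let p := odflt ((0%N, [::]), 0%N) (unpickle n) in phi c r (p.1.1 :: p.1.2) p.2.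

Lemma testE a s k : exists n, test n = phi c r (a :: s) k.
Proof. by exists (pickle ((a, s), k)); rewrite /test pickleK. Qed.

Lemma C0_test n : C0 (test n).
Proof. exact: C0_phi. Qed.

Lemma test_norm n x : `|test n x| <= 1.
Proof. exact: phi_norm. Qed.

(** Requiring the bound for a whole interval of times makes the selection independent of t; an
    intersection of closed conditions is closed, so measurability survives the uncountable
    quantifier. *)
Definition clos j m : set M :=
  [set x | forall i t, (i <= j)%N -> 0 <= t <= j%:R -> gap P (test i) t x (d m) <= (4 ^+ j)^-1].

Lemma closed_clos j m : closed (clos j m).
Proof.
rewrite (_ : clos j m = \bigcap_(p in [set p : nat * R | (p.1 <= j)%N /\ 0 <= p.2 <= j%:R])
    [set x | gap P (test p.1) p.2 x (d m) <= (4 ^+ j)^-1]).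
  apply: closed_bigI => -[i t] /= [_ /andP[t0 _]].
  apply: (preimage_closed _ (@closed_le _ _)) => y _.
  exact: gap_continuous (C0_test i) t0 y.
apply/seteqP; split => x; first by move=> h [i t] /= [hi ht]; exact: h.
by move=> h i t hi ht; exact: (h (i, t)).
Qed.

Lemma clos_ex j x : exists m, `[< clos j m x >].
Proof.
have e0 : 0 < (4 ^+ j)^-1 :> R by rewrite invr_gt0 exprn_gt0.
have : \forall y \near x, forall i : 'I_j.+1, forall t, 0 <= t <= j%:R ->
    gap P (test i) t x y <= (4 ^+ j)^-1.
  by apply: filter_forall => i; apply: gap_small => //; exact: C0_test.
move=> /nbhs_ballP[e /= e1 he]; have [m xm] := dd x e1.
exists m; apply/asboolP => i t ij tj.
apply: (he (d m) _ (Ordinal (ij : (i < j.+1)%N))) => //.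
exact/ball_mdist.
Qed.

Definition sel j x : nat := ex_minn (clos_ex j x).

Lemma selP j x : clos j (sel j x) x.
Proof. by rewrite /sel; case: ex_minnP => m /asboolP. Qed.

Lemma measurable_sel j m : measurable ([set x | sel j x = m] : set (borel M)).
Proof.
have mC i : measurable (clos j i : set (borel M)).
  rewrite -[X in measurable X]setCK; apply: measurableC; apply: open_measurable_borel.
  by apply: closed_openC; exact: closed_clos.
rewrite (_ : mkset _ = clos j m `&` \bigcap_(i in [set i | (i < m)%N]) ~` clos j i).
  apply: measurableI => //; apply: fin_bigcap_measurable; first exact: finite_II.
  by move=> i _; exact: measurableC.
apply/seteqP; split => x; rewrite /sel/=; case: ex_minnP => m' /asboolP h1 h2.
  move=> <-; split=> // i im hi; have := h2 i; rewrite leqNgt im /= => h.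
  by have := h (asboolT hi).
move=> [h3 h4]; apply/eqP; rewrite eqn_leq h2 ?asboolT//=.
by rewrite leqNgt; apply/negP => /h4; exact.
Qed.

(* sel j x selects a point of the dense sequence so close to x that, for every
   t <= j, the first test functions differ by at most 4 ^ -j in mean square;
   hence K x is almost surely the weak limit of the K (d (sel j x)). *)
Definition presf (Kx : EE R M * borel M) : PP R M :=
  if `[< range d Kx.2 >] then (Kx.1 : kernels R M) Kx.2
  else wlim dd lM bV (fun j => (Kx.1 : kernels R M) (d (sel j Kx.2))).

Lemma presf_range (K : EE R M) x : range d x -> presf (K, x) = (K : kernels R M) x.
Proof. by move=> h; rewrite /presf asboolT. Qed.

Lemma presf_ext (K L : EE R M) x :
  (forall m, (K : kernels R M) (d m) = (L : kernels R M) (d m)) -> presf (K, x) = presf (L, x).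
Proof.
move=> h; rewrite /presf/=; case: asboolP => [[m _ <-]|_]; first exact: h.
by congr wlim; apply/funext => j; exact: h.
Qed.

Lemma measurable_presf : measurable_fun setT presf.
Proof.
have mev m : measurable_fun setT (fun Kx : EE R M * borel M => (Kx.1 : kernels R M) (d m)).
  exact: (measurableT_comp (measurable_kev (d m)) measurable_fst).
have mpre (A : set (borel M)) : measurable A -> measurable [set Kx : EE R M * borel M | A Kx.2].
  by move=> mA; have := @measurable_snd _ _ (EE R M) (borel M) measurableT A mA; rewrite setTI.
apply: (@measurable_fun_cases _ _ (EE R M * borel M)%type (PP R M) presf
  (fun n => if n is i.+1 then [set Kx | Kx.2 = d i] else [set Kx | ~ range d Kx.2])
  (fun n => if n is i.+1 then fun Kx => (Kx.1 : kernels R M) (d i)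
    else fun Kx => wlim dd lM bV (fun j => (Kx.1 : kernels R M) (d (sel j Kx.2))))).
- move=> [|i]; last exact: (mpre [set d i] (measurable_singleton _)).
  by apply: (mpre (~` range d)); apply: measurableC; exact: measurable_range.
- move=> Kx; have [[i _ h]|h] := pselect (range d Kx.2); last by exists 0%N.
  by exists i.+1 => /=.
- move=> [|i] //; apply: measurable_wlim => j.
  apply: (@measurable_fun_cases _ _ (EE R M * borel M)%type (PP R M) _
    (fun m => [set Kx | sel j Kx.2 = m]) (fun m Kx => (Kx.1 : kernels R M) (d m))) => //.
  + by move=> m; exact: (mpre [set x | sel j x = m] (measurable_sel j m)).
  + by move=> Kx; exists (sel j Kx.2).
  + by move=> m Kx <-.
- move=> [|i] [K x] /=; first by move=> h; rewrite /presf asboolF.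
  by move=> xi; rewrite presf_range xi//; exists i.
Qed.

Lemma measurable_presf2 (x : borel M) : measurable_fun setT (fun K => presf (K, x)).
Proof. exact: (measurableT_comp measurable_presf (measurable_pair2 x)). Qed.

Lemma measurable_presf_section (K : EE R M) :
  measurable_fun setT (fun x : borel M => presf (K, x)).
Proof. exact: (measurableT_comp measurable_presf (measurable_pair1 K)). Qed.

Definition pres (K : EE R M) : EE R M := mk_kernel (measurable_presf_section K).

Lemma presE K x : (pres K : kernels R M) x = presf (K, x).
Proof. by []. Qed.

Lemma kmeas_pres K x : kmeas (pres K) x = prob_of (presf (K, x)).
Proof. by []. Qed.

Lemma pres_idem K : same_kernel (pres (pres K)) (pres K).
Proof.
move=> x B mB; rewrite (kmeas_pres (pres K)) (kmeas_pres K).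
suff -> : presf (pres K, x) = presf (K, x) by [].
by apply: presf_ext => m; rewrite presE presf_range.
Qed.

Lemma measurable_pres : measurable_fun setT pres.
Proof.
by apply: measurable_to_EE => x; exact: measurable_presf2.
Qed.

Lemma pres_ae t nu D x : matches dd P t nu D -> 0 <= t -> range d `<=` D -> D x ->
  {ae nu, forall K, same_measure (kmeas (pres K) x) (kmeas K x)}.
Proof.
move=> mnu t0 dD Dx; have [hx|hx] := pselect (range d x).
  by apply: nearW => K B mB; rewrite kmeas_pres presf_range.
have h i : {ae nu, forall K, kact K (test i) (d (sel j x)) @[j --> \oo] --> kact K (test i) x}.
  have bt : bm (test i : borel M -> R) := bm_C0 (C0_test i).
  (* From J on, both i <= j and t <= j, so the selection bound applies; before J the square is at
     most 4, which the constant [4 * 4 ^+ J] covers. *)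
  pose J := maxn i (Num.truncn t).+1.
  apply: (@ae_cvg_to _ _ _ nu (fun j K => kact K (test i) (d (sel j x))) (fun K => kact K (test i) x) (4 * 4 ^+ J)).
  - by move=> j; exact: (bm_kact bV).
  - exact: (bm_kact bV).
  - move=> j; have [jJ|Jj] := ltnP j J.
      apply: (@le_trans _ _ 4); last first.
        by rewrite -mulrA ler_peMr// ler_pdivlMr ?exprn_gt0// mul1r ler_eXn2l ?ltr1n// ltnW.
      rewrite (le_trans (ler_norm _))//; apply: exp_le_bound.
        by apply: bmX; apply: bmB; exact: (bm_kact bV).
      move=> K; rewrite normrX; apply: (@le_trans _ _ (2 ^+ 2)); last by rewrite -natrX.
      rewrite lerXn2r ?nnegrE// (le_trans (ler_normB _ _))// (_ : 2 = 1 + 1)//.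
      by rewrite lerD//; apply: exp_le_bound => // z; exact: test_norm.
    have -> : \int[nu]_K ((kact K (test i) (d (sel j x)) - kact K (test i) x) ^+ 2) =
        gap P (test i) t x (d (sel j x)).
      have Dd : D (d (sel j x)) by apply: dD; exists (sel j x).
      rewrite (matches_gap bV mnu Dx Dd bt).
      by apply: eq_Rintegral => K _; rewrite -sqrrN opprB.
    apply: (@le_trans _ _ (4 ^+ j)^-1).
      apply: selP; first by rewrite (leq_trans _ Jj)// leq_maxl.
      rewrite t0/= ltW// (lt_le_trans (truncnS_gt t))// ler_nat.
      by rewrite (leq_trans _ Jj)// leq_maxr.
    by rewrite ler_peMl// ?invr_ge0 ?exprn_ge0// -exprS exprn_ege1// ler1n.
have : {ae nu, forall K, forall i, kact K (test i) (d (sel j x)) @[j --> \oo] --> kact K (test i) x}.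
  by apply: (@ae_countable _ _ _ nu nat (fun i K =>
    kact K (test i) (d (sel j x)) @[j --> \oo] --> kact K (test i) x)) => i; exact: h.
apply: filterS => K hK; rewrite kmeas_pres /presf/= asboolF//.
apply: wlim_cvg => -[|a s] k.
  (* The constant cutoff is not among the tests, but its integral is always 1. *)
  rewrite (_ : phi c r [::] k = fun=> 1); last by apply/funext => z; rewrite /phi big_nil.
  under eq_fun do rewrite exp_cst.
  by rewrite exp_cst; exact: cvg_cst.
have [i <-] := testE a s k; exact: hK.
Qed.

End presentation.

(** * Existence of the matching laws *)

Section existence.
Context {R : realType} {M : pmetricType R}.
Variable d : nat -> M.
Hypothesis dd : dense_seq d.
Hypothesis lM : locally_compact [set: M].
Variables (c : nat -> M) (r : nat -> R).
Hypothesis bV : base_seq (bal c r).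
Hypothesis cV : forall n, compact (closure (bal c r n)).
Variable P : forall n, R -> R.-pker (borel (power M n)) ~> (borel (power M n)).
Hypothesis cP : consistent_feller P.

Section kernels_from_sequences.
Variable y : nat -> M.

Definition index_of (x : M) : nat := xget 0%N [set i | y i = x].

Lemma index_ofK x : range y x -> y (index_of x) = x.
Proof. by move=> [i _ h]; exact: (xgetPex 0%N (ex_intro [set i | y i = x] i h)). Qed.

Definition seqf (F : nat -> PP R M) (x : M) : PP R M :=
  if `[< range y x >] then F (index_of x) else point.

Lemma measurable_seqf F : measurable_fun setT (seqf F : borel M -> PP R M).
Proof. by apply: (measurable_off_range (y := y) (a := point)) => x h; rewrite /seqf asboolF. Qed.

Definition seqk (F : nat -> PP R M) : EE R M := mk_kernel (measurable_seqf F).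

Lemma kmeas_seqk F x : range y x -> kmeas (seqk F) x = prob_of (F (index_of x)).
Proof.
by move=> h; rewrite -[LHS]/(prob_of (seqf F x)) /seqf asboolT.
Qed.

Lemma kmeas_seqk_out F x : ~ range y x -> kmeas (seqk F) x = prob_of point.
Proof.
by move=> h; rewrite -[LHS]/(prob_of (seqf F x)) /seqf asboolF.
Qed.

Lemma measurable_seqk e (T : measurableType e) (F : T -> nat -> PP R M) :
  (forall i, measurable_fun setT (F ^~ i)) -> measurable_fun setT (fun t => seqk (F t)).
Proof.
move=> mF; apply: measurable_to_EE => x.
rewrite -[X in measurable_fun _ X]/(fun t => seqf (F t) x) /seqf.
by case: asboolP => _; [exact: mF|exact: measurable_cst].
Qed.

End kernels_from_sequences.

Lemma matches_range t (y : nat -> M) : 0 <= t -> exists nu, matches dd P t nu (range y).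
Proof.
move=> t0; pose Q n (x : power M n) := kprob (P n t) x.
have cQ k n (s : 'I_k -> 'I_n) : (1 <= k)%N -> (k <= n)%N -> injective s ->
  forall (x : power M n) (B : set (borel (power M k))), measurable B ->
  Q n x ((tuple_proj s : borel (power M n) -> borel (power M k)) @^-1` B) = Q k (tuple_proj s x) B.
  by move=> k1 kn si x B mB; exact: (cP.2 k n s k1 kn si x t t0 B mB).
pose F u i := emp dd lM Q y i u.
have mF := measurable_seqk y (fun i => measurable_emp dd lM bV Q y i : measurable_fun setT (F ^~ i)).
exists (push (@ULeb R) mF) => n x n0 yx B mB.
(* A point repeated in y or in x is always read through the same index; [emp_law] permits repeated
   indices. *)
have xE : x = fun l => y (index_of y (x l)) by apply/funext => l; rewrite index_ofK.
rewrite {1}xE -[LHS]/(fine (Q n (fun l => y (index_of y (x l))) B)).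
rewrite (emp_law dd lM bV cQ y (fun l => index_of y (x l)) n0 mB) mixture_fine//.
rewrite exp_push; last exact: (pfam_bm (pfam_prod_kmeas dd bV x) mB).
apply: eq_Rintegral => u _; congr (fine (pprod dd _ B)).
by apply/funext => l; rewrite kmeas_seqk.
Qed.

Hypothesis f2 : feller (P 2).

Local Notation presf := (presf dd lM bV cV f2).
Local Notation pres := (pres dd lM bV cV f2).

(* The presentation only reads K on the range of d, where all matching laws
   agree. *)
Definition restr (K : EE R M) : EE R M := seqk d (fun i => (K : kernels R M) (d i)).

Lemma restrE K m : (restr K : kernels R M) (d m) = (K : kernels R M) (d m).
Proof.
have h : range d (d m) by exists m.
by rewrite -[LHS]/(seqf d _ (d m)) /seqf asboolT// index_ofK.
Qed.

Lemma measurable_restr : measurable_fun setT restr.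
Proof. by apply: measurable_seqk => i; exact: measurable_kev. Qed.

Lemma bm_kmeas_prod (l : seq (M * seq nat)) :
  bm (fun K : EE R M => \prod_(p <- l) fine (kmeas K p.1 (inter c r p.2))).
Proof.
apply: bm_prod => p; apply: pfam_bm; last exact: measurable_inter.
exact: (pfam_kmeas bV).
Qed.

Lemma restr_law t nu nu' D : matches dd P t nu D -> matches dd P t nu' D -> range d `<=` D ->
  same_measure (push nu measurable_restr) (push nu' measurable_restr).
Proof.
move=> mnu mnu' dD; apply: (kernel_measure_unique bV) => l.
rewrite !exp_push; try exact: bm_kmeas_prod.
pose ind (p : M * seq nat) := `[< range d p.1 >].
(* Off the range of d the restricted kernel is a fixed law, so these factors are deterministic and
   common to both sides. *)
pose C : R := \prod_(p <- l | ~~ ind p) fine (prob_of point (inter c r p.2)).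
have e K : \prod_(p <- l) fine (kmeas (restr K) p.1 (inter c r p.2)) =
    C * \prod_(p <- [seq p <- l | ind p]) fine (kmeas K p.1 (inter c r p.2)).
  rewrite (bigID ind) [RHS]mulrC big_filter; congr (_ * _).
    by apply: eq_bigr => p /asboolP h; rewrite /restr kmeas_seqk// index_ofK.
  by apply: eq_bigr => p /asboolPn h; rewrite /restr kmeas_seqk_out.
under eq_Rintegral do rewrite e; under [RHS]eq_Rintegral do rewrite e.
rewrite !expZ; try exact: bm_kmeas_prod.
congr (_ * _); apply: (moments_matches bV mnu mnu').
by apply/allP => p; rewrite mem_filter => /andP[/asboolP h _]; apply/asboolP; exact: dD.
Qed.

Lemma presf_restr K x : presf (restr K, x) = presf (K, x).
Proof. by apply: presf_ext => m; exact: restrE. Qed.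

(** Under an auxiliary law matching on the points of x and of d together, the presentation equals
    the kernel at x almost surely. A function of the presentation depends only on the restriction to
    d, so its expectation is the same under nu. *)
Lemma matches_pres t nu : 0 <= t -> matches dd P t nu (range d) ->
  matches dd P t (push nu (measurable_pres dd lM bV cV f2)) setT.
Proof.
move=> t0 mnu n x n0 _ B mB.
(* The n points of x are placed in front of the sequence d. *)
pose y i : M := if insub i is Some l then x l else d (i - n).
have yd : range d `<=` range y.
  move=> _ [m _ <-]; exists (m + n)%N => //.
  by rewrite /y insubF ?addnK// ltnNge leq_addl.
have yx l : range y (x l) by exists (nat_of_ord l) => //; rewrite /y valK.
have [nu' mnu'] := matches_range y t0.
have mnu'd : matches dd P t nu' (range d).
  by move=> m z m0 dz; apply: mnu' => // l; apply: yd.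
pose G (K : EE R M) := fine (pprod dd (fun l => prob_of (presf (K, x l))) B).
have bG : bm G.
  apply: pfam_bm mB; apply: pfam_pprod => l.
  exact: (pfam_PP bV (measurable_presf2 dd lM bV cV f2 (x l))).
have Gr K : G K = G (restr K).
  have e : (fun l => prob_of (presf (K, x l))) = (fun l => prob_of (presf (restr K, x l))).
    by apply/funext => l; rewrite (presf_restr K).
  exact: (congr1 (fun mu => fine (pprod dd mu B)) e).
have bK : bm (fun K : EE R M => fine (pprod dd (fun l => kmeas K (x l)) B)).
  exact: (pfam_bm (pfam_prod_kmeas dd bV x) mB).
rewrite exp_push//.
transitivity (\int[nu]_K G K); last by [].
rewrite mnu'//.
transitivity (\int[nu']_K G K).
  apply: exp_ae_eq => //.
  have : {ae nu', forall K, forall l : 'I_n, same_measure (kmeas (pres K) (x l)) (kmeas K (x l))}.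
    apply: (@ae_countable _ _ _ nu' 'I_n (fun l K =>
      same_measure (kmeas (pres K) (x l)) (kmeas K (x l)))) => l.
    have hl := @pres_ae _ _ _ dd lM _ _ bV cV _ f2 t nu' (range y) (x l) mnu' t0 yd (yx l).
    exact: hl.
  by apply: filterS => K hK; rewrite /G (pprod_same dd hK).
under eq_Rintegral do rewrite Gr; under [RHS]eq_Rintegral do rewrite Gr.
rewrite -(exp_push _ measurable_restr bG) -[RHS](exp_push _ measurable_restr bG).
by apply: exp_same => //; exact: (restr_law mnu'd mnu).
Qed.

Lemma matches_setT t : 0 <= t -> exists nu, matches dd P t nu setT.
Proof.
move=> t0; have [nu mnu] := matches_range d t0.
by exists (push nu (measurable_pres dd lM bV cV f2)); exact: matches_pres.
Qed.

Lemma matches_presentation t nu : 0 <= t -> matches dd P t nu setT ->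
  measurable_presentation nu pres.
Proof.
move=> t0 mnu; split; first exact: (measurable_presf dd lM bV cV f2).
move=> x; have hx := @pres_ae _ _ _ dd lM _ _ bV cV _ f2 t nu setT x mnu t0 (@subsetT _ _) I.
exact: hx.
Qed.

End existence.

(** * Convolutions *)

Section convolutions.
Context {R : realType} {M : pmetricType R}.
Variable d : nat -> M.
Hypothesis dd : dense_seq d.
Variables (c : nat -> M) (r : nat -> R).
Hypothesis bV : base_seq (bal c r).
Variable P : forall n, R -> R.-pker (borel (power M n)) ~> (borel (power M n)).
Hypothesis cP : consistent_feller P.
Variable q : EE R M -> EE R M.
Hypothesis mq : measurable_fun [set: EE R M * borel M]
  (fun Kx : EE R M * borel M => (q Kx.1 : kernels R M) Kx.2).

Let pfam_q e (T : measurableType e) (f : T -> EE R M) (g : T -> borel M) :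
  measurable_fun setT f -> measurable_fun setT g -> pfam (fun t => kmeas (q (f t)) (g t)).
Proof.
move=> mf mg; have mfg : measurable_fun setT (fun t => (f t, g t)) by exact: measurable_fun_pair.
exact: (pfam_PP bV (measurableT_comp mq mfg)).
Qed.

Lemma kernel_comp_fine (K L : EE R M) x B : measurable B ->
  fine (kmeas (kernel_comp K L) x B) = \int[kmeas K x]_y fine (kmeas L y B).
Proof.
move=> mB; rewrite (kernel_compP bV K L x mB); congr fine.
by apply: eq_integral => y _; rewrite prob_fineK.
Qed.

Lemma measurable_conv :
  measurable_fun setT (fun K : EE R M * EE R M => kernel_comp K.1 (q K.2)).
Proof.
apply: measurable_to_EE => x; apply: (measurable_to_PP bV) => B mB.
pose F (K : EE R M * EE R M) := kmeas K.1 x.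
pose f (Ky : (EE R M * EE R M) * borel M) := fine (kmeas (q Ky.1.2) Ky.2 B).
rewrite (_ : (fun K => _) = (fun K => (\int[F K]_y f (K, y))%:E)).
  apply/measurable_EFinP.
  have pF : pfam F.
    exact: (pfam_PP bV (measurableT_comp (measurable_kev x) measurable_fst)).
  have bf : bm f.
    apply: pfam_bm mB; apply: pfam_q; last exact: measurable_snd.
    exact: (measurableT_comp measurable_snd measurable_fst).
  exact: (pfam_exp2 pF bf).1.
apply/funext => -[K L]; rewrite -[LHS](prob_fineK (kmeas (kernel_comp K (q L)) x) mB).
by rewrite kernel_comp_fine.
Qed.

Lemma matches_convolution t s (nu1 nu2 : probability (EE R M) R) : 0 <= t -> 0 <= s ->
  matches dd P t nu1 setT -> matches dd P s nu2 setT -> measurable_presentation nu2 q ->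
  matches dd P (t + s) (push (nu1 \x nu2)%E measurable_conv) setT.
Proof.
move=> t0 s0 m1 m2 [_ aeq]; apply: (@matches_boxes _ _ d dd c r bV P (t + s)) => n x n0 _ A mA.
have mB : measurable (box A) := measurable_box mA.
have [_ CK _ _] := cP.1 n n0.
pose H (zL : borel (power M n) * EE R M) := \prod_i fine (kmeas (q zL.2) (zL.1 i) (A i)).
have bH : bm H.
  apply: (@bm_prod _ _ (borel (power M n) * EE R M)%type _ _
    (fun i zL => fine (kmeas (q zL.2) (zL.1 i) (A i)))) => i.
  apply: pfam_bm (mA i); apply: pfam_q; first exact: measurable_snd.
  exact: (measurableT_comp (measurable_proj i) measurable_fst).
transitivity (\int[P n t x]_z \int[nu2]_L H (z, L)).
  rewrite CK//; congr fine; apply: eq_integral => z _.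
  rewrite -[LHS](prob_fineK (kprob (P n s) z) mB); congr EFin.
  rewrite [LHS](m2 n z n0 (fun=> I) _ mB).
  (* Passing from L to [q L] is harmless at the finitely many points [z i] and gives the joint
     measurability in (z, L) that Fubini requires. *)
  apply: exp_ae_eq.
  - exact: (pfam_bm (pfam_prod_kmeas dd bV z) mB).
  - exact: bm_section.
  - have : {ae nu2, forall K, forall i : 'I_n, same_measure (kmeas (q K) (z i)) (kmeas K (z i))}.
      exact: (@ae_countable _ _ _ nu2 'I_n (fun i K =>
        same_measure (kmeas (q K) (z i)) (kmeas K (z i)))).
    apply: filterS => K hK; rewrite pprod_box//; apply: eq_bigr => i _.
    by rewrite hK.
have bg : bm (fun z : borel (power M n) => \int[nu2]_L H (z, L)).
  by apply: (@pfam_exp2 _ _ _ _ _ (fun=> nu2) H) => //; exact: pfam_cst.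
rewrite (matches_exp bV m1 n0 (fun=> I) bg).
have bKc i : bm (fun K : EE R M => fine (kmeas K (x i) (A i))).
  exact: (pfam_bm (pfam_kmeas bV (x i)) (mA i)).
have bK : bm (fun K : EE R M => \prod_i fine (kmeas K (x i) (A i))) by exact: bm_prod.
rewrite (exp_push _ measurable_conv bK).
rewrite [RHS](exp_fubini nu1 nu2 (bm_comp measurable_conv bK)).
apply: eq_Rintegral => K _; rewrite exp_fubini_swap//.
apply: eq_Rintegral => L _.
rewrite (exp_pprod dd (fun i => kmeas K (x i)) (f := fun i y => fine (kmeas (q L) y (A i)))).
  by apply: eq_bigr => i _; rewrite kernel_comp_fine.
by move=> i; exact: (pfam_bm (pfam_kernel bV (q L)) (mA i)).
Qed.

End convolutions.

(** * Limits in probability *)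

Lemma cvge0 (R : realType) (T : Type) (F : set_system T) (u : T -> \bar R) :
  (forall A B, A `<=` B -> F A -> F B) ->
  (forall e : R, 0 < e -> F [set x | (0 <= u x <= e%:E)%E]) -> u @ F --> 0%E.
Proof.
move=> FS h U [e /= e0 eU].
have e2 : 0 < e / 2 by rewrite divr_gt0.
apply: FS (h _ e2) => x /= /andP[].
case: (u x) => [a|//|//]; rewrite !lee_fin => a0 ae; apply: eU.
by rewrite /= sub0r normrN ger0_norm// (le_lt_trans ae)// ltr_pdivrMr// ltr_pMr// ltr1n.
Qed.

Lemma chebyshev_exp (R : realType) d (T : measurableType d) (nu : probability T R) (g : T -> R) e :
  bm g -> 0 < e -> (nu [set x | e <= `|g x|]%R <= (e ^- 2 * \int[nu]_x (g x ^+ 2))%:E)%E.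
Proof.
move=> bg e0; have mA : measurable [set x | e <= `|g x|]%R.
  rewrite (_ : mkset _ = (fun x => `|g x|) @^-1` `[e, +oo[).
    have := (bm_norm bg).1 measurableT _ (@measurable_itv R `[e, +oo[).
    by rewrite setTI.
  by apply/seteqP; split => x; rewrite /preimage/= in_itv/= andbT.
rewrite -(prob_fineK nu mA) lee_fin -(exp_indic nu mA) -expZ; last exact: bmX.
apply: exp_le; [exact: bm_indic|by apply: bmZ; exact: bmX|move=> x].
rewrite indicE; have [hx|hx] := boolP (_ \in _); last first.
  by rewrite mulr_ge0 ?sqr_ge0// invr_ge0 exprn_ge0// ltW.
rewrite inE /= in hx.
rewrite mulrC ler_pdivlMr ?exprn_gt0// mul1r -[g x ^+ 2]real_normK ?num_real//.
by rewrite lerXn2r ?nnegrE// ltW.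
Qed.

Section limits.
Context {R : realType} {M : pmetricType R}.
Variable d : nat -> M.
Hypothesis dd : dense_seq d.
Variables (c : nat -> M) (r : nat -> R).
Hypothesis bV : base_seq (bal c r).
Variable P : forall n, R -> R.-pker (borel (power M n)) ~> (borel (power M n)).
Hypothesis cP : consistent_feller P.
Variable nu : R -> probability (EE R M) R.
Hypothesis mnu : forall t, 0 <= t -> matches dd P t (nu t) setT.
Variable f : M -> R.
Hypothesis C0f : C0 f.

Let bf : bm (f : borel M -> R) := bm_C0 C0f.

Let f2 : feller (P 2).
Proof. exact: (cP.1 2). Qed.

Let C0_proj1 : C0 (fun z : power M 1 => f (z ord0)).
Proof.
have /C0P[cf hf] := C0f; apply/C0P; split.
  move=> z; apply: (@continuous_comp _ _ _ (fun z : power M 1 => z ord0) f).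
    exact: proj_continuous.
  exact: cf.
move=> e e0; have [C cC hC] := hf e e0.
exists [set z : power M 1 | forall i, C (z i)].
  exact: (@tychonoff _ (fun _ : 'I_1 => M) (fun=> C)).
by move=> z /existsNP[i Ci]; apply: hC; rewrite (ord1 i) in Ci.
Qed.

Lemma second_moment t x y : 0 <= t ->
  \int[nu t]_K (kact K f x * kact K f y) = \int[P 2 t (pair2 x y)]_z tensor2 f z.
Proof. by move=> t0; rewrite (matches2 bV (mnu t0) I I bf). Qed.

Lemma variance_small e : 0 < e -> exists2 s, 0 < s &
  forall t x, 0 <= t < s -> \int[nu t]_K ((kact K f x - f x) ^+ 2) <= e.
Proof.
move=> e0; have [b b0 fb] := C0_bounded C0f.
(* The mean square is a second-order error minus [2 * f x] times a first-order error; bounding both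
   errors by eta gives eta + 2 b eta = e. *)
pose eta := e / (1 + 2 * b).
have b1 : 0 < 1 + 2 * b by rewrite addr_gt0// mulr_gt0.
have eta0 : 0 < eta by rewrite divr_gt0.
have [s1 s10 h1] := feller_small (cP.1 1 isT) C0_proj1 eta0.
have [s2 s20 h2] := feller_small f2 (C0_tensor2 C0f) eta0.
exists (Num.min s1 s2) => [|t x]; first by rewrite lt_min s10.
rewrite lt_min => /and3P[t0 ts1 ts2].
have {}h1 := h1 t (fun=> x) (_ : 0 <= t < s1); rewrite t0 in h1.
have {}h2 := h2 t (pair2 x x) (_ : 0 <= t < s2); rewrite t0 in h2.
have {}h1 := h1 ts1; have {}h2 := h2 ts2.
have bK := bm_kact bV x bf.
have -> : \int[nu t]_K ((kact K f x - f x) ^+ 2) =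
    \int[P 2 t (pair2 x x)]_z tensor2 f z - (2 * f x) * \int[P 1 t (fun=> x)]_z f (z ord0) + f x ^+ 2.
  rewrite -second_moment// (matches1 bV (mnu t0) I bf) -[X in _ + X](exp_cst (nu t)).
  have bKK : bm (fun K : EE R M => kact K f x * kact K f x) by exact: bmM.
  rewrite -expZ// -expB//; last exact: bmZ.
  rewrite -expD//; [|by apply: bmB => //; exact: bmZ|exact: bm_cst].
  by apply: eq_Rintegral => K _; ring.
have {}h2 : `|\int[P 2 t (pair2 x x)]_z tensor2 f z - f x * f x| <= eta by [].
set a := \int[_]__ _ in h2 *; set p := \int[_]__ _ in h1 *.
rewrite (_ : _ + _ = (a - f x * f x) - (2 * f x) * (p - f x)); last by ring.
rewrite (le_trans (ler_norm _))// (le_trans (ler_normB _ _))//.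
rewrite (_ : e = eta + 2 * b * eta); last by rewrite /eta; field; rewrite gt_eqF.
rewrite lerD// normrM ler_pM// normrM ger0_norm// ler_pM2l//.
Qed.

Lemma strong_continuity e : 0 < e ->
  ereal_sup (range (fun x : M => nu t [set K | e <= `|kact K f x - f x|])) @[t --> 0^'+] --> 0%E.
Proof.
move=> e0; apply: cvge0 => [A B AB|a a0]; first exact: filterS.
(* Chebyshev's inequality divides by e ^ 2, so a mean square of at most e ^ 2 a leaves a. *)
have [s s0 hs] := variance_small (mulr_gt0 (exprn_gt0 2 e0) a0).
exists s => //= t; rewrite /= sub0r normrN => ts t0; rewrite gtr0_norm// in ts.
apply/andP; split.
  apply: (@le_trans _ _ (nu t [set K | e <= `|kact K f point - f point|])) => //.
  by apply: ereal_sup_ubound; exists point.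
apply: ge_ereal_sup => _ [x _ <-].
have bK : bm (fun K : EE R M => kact K f x - f x).
  by apply: bmB; [exact: (bm_kact bV)|exact: bm_cst].
apply: le_trans (chebyshev_exp (nu t) bK e0) _.
by rewrite lee_fin mulrC ler_pdivrMr ?exprn_gt0// mulrC hs// ltW.
Qed.

Lemma continuity_in_probability t x e : 0 <= t -> 0 < e ->
  nu t [set K | e <= `|kact K f y - kact K f x|] @[y --> x] --> 0%E.
Proof.
move=> t0 e0; apply: cvge0 => [A B AB|a a0]; first exact: filterS.
have := gap_small f2 x t C0f (mulr_gt0 (exprn_gt0 2 e0) a0).
apply: filterS => y /(_ t); rewrite t0 lexx => /(_ isT) hy.
apply/andP; split => //.
have bK : bm (fun K : EE R M => kact K f y - kact K f x) by apply: bmB; exact: (bm_kact bV).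
apply: le_trans (chebyshev_exp (nu t) bK e0) _.
rewrite lee_fin mulrC ler_pdivrMr ?exprn_gt0// mulrC.
apply: le_trans hy; rewrite (matches_gap bV (mnu t0) I I bf).
rewrite le_eqVlt; apply/orP; left; apply/eqP; apply: eq_Rintegral => K _.
by rewrite -sqrrN opprB.
Qed.

Lemma vanishing_in_probability t e : 0 <= t -> 0 < e ->
  nu t [set K | e <= `|kact K f y|] @[y --> infty_nbhs M] --> 0%E.
Proof.
move=> t0 e0; apply: cvge0 => [A B AB [C cC CA]|a a0].
  by exists C => // x /CA /AB.
have [_ _ /(_ t t0 _ (C0_tensor2 C0f))/C0P[_ hP] _] := f2.
have [C cC hC] := hP _ (mulr_gt0 (exprn_gt0 2 e0) a0).
(* If y is outside the projection of C, then (y, y) is outside C; the projection is compact as a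
   continuous image. *)
exists ((fun z : power M 2 => z ord0) @` C).
  apply: continuous_compact => //; apply: continuous_subspaceT.
  exact: proj_continuous.
move=> y Cy; apply/andP; split => //.
have {}Cy : ~ C (pair2 y y) by move=> h; apply: Cy; exists (pair2 y y).
apply: le_trans (chebyshev_exp (nu t) (bm_kact bV y bf) e0) _.
rewrite lee_fin mulrC ler_pdivrMr ?exprn_gt0// mulrC.
apply: le_trans (ltW (hC _ Cy)).
rewrite -second_moment// ger0_norm; last by apply: Rintegral_ge0 => // K _; exact: sqr_ge0.
by under eq_Rintegral do rewrite expr2.
Qed.

End limits.

(** * The representation formula and the conclusion *)

Lemma matches_represents (R : realType) (M : pmetricType R) (d : nat -> M)
    (dd : dense_seq d)
    (c : nat -> M) (r : nat -> R) (bV : base_seq (bal c r))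
    (P : forall n, R -> R.-pker (borel (power M n)) ~> (borel (power M n)))
    t (nu : probability (EE R M) R) :
  matches dd P t nu setT <->
  forall n (x : power M n) (B : set (borel (power M n))), (1 <= n)%N -> measurable B ->
    P n t x B = (\int[nu]_K prod_prob (fun i => kmeas K (x i)) B)%E.
Proof.
have e n (x : power M n) (B : set (borel (power M n))) : measurable B ->
    (\int[nu]_K fine (pprod dd (fun i => kmeas K (x i)) B))%:E =
    (\int[nu]_K prod_prob (fun i => kmeas K (x i)) B)%E.
  move=> mB; rewrite exp_EFin; last exact: (pfam_bm (pfam_prod_kmeas dd bV x) mB).
  by apply: eq_integral => K _; rewrite prob_fineK// pprodE.
split=> [h n x B n0 mB|h n x n0 _ B mB].
  by rewrite -e// -h// (prob_fineK (kprob (P n t) x) mB).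
by rewrite h// -e.
Qed.

Unset Implicit Arguments.

Theorem theorem2p1 (R : realType) (M : pmetricType R)
    (P : forall n, R -> R.-pker (borel (power M n)) ~> (borel (power M n))) :
  locally_compact [set: M] -> separable M -> consistent_feller P ->
  let represents (nu : R -> probability (EE R M) R) :=
    forall n (x : power M n) (B : set (borel (power M n))) (t : R),
      (1 <= n)%N -> measurable B -> 0 <= t ->
      P n t x B = (\int[nu t]_K prod_prob (fun i => kmeas K (x i)) B)%E in
  exists nu : R -> probability (EE R M) R,
    [/\ feller_convolution_semigroup nu, represents nu,
        forall nu' : R -> probability (EE R M) R,
          feller_convolution_semigroup nu' -> represents nu' ->
          forall t, 0 <= t -> same_measure (nu' t) (nu t)
      & exists p : EE R M -> EE R M,
          (forall t, 0 <= t -> measurable_presentation (nu t) p) /\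
          (forall K, same_kernel (p (p K)) (p K))].
Proof.
move=> lM sM cP represents.
have [d dd] := separable_dense_seq sM.
have [c [r [bV cV]]] := compact_base dd lM.
have f2 : feller (P 2) := cP.1 2 isT.
have /choice[nu mnu] : forall t, exists nu : probability (EE R M) R, 0 <= t -> matches dd P t nu setT.
  (* The family is indexed by all reals; negative times receive a Dirac mass as a default. *)
  move=> t; have [t0|t0] := leP 0 t; last by exists (\d_point).
  by have [nu mnu] := matches_setT dd lM bV cV cP f2 t0; exists nu.
have mpres t (t0 : 0 <= t) := matches_presentation lM bV cV f2 t0 (mnu t t0).
exists nu; split.
- split.
  + by move=> t t0; exists (pres dd lM bV cV f2); exact: mpres.
  + move=> t s t0 s0 q hq.
    have mconv := matches_convolution bV cP hq.1 t0 s0 (mnu t t0) (mnu s s0) hq.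
    exact: (matches_unique bV mconv (mnu _ (addr_ge0 t0 s0))).
  + by move=> f C0f e e0; exact: (strong_continuity bV cP mnu C0f e0).
  + move=> f C0f t t0 x e e0; split.
      exact: (continuity_in_probability bV cP mnu C0f x t0 e0).
    exact: (vanishing_in_probability bV cP mnu C0f t0 e0).
- move=> n x B t n0 mB t0.
  by have /(matches_represents dd bV) h := mnu t t0; exact: h.
- move=> nu' _ rep t t0; apply: (matches_unique bV _ (mnu t t0)).
  by apply/(matches_represents dd bV) => n x B n0 mB; exact: rep.
- exists (pres dd lM bV cV f2); split; first exact: mpres.
  exact: pres_idem.
Qed.
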